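(* Let $A$ and $B$ be C$^*$-algebras and let $w\in C_0((0,1])$ be the function $w(z)=z$. If $T:A\to B$ is a contractive completely orthogonality preserving bounded linear operator, then there exists a TRO homomorphism $\Phi_T:C_0((0,1])\otimes A\to B$ such that $\Phi_T(w\otimes a)=T(a)$ for all $a\in A$. Conversely, any TRO homomorphism $\Phi:C_0((0,1])\otimes A\to B$ induces a contractive completely orthogonality preserving operator $T_\Phi:A\to B$ via $T_\Phi(a):=\Phi(w\otimes a)$. Moreover, the mappings $T\mapsto\Phi_T$ and $\Phi\mapsto T_\Phi$ are mutual inverses.
   Context: Two elements $a,b$ of a C$^*$-algebra are orthogonal, written $a\perp b$, if $ab^*=b^*a=0$. A linear map $T:A\to B$ between C$^*$-algebras is completely orthogonality preserving if for every $n\in\mathbb{N}$ the amplification $T_n:M_n(A)\to M_n(B)$, $T_n((a_{i,j}))=(T(a_{i,j}))$, satisfies: $x\perp y$ implies $T_n(x)\perp T_n(y)$. A linear map $\Phi$ between C$^*$-algebras is a TRO homomorphism if $\Phi(xy^*z)=\Phi(x)\Phi(y)^*\Phi(z)$ for all $x,y,z$. $C_0((0,1])$ is the C$^*$-algebra of continuous complex-valued functions on $(0,1]$ vanishing at $0$, and $C_0((0,1])\otimes A$ is the C$^*$-algebra tensor product (the C$^*$-norm is unique since $C_0((0,1])$ is nuclear). *)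

(* Defs.v *)
From HB Require Import structures.
From mathcomp Require Import all_boot all_order all_algebra complex.
From mathcomp Require Import boolp classical_sets functions set_interval.
From mathcomp Require Import reals topology normedtype derive realfun.
From mathcomp Require Import lra.

Set Implicit Arguments.
Unset Strict Implicit.
Unset Printing Implicit Defensive.

Import Order.TTheory GRing.Theory Num.Theory numFieldNormedType.Exports.

Local Open Scope classical_set_scope.
Local Open Scope ring_scope.

(* Complex C*-algebras, not assumed unital.  As in every [normedModType R[i]],
   the norm takes its values in the nonnegative reals of [R[i]]. *)
HB.mixin Record isCStarAlgebra (R : realType) (A : Type)
    & CompleteNormedModule R[i] A := {
  cmul : A -> A -> A;
  cstar : A -> A;
  cmulA : associative cmul;
  cmulDl : left_distributive cmul +%R;
  cmulDr : right_distributive cmul +%R;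
  cmulZl : forall (k : R[i]) x y, cmul (k *: x) y = k *: cmul x y;
  cmulZr : forall (k : R[i]) x y, cmul x (k *: y) = k *: cmul x y;
  cstarD : {morph cstar : x y / x + y};
  cstarZ : forall (k : R[i]) x, cstar (k *: x) = (Num.conj k) *: cstar x;
  cstarM : forall x y, cstar (cmul x y) = cmul (cstar y) (cstar x);
  cstarK : involutive cstar;
  cnormM : forall x y, `|cmul x y| <= `|x| * `|y|;
  cnorm_star : forall x, `|cmul (cstar x) x| = `|x| ^+ 2
}.

#[short(type="cstarAlgType")]
HB.structure Definition CStarAlgebra (R : realType) :=
  {A of isCStarAlgebra R A & CompleteNormedModule R[i] A}.

Section RealNorm.
Context {R : realType} {V : normedModType R[i]}.
Implicit Types x y : V.

Definition rnorm x : R := complex.Re `|x|.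

Lemma rnormE x : `|x| = real_complex R (rnorm x).
Proof.
have := normr_ge0 x; rewrite /rnorm lecE; case: `|x| => a b /= /andP[/eqP b0 _].
by rewrite b0.
Qed.

Lemma rnorm_ge0 x : 0 <= rnorm x.
Proof. by rewrite -ler0c -rnormE. Qed.

Lemma rnorm0 : rnorm 0 = 0.
Proof. by rewrite /rnorm normr0. Qed.

Lemma rnorm0_eq0 x : rnorm x = 0 -> x = 0.
Proof. by move=> x0; apply/normr0_eq0; rewrite rnormE x0. Qed.

Lemma rnormN x : rnorm (- x) = rnorm x.
Proof. by rewrite /rnorm normrN. Qed.

Lemma ler_rnormD x y : rnorm (x + y) <= rnorm x + rnorm y.
Proof. by rewrite -lecR rmorphD /= -!rnormE ler_normD. Qed.

Lemma rnormB x y : rnorm (x - y) = rnorm (y - x).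
Proof. by rewrite -rnormN opprB. Qed.

Lemma ler_rnormB x y : rnorm x - rnorm y <= rnorm (x - y).
Proof. by rewrite lerBlDr -{1}(subrK y x) ler_rnormD. Qed.

Lemma rnormZ (k : R[i]) x : rnorm (k *: x) = complex.Re `|k| * rnorm x.
Proof.
apply: complexI; rewrite rmorphM /= -!rnormE normrZ.
by rewrite (RRe_real (normr_real k)).
Qed.

Lemma cvg_rnormP {T} (F : set_system T) {FF : Filter F} (f : T -> V) (l : V) :
  f @ F --> l <-> forall e : R, 0 < e -> \forall t \near F, rnorm (l - f t) < e.
Proof.
split=> [/cvgrPdist_lt fl e e0|fl].
  near do rewrite -ltcR -rnormE.
  by apply: fl; rewrite ltcR.
apply/cvgrPdist_lt => -[e i]; rewrite ltcE /= => /andP[/eqP -> e0].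
by near do rewrite rnormE ltcR; exact: fl.
Unshelve. all: by end_near. Qed.

Lemma cauchy_rnormP (F : set_system V) {FF : ProperFilter F} :
  cauchy F <-> forall e : R, 0 < e -> exists x, \forall y \near F, rnorm (x - y) < e.
Proof.
split=> [/cauchyP cF e e0|cF].
  have e0' : 0 < real_complex R e by rewrite ltcR.
  have [x Fx] := cF _ e0'; exists x; apply: filterS Fx => y.
  by rewrite -ball_normE /= rnormE ltcR.
apply/cauchyP => -[e i]; rewrite ltcE /= => /andP[/eqP -> e0].
have [x Fx] := cF _ e0; exists x; apply: filterS Fx => y.
by rewrite -ball_normE /= rnormE ltcR.
Qed.

End RealNorm.

Section ComplexNumbers.
Context {R : realType}.

HB.instance Definition _ := NormedModule.copy R[i] R[i]^o.

Lemma rnorm_complex (z : R[i]) :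
  rnorm z = Num.sqrt (complex.Re z ^+ 2 + complex.Im z ^+ 2).
Proof. by rewrite /rnorm normc_def. Qed.

Lemma ler_Re_rnorm (z : R[i]) : `|complex.Re z| <= rnorm z.
Proof.
by rewrite rnorm_complex -sqrtr_sqr ler_wsqrtr// lerDl sqr_ge0.
Qed.

Lemma ler_Im_rnorm (z : R[i]) : `|complex.Im z| <= rnorm z.
Proof.
by rewrite rnorm_complex -sqrtr_sqr ler_wsqrtr// lerDr sqr_ge0.
Qed.

Lemma rnorm_le_ReIm (z : R[i]) :
  rnorm z <= `|complex.Re z| + `|complex.Im z|.
Proof.
rewrite rnorm_complex -[leRHS]ger0_norm ?addr_ge0// -sqrtr_sqr ler_wsqrtr//.
rewrite sqrrD !real_normK ?num_real// lerD2r lerDl.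
by rewrite mulrn_wge0// mulr_ge0.
Qed.

Lemma complex_complete (F : set_system R[i]) :
  ProperFilter F -> cauchy F -> cvg F.
Proof.
move=> FF /cauchy_rnormP cF.
have ReB (x y : R[i]) : complex.Re (x - y) = complex.Re x - complex.Re y.
  by case: x y => [? ?] [].
have ImB (x y : R[i]) : complex.Im (x - y) = complex.Im x - complex.Im y.
  by case: x y => [? ?] [].
have [a Fa] : exists a : R, @complex.Re R @ F --> a.
  apply/cvg_ex; apply: R_complete; apply/cauchyP => e e0.
  have [x Fx] := cF _ e0; exists (complex.Re x); apply: filterS Fx => y /=.
  by rewrite -ball_normE /= -ReB; apply: le_lt_trans; exact: ler_Re_rnorm.
have [b Fb] : exists b : R, @complex.Im R @ F --> b.
  apply/cvg_ex; apply: R_complete; apply/cauchyP => e e0.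
  have [x Fx] := cF _ e0; exists (complex.Im x); apply: filterS Fx => y /=.
  by rewrite -ball_normE /= -ImB; apply: le_lt_trans; exact: ler_Im_rnorm.
apply/cvg_ex; exists (Complex a b); apply/(@cvg_rnormP R R[i]) => e e0.
have e20 : 0 < e / 2 by rewrite divr_gt0.
near=> z; apply: (le_lt_trans (rnorm_le_ReIm _)); rewrite ReB ImB /=.
by rewrite [ltRHS]splitr ltrD//; near: z;
  [exact: (cvgrPdist_lt _ _).1 Fa _ e20|exact: (cvgrPdist_lt _ _).1 Fb _ e20].
Unshelve. all: by end_near. Qed.

HB.instance Definition _ := Uniform_isComplete.Build R[i] complex_complete.

Let cmulA (x y z : R[i]) : x * (y * z) = x * y * z. Proof. exact: mulrA. Qed.
Let cmulDl (x y z : R[i]) : (x + y) * z = x * z + y * z.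
Proof. exact: mulrDl. Qed.
Let cmulDr (x y z : R[i]) : x * (y + z) = x * y + x * z.
Proof. exact: mulrDr. Qed.
Let cmulZl (k : R[i]) (x y : R[i]) : (k *: x) * y = k *: (x * y).
Proof. exact/esym/mulrA. Qed.
Let cmulZr (k : R[i]) (x y : R[i]) : x * (k *: y) = k *: (x * y).
Proof. exact: mulrCA. Qed.
Let cstarD : {morph (@Num.conj R[i]) : x y / x + y}.
Proof. exact: rmorphD. Qed.
Let cstarZ (k x : R[i]) : Num.conj (k *: x) = Num.conj k *: Num.conj x.
Proof. exact: rmorphM. Qed.
Let cstarM (x y : R[i]) : Num.conj (x * y) = Num.conj y * Num.conj x.
Proof. by rewrite mulrC; exact: rmorphM. Qed.
Let cnormM (x y : R[i]) : `|x * y| <= `|x| * `|y|.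
Proof. by rewrite normrM. Qed.
Let cnorm_star (x : R[i]) : `|Num.conj x * x| = `|x| ^+ 2.
Proof. by rewrite normrM norm_conjC expr2. Qed.

HB.instance Definition _ := @isCStarAlgebra.Build R R[i]
  *%R (@Num.conj R[i]) cmulA cmulDl cmulDr cmulZl cmulZr
  cstarD cstarZ cstarM (@conjCK R[i]) cnormM cnorm_star.

End ComplexNumbers.

Section CStarTopology.
Context {R : realType} {A : cstarAlgType R}.
Implicit Types x y : A.

Lemma cmul0l x : cmul 0 x = 0.
Proof. by have := cmulZl 0 0 x; rewrite !scale0r. Qed.

Lemma cmul0r x : cmul x 0 = 0.
Proof. by have := cmulZr 0 x 0; rewrite !scale0r. Qed.

Lemma cmulNl x y : cmul (- x) y = - cmul x y.
Proof. by rewrite -scaleN1r cmulZl scaleN1r. Qed.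

Lemma cmulNr x y : cmul x (- y) = - cmul x y.
Proof. by rewrite -scaleN1r cmulZr scaleN1r. Qed.

Lemma cstar0 : cstar (0 : A) = 0.
Proof. by have := cstarZ 0 (0 : A); rewrite rmorph0 !scale0r. Qed.

Lemma cstarN x : cstar (- x) = - cstar x.
Proof. by rewrite -scaleN1r cstarZ rmorphN rmorph1 scaleN1r. Qed.

Lemma cnormS x : `|cstar x| = `|x|.
Proof.
have le (y : A) : `|y| <= `|cstar y|.
  have [->|y0] := eqVneq y 0; first by rewrite cstar0.
  have y_gt0 : 0 < `|y| by rewrite normr_gt0.
  by rewrite -(ler_pM2r y_gt0) -expr2 -cnorm_star cnormM.
by apply/le_anti; rewrite le (le_trans (le (cstar x)))// cstarK.
Qed.

Lemma rnormM x y : rnorm (cmul x y) <= rnorm x * rnorm y.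
Proof. by rewrite -lecR rmorphM /= -!rnormE cnormM. Qed.

Lemma rnormS x : rnorm (cstar x) = rnorm x.
Proof. by rewrite /rnorm cnormS. Qed.

Lemma rnorm_star x : rnorm (cmul (cstar x) x) = rnorm x ^+ 2.
Proof. by apply: complexI; rewrite rmorphXn /= -!rnormE cnorm_star. Qed.

Section Cvg.
Context {T : Type} {F : set_system T} {FF : Filter F}.
Implicit Types f g : T -> A.

Lemma cvg_cstar f l : f @ F --> l -> cstar (f t) @[t --> F] --> cstar l.
Proof.
move=> /cvg_rnormP fl; apply/cvg_rnormP => e e0.
by apply: filterS (fl _ e0) => t; rewrite -cstarN -cstarD rnormS.
Qed.

Lemma cvg_cmul f g l m : f @ F --> l -> g @ F --> m ->
  cmul (f t) (g t) @[t --> F] --> cmul l m.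
Proof.
move=> /cvg_rnormP fl /cvg_rnormP gm; apply/cvg_rnormP => e e0.
have l0 := rnorm_ge0 l; have m0 := rnorm_ge0 m.
have m10 : 0 < rnorm m + 1 by rewrite ltr_wpDl.
have l10 : 0 < rnorm l + 1 by rewrite ltr_wpDl.
have e20 : 0 < e / 2 by rewrite divr_gt0.
near=> t.
have -> : cmul l m - cmul (f t) (g t) =
    cmul (l - f t) (g t) + cmul l (m - g t).
  by rewrite cmulDl cmulDr cmulNl cmulNr [RHS]addrC addrA subrK.
apply: (le_lt_trans (ler_rnormD _ _)).
rewrite [ltRHS]splitr ltr_leD//.
- apply: (le_lt_trans (rnormM _ _)).
  have gt1 : rnorm (g t) <= rnorm m + 1.
    rewrite -lerBlDl (le_trans (ler_rnormB _ _))// rnormB ltW//.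
    by near: t; exact: gm.
  apply: (le_lt_trans (ler_wpM2l (rnorm_ge0 _) gt1)).
  by rewrite -ltr_pdivlMr//; near: t; apply: fl; rewrite divr_gt0.
- apply: (le_trans (rnormM _ _)).
  apply: (@le_trans _ _ ((rnorm l + 1) * rnorm (m - g t))).
    by rewrite ler_wpM2r ?rnorm_ge0// lerDl.
  rewrite mulrC -ler_pdivlMr// ltW//; near: t; apply: gm.
  by rewrite divr_gt0.
Unshelve. all: by end_near. Qed.

End Cvg.
End CStarTopology.

(* [cone A] is C_0((0,1], A), the C*-algebra of continuous A-valued functions
   on (0,1] vanishing at 0.  Its elements are carried by total functions on R
   which are extended by 0 outside (0,1], so that equality of functions on
   (0,1] is Leibniz equality. *)
Section Cone.
Context {R : realType}.

Section Carrier.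
Variable A : cstarAlgType R.

Definition cone_pred : {pred R -> A} := fun f =>
  `[< [/\ {within `]0, 1], continuous f},
          f t @[t --> 0^'+] --> (0 : A) &
          forall t, t \notin `]0, 1] -> f t = 0] >].

Record cone := Cone { cone_fun :> R -> A ; _ : cone_fun \in cone_pred }.

HB.instance Definition _ := [isSub for cone_fun].
HB.instance Definition _ := [Choice of cone by <:].

Lemma conePred_submod : submod_closed cone_pred.
Proof.
split=> [|k f g].
  apply/asboolP; split=> //; last exact: cvg_cst.
  by apply/subspace_continuousP => t _; exact: cvg_cst.
move=> /asboolP[/subspace_continuousP fc f0 fz].
move=> /asboolP[/subspace_continuousP gc g0 gz].
apply/asboolP; split.
- apply/subspace_continuousP => t t01; apply: cvgD; last exact: gc.
  by apply: cvgZl_tmp; exact: fc.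
- rewrite -[X in _ --> X]addr0; apply: cvgD => //.
  by rewrite -(scaler0 _ k); exact: cvgZl_tmp.
- by move=> t t01; rewrite !fctE fz// gz// scaler0 addr0.
Qed.

HB.instance Definition _ :=
  GRing.isSubmodClosed.Build R[i] (R -> A) cone_pred conePred_submod.
HB.instance Definition _ := [SubChoice_isSubLmodule of cone by <:].

Lemma coneP (f : R -> A) : reflect
  [/\ {within `]0, 1], continuous f}, f t @[t --> 0^'+] --> (0 : A) &
      forall t, t \notin `]0, 1] -> f t = 0] (f \in cone_pred).
Proof. exact: asboolP. Qed.

Implicit Types f g : cone.

Lemma cone_out f t : t \notin `]0, 1] -> f t = 0.
Proof. by case: f => f /= /coneP[_ _]; exact. Qed.

Lemma cone_within f : {within `[0, 1], continuous f}.
Proof.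
have /coneP[/subspace_continuousP fc f0 fz] : cone_fun f \in cone_pred.
  exact: valP.
apply/subspace_continuousP => x; rewrite /= in_itv/= => /andP[].
rewrite le_eqVlt => /predU1P[<- _|x0 x1]; last first.
  have x01 : x \in `]0, 1] by rewrite in_itv/= x0 x1.
  apply/cvg_rnormP => e e0.
  have /cvg_rnormP/(_ _ e0) := fc _ x01; rewrite !near_withinE => H.
  near=> t => /=; rewrite in_itv/= => /andP[_ t1].
  have t01 : t \in `]0, 1].
    by rewrite in_itv/= t1 andbT; near: t; exact: lt_nbhsr.
  by move: t01; near: t; exact: H.
rewrite /from_subspace fz ?in_itv/= ?ltxx//; apply/cvg_rnormP => e e0.
move/cvg_rnormP : f0 => /(_ _ e0); rewrite !near_withinE; apply: filterS => t H.
rewrite /= in_itv/= => /andP[]; rewrite le_eqVlt => /predU1P[<- _|]; last first.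
  by move=> ? _; exact: H.
by rewrite fz ?in_itv/= ?ltxx// subrr rnorm0.
Unshelve. all: by end_near. Qed.

Definition cone_sup f : R := sup [set rnorm (f t) | t in `]0, 1]%classic].

Let cone_nonempty f : [set rnorm (f t) | t in `]0, 1]%classic] !=set0.
Proof. by exists (rnorm (f 1)), 1 => //=; rewrite in_itv/= ltr01 lexx. Qed.

Let cone_ubound f : has_ubound [set rnorm (f t) | t in `]0, 1]%classic].
Proof.
have [||c c01 fmax] := @EVT_max R (fun t => rnorm (f t)) 0 1.
- exact: ler01.
- apply/subspace_continuousP => x x01; apply/cvgrPdist_lt => e e0.
  have /subspace_continuousP/(_ _ x01)/cvg_rnormP/(_ _ e0) := @cone_within f.
  apply: filterS => t; apply: le_lt_trans; rewrite ler_norml ler_rnormB andbT.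
  by rewrite lerNl opprB rnormB ler_rnormB.
- exists (rnorm (f c)) => _ [t /= t01 <-]; apply: fmax.
  by move: t01; rewrite !in_itv/= => /andP[/ltW-> ->].
Qed.

Lemma rnorm_le_sup f t : rnorm (f t) <= cone_sup f.
Proof.
have [t01|t01] := boolP (t \in `]0, 1]).
  by apply: ub_le_sup; [exact: cone_ubound|exists t].
rewrite cone_out// rnorm0; apply: le_trans (rnorm_ge0 (f 1)) _.
apply: ub_le_sup; first exact: cone_ubound.
by exists 1 => //=; rewrite in_itv/= ltr01 lexx.
Qed.

Lemma cone_sup_le f M :
  (forall t, t \in `]0, 1] -> rnorm (f t) <= M) -> cone_sup f <= M.
Proof. by move=> fM; apply: ge_sup => // _ [t t01 <-]; exact: fM. Qed.

Lemma cone_sup_ge0 f : 0 <= cone_sup f.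
Proof. exact: le_trans (rnorm_ge0 _) (rnorm_le_sup f 0). Qed.

Let cone_normD f g : real_complex R (cone_sup (f + g)) <=
  real_complex R (cone_sup f) + real_complex R (cone_sup g).
Proof.
rewrite -rmorphD lecR; apply: cone_sup_le => t _ /=.
by rewrite (le_trans (ler_rnormD _ _))// lerD// rnorm_le_sup.
Qed.

Let cone_normZ (k : R[i]) f : real_complex R (cone_sup (k *: f)) =
  `|k| * real_complex R (cone_sup f).
Proof.
rewrite -(RRe_real (normr_real k)) -rmorphM; congr (real_complex R _).
have k0 : 0 <= complex.Re `|k| by rewrite -ler0c (RRe_real (normr_real k)).
apply/le_anti/andP; split.
  apply: cone_sup_le => t _ /=.
  by rewrite (rnormZ k (f t)) ler_wpM2l// rnorm_le_sup.
have [k_gt0|k_le0] := ltP 0 (complex.Re `|k|); last first.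
  have -> : complex.Re `|k| = 0 by apply/le_anti; rewrite k0 k_le0.
  by rewrite mul0r cone_sup_ge0.
rewrite -ler_pdivlMl//; apply: cone_sup_le => t _.
by rewrite ler_pdivlMl// -(rnormZ k (f t)) (rnorm_le_sup (k *: f)).
Qed.

Let cone_norm0 f : real_complex R (cone_sup f) = 0 -> f = 0.
Proof.
move=> /complexI f0; apply/val_inj/funext => t /=; apply: rnorm0_eq0.
by apply/le_anti; rewrite rnorm_ge0 andbT -f0 rnorm_le_sup.
Qed.

HB.instance Definition _ := @Lmodule_isNormed.Build R[i] cone
  (fun f => real_complex R (cone_sup f)) cone_normD cone_normZ cone_norm0.

Lemma cone_normE f : `|f| = real_complex R (cone_sup f).
Proof. by []. Qed.

Lemma cone_rnormE f : rnorm f = cone_sup f.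
Proof. by []. Qed.

Lemma rnorm_eval f t : rnorm (f t) <= rnorm f.
Proof. exact: rnorm_le_sup. Qed.

Lemma cone_cvg f (x : R) : x \in `]0, 1] -> f t @[t --> within `]0, 1] (nbhs x)] --> f x.
Proof.
have /coneP[/subspace_continuousP fc _ _] : cone_fun f \in cone_pred.
  exact: valP.
exact: fc.
Qed.

Lemma cone_cvg0 f : f t @[t --> 0^'+] --> (0 : A).
Proof. by have /coneP[] : cone_fun f \in cone_pred by exact: valP. Qed.

Lemma cone0 f : f 0 = 0.
Proof. by rewrite cone_out// in_itv/= ltxx. Qed.

Lemma cone_complete (F : set_system cone) : ProperFilter F -> cauchy F -> cvg F.
Proof.
move=> FF /cauchy_rnormP cF.
have [g Fg] : exists g : R -> A, forall t, (f : cone) t @[f --> F] --> g t.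
  exists (fun t => lim ((f : cone) t @[f --> F])) => t.
  suff : cvg ((f : cone) t @[f --> F]) by [].
  apply: cauchy_cvg; apply/cauchy_rnormP => e e0.
  have [x Fx] := cF _ e0; exists (x t); apply: filterS Fx => y /=.
  exact/le_lt_trans/(rnorm_eval (x - y)).
have unif e : 0 < e -> \forall f \near F, forall t, rnorm (g t - (f : cone) t) < e.
  move=> e0; have e30 : 0 < e / 3 by rewrite divr_gt0.
  have [x Fx] := cF _ e30; near=> f => t.
  have xf : rnorm (x t - f t) < e / 3.
    by apply: (le_lt_trans (rnorm_eval (x - f) t)); near: f.
  near F => h.
  have xh : rnorm (h t - x t) < e / 3.
    by rewrite rnormB; apply: (le_lt_trans (rnorm_eval (x - h) t)); near: h.
  have gh : rnorm (g t - h t) < e / 3.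
    by near: h; move/cvg_rnormP: (Fg t); exact.
  have -> : g t - f t = (g t - h t) + ((h t - x t) + (x t - f t)).
    by rewrite !addrA !subrK.
  apply: (le_lt_trans (ler_rnormD _ _)).
  have := ler_rnormD (h t - x t) (x t - f t); lra.
have cvg_g (G : set_system R) (FG : Filter G) x :
    (forall f, f t @[t --> G] --> f x) -> g @ G --> g x.
  move=> Gf; apply/cvg_rnormP => e e0.
  have e30 : 0 < e / 3 by rewrite divr_gt0.
  have [f gf] := filter_ex (unif _ e30).
  have /cvg_rnormP/(_ _ e30) := Gf f; apply: filterS => t ft.
  have -> : g x - g t = (g x - f x) + ((f x - f t) + - (g t - f t)).
    by rewrite opprB !addrA !subrK.
  apply: (le_lt_trans (ler_rnormD _ _)).
  have := ler_rnormD (f x - f t) (- (g t - f t)); rewrite rnormN.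
  have := gf x; have := gf t; lra.
have gz t : t \notin `]0, 1] -> g t = 0.
  move=> t01; apply: rnorm0_eq0; apply/le_anti; rewrite rnorm_ge0 andbT.
  apply/ler_addgt0Pl => e e0; rewrite addr0.
  have [f /(_ t)] := filter_ex (unif _ e0).
  by rewrite cone_out// subr0 => /ltW.
have gC : g \in cone_pred.
  apply/coneP; split=> //.
    by apply/subspace_continuousP => x x01; apply: cvg_g => f; exact: cone_cvg.
  rewrite -(gz 0) ?in_itv/= ?ltxx//.
  by apply: cvg_g => f; rewrite cone0; exact: cone_cvg0.
apply/cvg_ex; exists (Cone gC); apply/cvg_rnormP => e e0.
have e20 : 0 < e / 2 by rewrite divr_gt0.
apply: filterS (unif _ e20) => f gf.
apply: (@le_lt_trans _ _ (e / 2)); last by lra.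
by rewrite cone_rnormE; apply: cone_sup_le => t _; rewrite ltW//= gf.
Unshelve. all: by end_near. Qed.

HB.instance Definition _ := Uniform_isComplete.Build cone cone_complete.

Lemma cone_mul_subproof f g : (fun t => cmul (f t) (g t)) \in cone_pred.
Proof.
apply/coneP; split.
- apply/subspace_continuousP => x x01.
  by apply: cvg_cmul; exact: cone_cvg.
- by rewrite -(cmul0l 0); apply: cvg_cmul; exact: cone_cvg0.
- by move=> t t01; rewrite cone_out// cmul0l.
Qed.

Definition cone_mul f g : cone := Cone (cone_mul_subproof f g).

Lemma cone_star_subproof f : (fun t => cstar (f t)) \in cone_pred.
Proof.
apply/coneP; split.
- apply/subspace_continuousP => x x01.
  by apply: cvg_cstar; exact: cone_cvg.
- by rewrite -cstar0; apply: cvg_cstar; exact: cone_cvg0.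
- by move=> t t01; rewrite cone_out// cstar0.
Qed.

Definition cone_star f : cone := Cone (cone_star_subproof f).

Let cone_ext f g : f =1 g -> f = g.
Proof. by move=> fg; apply/val_inj/funext. Qed.

Let cone_mulA : associative cone_mul.
Proof. by move=> f g h; apply: cone_ext => t; exact: cmulA. Qed.
Let cone_mulDl : left_distributive cone_mul +%R.
Proof. by move=> f g h; apply: cone_ext => t; exact: cmulDl. Qed.
Let cone_mulDr : right_distributive cone_mul +%R.
Proof. by move=> f g h; apply: cone_ext => t; exact: cmulDr. Qed.
Let cone_mulZl (k : R[i]) f g : cone_mul (k *: f) g = k *: cone_mul f g.
Proof. by apply: cone_ext => t; exact: cmulZl. Qed.
Let cone_mulZr (k : R[i]) f g : cone_mul f (k *: g) = k *: cone_mul f g.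
Proof. by apply: cone_ext => t; exact: cmulZr. Qed.
Let cone_starD : {morph cone_star : f g / f + g}.
Proof. by move=> f g; apply: cone_ext => t; exact: cstarD. Qed.
Let cone_starZ (k : R[i]) f : cone_star (k *: f) = Num.conj k *: cone_star f.
Proof. by apply: cone_ext => t; exact: cstarZ. Qed.
Let cone_starM f g : cone_star (cone_mul f g) = cone_mul (cone_star g) (cone_star f).
Proof. by apply: cone_ext => t; exact: cstarM. Qed.
Let cone_starK : involutive cone_star.
Proof. by move=> f; apply: cone_ext => t; exact: cstarK. Qed.

Let cone_normM f g : `|cone_mul f g| <= `|f| * `|g|.
Proof.
rewrite !cone_normE -rmorphM lecR; apply: cone_sup_le => t _.
apply: (le_trans (rnormM _ _)).
by apply: ler_pM; rewrite ?rnorm_ge0//; exact: rnorm_le_sup.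
Qed.

Let cone_norm_star f : `|cone_mul (cone_star f) f| = `|f| ^+ 2.
Proof.
rewrite !cone_normE -rmorphXn; congr (real_complex R _); apply/le_anti/andP; split.
  apply: cone_sup_le => t _ /=.
  by rewrite rnorm_star lerXn2r ?nnegrE ?rnorm_ge0 ?cone_sup_ge0// rnorm_le_sup.
have N0 := cone_sup_ge0 (cone_mul (cone_star f) f).
rewrite -[leRHS]sqr_sqrtr// lerXn2r ?nnegrE ?sqrtr_ge0 ?cone_sup_ge0//.
apply: cone_sup_le => t _; rewrite -[leLHS]ger0_norm ?rnorm_ge0//.
rewrite -sqrtr_sqr ler_wsqrtr// -rnorm_star.
exact: (rnorm_le_sup (cone_mul (cone_star f) f)).
Qed.

HB.instance Definition _ := @isCStarAlgebra.Build R cone cone_mul cone_star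
  cone_mulA cone_mulDl cone_mulDr cone_mulZl cone_mulZr
  cone_starD cone_starZ cone_starM cone_starK cone_normM cone_norm_star.

End Carrier.

Lemma cone_real_subproof (phi : R -> R) : continuous phi -> phi 0 = 0 ->
  (fun t => if t \in `]0, 1] then real_complex R (phi t) else 0)
    \in @cone_pred R[i].
Proof.
move=> phic phi0.
have rnormRB (s t : R) : rnorm (real_complex R s - real_complex R t) = `|s - t|.
  by rewrite -rmorphB rnorm_complex /= expr0n addr0 sqrtr_sqr.
have phiE (t : R) : `]0, 1]%classic t ->
    (if t \in `]0, 1] then real_complex R (phi t) else 0) =
    real_complex R (phi t).
  by move=> t01; rewrite ifT.
apply/coneP; split.
- apply/subspace_continuousP => x x01; apply/cvg_rnormP => e e0.
  rewrite near_withinE; near=> t => t01.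
  rewrite /from_subspace/= !phiE// rnormRB.
  by near: t; exact: (cvgrPdist_lt _ _).1 (phic x) _ e0.
- apply/cvg_rnormP => e e0; near=> t; rewrite sub0r rnormN.
  case: ifP => [_|_]; last by rewrite rnorm0.
  rewrite -[real_complex R _]subr0 -[0]/(real_complex R 0) rnormRB.
  rewrite -phi0 distrC.
  by near: t; apply: cvg_within; exact: (cvgrPdist_lt _ _).1 (phic 0) _ e0.
- by move=> t /negbTE t01; rewrite t01.
Unshelve. all: by end_near. Qed.

(* the function w(t) = t on (0,1] *)
Definition cone_id : cone R[i] :=
  Cone (cone_real_subproof (fun t => @cvg_id R (nbhs t)) erefl).

End Cone.

Arguments cone_id {R}.

Definition C0 (R : realType) : cstarAlgType R := cone R[i].

(* [D] with [ten] is a C*-tensor product of [A1] and [A2]: the span of the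
   elementary tensors [ten a1 a2] is a dense *-subalgebra of D which carries
   the algebraic tensor product of A1 and A2, i.e. a sum of elementary tensors
   vanishes in D only if it is killed by every bilinear map on A1 x A2.
   In other words, D is the completion of the algebraic tensor product in some
   C*-norm; that norm is unique when A1 is nuclear, as
   C_0((0,1]) is. *)
Record is_cstar_tensor (R : realType) (A1 A2 D : cstarAlgType R)
    (ten : {bilinear A1 -> A2 -> D}) : Prop := {
  tensor_mul : forall a1 a2 b1 b2,
    cmul (ten a1 a2) (ten b1 b2) = ten (cmul a1 b1) (cmul a2 b2);
  tensor_star : forall a1 a2, cstar (ten a1 a2) = ten (cstar a1) (cstar a2);
  tensor_faithful : forall s : seq (A1 * A2), \sum_(p <- s) ten p.1 p.2 = 0 ->
    forall (V : lmodType R[i]) (beta : {bilinear A1 -> A2 -> V}),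
      \sum_(p <- s) beta p.1 p.2 = 0;
  tensor_dense : closure (range
    (fun s : seq (A1 * A2) => \sum_(p <- s) ten p.1 p.2)) = [set: D]
}.

Record cstar_tensor (R : realType) (A1 A2 : cstarAlgType R) := CStarTensor {
  tensor_alg :> cstarAlgType R;
  tensor : {bilinear A1 -> A2 -> tensor_alg};
  tensorP : is_cstar_tensor tensor
}.

(* The tensor product of C_0((0,1]) and A exists: C_0((0,1], A) is one. *)
Section ConeTensor.
Context {R : realType}.
Variable A : cstarAlgType R.
Implicit Types (f g : C0 R) (a : A) (s : seq (C0 R * A)).

Lemma cone_tensor_subproof f a :
  (fun t => (cone_fun f t : R[i]) *: a) \in @cone_pred R A.
Proof.
apply/coneP; split.
- apply/subspace_continuousP => x x01.
  by apply: cvgZr_tmp; exact: cone_cvg.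
- by rewrite -(scale0r a); apply: cvgZr_tmp; exact: cone_cvg0.
- by move=> t t01; rewrite cone_out// scale0r.
Qed.

Definition cone_tensor_fun f a : cone A := Cone (cone_tensor_subproof f a).

Lemma cone_tensor_bilinear : bilinear_for *:%R *:%R cone_tensor_fun.
Proof.
split=> [a k f g|f k a b]; apply/val_inj/funext => t /=.
  by rewrite -[RHS]/(k *: (cone_fun f t *: a) + cone_fun g t *: a) scalerDl scalerA.
rewrite -[RHS]/(k *: (cone_fun f t *: a) + cone_fun f t *: b).
by rewrite scalerDr !scalerA mulrC.
Qed.

HB.instance Definition _ := bilinear_isBilinear.Build R[i] (C0 R) A (cone A)
  *:%R *:%R cone_tensor_fun cone_tensor_bilinear.

Lemma cone_sumE (I : Type) (r : seq I) (F : I -> cone A) t :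
  (\sum_(i <- r) F i) t = \sum_(i <- r) F i t.
Proof.
by elim: r => [|i r IH]; rewrite ?big_nil// !big_cons -IH.
Qed.

Lemma cone_tensor_faithful s :
  \sum_(p <- s) cone_tensor_fun p.1 p.2 = 0 ->
  forall (V : lmodType R[i]) (beta : {bilinear C0 R -> A -> V}),
    \sum_(p <- s) beta p.1 p.2 = 0.
Proof.
move=> s0 V beta.
have {s0} : forall t, \sum_(p <- s) cone_fun p.1 t *: p.2 = 0.
  by move=> t; have := cone_sumE s (fun p => cone_tensor_fun p.1 p.2) t; rewrite s0.
move: {2}(size s) (erefl (size s)) => n.
elim: n s => [|n IH] s; first by move=> /size0nil -> _; rewrite big_nil.
case: s => [//|[f a] s] [sn] s0.
rewrite big_cons /=.
have [f0|] := pselect (forall t, cone_fun f t = 0).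
  have -> : f = 0 by apply/val_inj/funext.
  rewrite linear0l add0r; apply: IH => // t.
  by have := s0 t; rewrite big_cons/= f0 scale0r add0r.
move=> /existsNP[t0 /eqP ft0].
pose c (p : C0 R * A) := cone_fun p.1 t0 / cone_fun f t0.
pose s' := [seq (p.1 - c p *: f, p.2) | p <- s].
have aE : a = - \sum_(p <- s) c p *: p.2.
  apply: (scalerI ft0); rewrite scalerN scaler_sumr; apply/eqP.
  rewrite -addr_eq0 -[X in _ == X](s0 t0) big_cons/=.
  apply/eqP; congr (_ + _); apply: eq_bigr => p _.
  by rewrite scalerA /c mulrC divfK.
have : \sum_(p <- s') beta p.1 p.2 = 0.
  apply: IH; first by rewrite size_map.
  move=> t; rewrite big_map /= -[RHS](s0 t) big_cons /=.
  rewrite aE scalerN scaler_sumr -sumrN -big_split /=; apply: eq_bigr => p _.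
  transitivity ((cone_fun p.1 t - c p * cone_fun f t) *: p.2); first by [].
  by rewrite scalerBl addrC scalerA [_ * c p]mulrC.
rewrite big_map /= => H; rewrite -[RHS]H.
rewrite aE linearNr linear_sumr -sumrN -big_split /=.
by apply: eq_bigr => p _; rewrite linearBl linearZl_LR linearZr_LR addrC.
Qed.

Let rnorm_sum (I : Type) (r : seq I) (F : I -> A) :
  rnorm (\sum_(i <- r) F i) <= \sum_(i <- r) rnorm (F i).
Proof.
elim/big_ind2: _ => [|x1 x2 y1 y2 h1 h2|//]; first by rewrite rnorm0.
by rewrite (le_trans (ler_rnormD _ _))// lerD.
Qed.

Let ramp (x : R) : R := (`|x| - `|x - 1| + 1) / 2.

Let ramp_le0 x : x <= 0 -> ramp x = 0.
Proof.
by move=> x0; rewrite /ramp ler0_norm// ler0_norm; lra.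
Qed.

Let ramp_ge1 x : 1 <= x -> ramp x = 1.
Proof.
by move=> x1; rewrite /ramp !ger0_norm; lra.
Qed.

Let ramp_homo x y : x <= y -> ramp x <= ramp y.
Proof.
by move=> xy; rewrite /ramp; case: (ger0P x); case: (ger0P y);
  case: (ger0P (x - 1)); case: (ger0P (y - 1)); lra.
Qed.

Let ramp_continuous : continuous ramp.
Proof.
move=> x; apply: cvgM; last exact: cvg_cst.
apply: cvgD; last exact: cvg_cst.
apply: cvgB; apply: cvg_norm; first exact: cvg_id.
by apply: cvgB; [exact: cvg_id|exact: cvg_cst].
Qed.

(* piecewise linear partition of unity subordinate to the points k / n *)
Let hat_fun (n k : nat) (t : R) : R :=
  ramp (n%:R * t - k%:R + 1) - ramp (n%:R * t - k%:R).

Let hat_ge0 n k t : 0 <= hat_fun n k t.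
Proof. by rewrite subr_ge0 ramp_homo// lerDl. Qed.

Let hat_out n k t : 1 <= `|n%:R * t - k%:R| -> hat_fun n k t = 0.
Proof.
rewrite /hat_fun => h; have [x0|x0] := ger0P (n%:R * t - k%:R).
  by rewrite !ramp_ge1 ?subrr//; move: h; rewrite ger0_norm//; lra.
by rewrite !ramp_le0 ?subrr//; move: h; rewrite ltr0_norm//; lra.
Qed.

Let hat_sum n t : 0 <= t <= 1 -> \sum_(k < n.+1) hat_fun n k t = 1.
Proof.
move=> /andP[t0 t1].
rewrite -(big_mkord xpredT (fun k => hat_fun n k t)).
have -> : \sum_(0 <= k < n.+1) hat_fun n k t =
    \sum_(0 <= k < n.+1) ((- ramp (n%:R * t - k.+1%:R + 1)) - (- ramp (n%:R * t - k%:R + 1))).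
  apply: eq_bigr => k _; rewrite /hat_fun opprK addrC; congr (- ramp _ + _).
  by rewrite -natr1; lra.
rewrite telescope_sumr//.
rewrite -natr1 ramp_le0 ?ramp_ge1; first by lra.
  by rewrite subr0 lerDr mulr_ge0.
have : n%:R * t <= n%:R by rewrite ler_piMr.
lra.
Qed.

Let hat_continuous n k : continuous (hat_fun n k).
Proof.
have affc : continuous (fun t : R => n%:R * t - k%:R).
  move=> x; apply: cvgB; last exact: cvg_cst.
  by apply: cvgM; [exact: cvg_cst|exact: cvg_id].
move=> x; apply: cvgB.
  apply: (@continuous_comp _ _ _ (fun t : R => n%:R * t - k%:R + 1) ramp).
    by apply: cvgD; [exact: affc|exact: cvg_cst].
  exact: ramp_continuous.
apply: (@continuous_comp _ _ _ (fun t : R => n%:R * t - k%:R) ramp).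
  exact: affc.
exact: ramp_continuous.
Qed.

Let hat0 n k : hat_fun n k.+1 0 = 0.
Proof. by apply: hat_out; rewrite mulr0 sub0r normrN normr_nat ler1n. Qed.

Let hat n k : C0 R := Cone (cone_real_subproof (@hat_continuous n k.+1) (hat0 n k)).

Let cone_modulus (f : cone A) (e : R) : 0 < e -> exists n : nat,
  forall (t : R) (k : nat), t \in `]0, 1] -> (k <= n)%N ->
    `|n%:R * t - k%:R| < 1 -> rnorm (f t - f (k%:R / n%:R)) <= e.
Proof.
move=> e0; have e20 : 0 < e / 2 by rewrite divr_gt0.
pose P (n : nat) (t : R) := forall k : nat, (k <= n)%N ->
  `|n%:R * t - k%:R| < 1 -> rnorm (f t - f (k%:R / n%:R)) <= e.
have /near_covering_withinP/(_ nat \oo P _) H :=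
  (compact_near_coveringP _).1 (@segment_compact R 0 1).
have {H} : \forall n \near \oo, `[0, 1]%classic `<=` P n.
  apply: H => x x01.
  have /subspace_continuousP/(_ _ x01)/cvg_rnormP/(_ _ e20) := @cone_within _ _ f.
  rewrite near_withinE => /nbhs_ballP[d /= d0 fd].
  have d20 : 0 < d / 2 by rewrite divr_gt0.
  have Nd : \forall n \near \oo, (d / 2)^-1 < n%:R.
    exact: nbhs_infty_gtr.
  exists (ball x (d / 2), [set n | (d / 2)^-1 < n%:R]).
    by split => //=; exact: nbhsx_ballx.
  move=> [t n] /= [xt nd] t01 k kn tk.
  have n0 : 0 < n%:R :> R by apply: lt_trans nd; rewrite invr_gt0.
  have k01 : `[0, 1]%classic (k%:R / n%:R : R).
    rewrite /= in_itv/= divr_ge0//= ler_pdivrMr// mul1r.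
    by rewrite ler_nat.
  have tk2 : `|t - k%:R / n%:R| < d / 2.
    rewrite -(ltr_pM2l n0) -[X in X * `|_|](gtr0_norm n0) -normrM mulrBr.
    rewrite [_ * (k%:R / _)]mulrC divfK ?gt_eqF//.
    apply: (lt_trans tk); rewrite -ltr_pdivrMr// div1r//.
  have ft : rnorm (f x - f t) < e / 2.
    by apply: fd => //; apply: le_ball xt; lra.
  have fk : rnorm (f x - f (k%:R / n%:R)) < e / 2.
    apply: fd => //; rewrite /ball /=.
    have -> : x - k%:R / n%:R = (x - t) + (t - k%:R / n%:R) by rewrite addrA subrK.
    apply: (le_lt_trans (ler_normD _ _)); move: xt; rewrite /ball/=; lra.
  have -> : f t - f (k%:R / n%:R) = - (f x - f t) + (f x - f (k%:R / n%:R)).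
    by rewrite opprB addrA subrK.
  by apply: (le_trans (ler_rnormD _ _)); rewrite rnormN; lra.
move=> /filter_ex[n Pn]; exists n => t k t01; apply: Pn.
by move: t01; rewrite /= !in_itv/= => /andP[/ltW-> ->].
Qed.

Lemma cone_tensor_dense : closure (range
  (fun s => \sum_(p <- s) cone_tensor_fun p.1 p.2)) = [set: cone A].
Proof.
apply/seteqP; split=> // f _ U /nbhs_ballP[e' e'0 eU].
have [e e0 ballU] : exists2 e : R, 0 < e & forall g : cone A, rnorm (f - g) < e -> U g.
  move: e' e'0 eU => -[e i] /=; rewrite ltcE /= => /andP[/eqP -> e0] eU.
  by exists e => // g fg; apply: eU; rewrite -ball_normE/= rnormE ltcR.
have e20 : 0 < e / 2 by rewrite divr_gt0.
have [n fn] := cone_modulus f e20.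
pose s := [seq (hat n k, f (k.+1%:R / n%:R)) | k <- iota 0 n].
exists (\sum_(p <- s) cone_tensor_fun p.1 p.2); split; first by exists s.
apply: ballU; apply: (@le_lt_trans _ _ (e / 2)); last by lra.
rewrite cone_rnormE; apply: cone_sup_le => t t01.
have t01' : 0 <= t <= 1 by move: t01; rewrite in_itv/= => /andP[/ltW-> ->].
have -> : (f - \sum_(p <- s) cone_tensor_fun p.1 p.2 : cone A) t =
    \sum_(k < n.+1) real_complex R (hat_fun n k t) *: (f t - f (k%:R / n%:R)).
  transitivity (f t - (\sum_(p <- s) cone_tensor_fun p.1 p.2 : cone A) t).
    by [].
  under [RHS]eq_bigr do rewrite scalerBr.
  rewrite sumrB -scaler_suml -rmorph_sum/= hat_sum// scale1r; congr (_ - _).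
  rewrite big_ord_recl /= mul0r cone0 scaler0 add0r cone_sumE big_map.
  rewrite -[n in iota 0 n]subn0 (big_mkord xpredT).
  by apply: eq_bigr => k _ /=; rewrite t01.
apply: (le_trans (rnorm_sum _ _)).
apply: (@le_trans _ _ (\sum_(k < n.+1) hat_fun n k t * (e / 2))); last first.
  by rewrite -mulr_suml hat_sum// mul1r.
apply: ler_sum => k _; rewrite rnormZ -[complex.Re _]/(rnorm _).
rewrite rnorm_complex /= expr0n addr0 sqrtr_sqr ger0_norm//.
have [tk|tk] := ltP `|n%:R * t - k%:R| 1; last by rewrite hat_out// !mul0r.
by rewrite ler_wpM2l// fn// -ltnS.
Qed.

Lemma cone_is_cstar_tensor : is_cstar_tensor cone_tensor_fun.
Proof.
split.
- move=> f a g b; apply/val_inj/funext => t /=.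
  by rewrite cmulZl cmulZr scalerA.
- by move=> f a; apply/val_inj/funext => t /=; rewrite cstarZ.
- exact: cone_tensor_faithful.
- exact: cone_tensor_dense.
Qed.

Definition cone_cstar_tensor : cstar_tensor (C0 R) A :=
  CStarTensor cone_is_cstar_tensor.

End ConeTensor.

Section MatrixAmplification.
Context {R : realType}.

Section Operations.
Context {A : cstarAlgType R} {n : nat}.
Implicit Types x y : 'M[A]_n.

Definition mx_cmul x y : 'M[A]_n := \matrix_(i, j) \sum_k cmul (x i k) (y k j).
Definition mx_cstar x : 'M[A]_n := \matrix_(i, j) cstar (x j i).

Definition mx_orthogonal x y : Prop :=
  mx_cmul x (mx_cstar y) = 0 /\ mx_cmul (mx_cstar y) x = 0.

End Operations.

Variables A B : cstarAlgType R.

Definition completely_orthogonality_preserving (T : A -> B) : Prop :=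
  forall (n : nat) (x y : 'M[A]_n),
    mx_orthogonal x y -> mx_orthogonal (map_mx T x) (map_mx T y).

Definition contractive (T : A -> B) : Prop := forall a, `|T a| <= `|a|.

Definition is_tro_hom (Phi : A -> B) : Prop := forall x y z,
  Phi (cmul (cmul x (cstar y)) z) =
  cmul (cmul (Phi x) (cstar (Phi y))) (Phi z).

Record contractive_cop := ContractiveCop {
  cop_fun :> {linear A -> B};
  cop_contractive : contractive cop_fun;
  cop_cop : completely_orthogonality_preserving cop_fun
}.

Record tro_hom := TroHom {
  tro_hom_fun :> {linear A -> B};
  tro_homP : is_tro_hom tro_hom_fun
}.

End MatrixAmplification.

(* Main.v *)
Require Import Defs.
From HB Require Import structures.
From mathcomp Require Import all_boot all_order all_algebra complex.
From mathcomp Require Import boolp classical_sets functions set_interval.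
From mathcomp Require Import reals topology normedtype sequences derive realfun.
From mathcomp Require Import ring lra.

(** A TRO homomorphism Phi on D, the tensor product of C_0((0,1]) and A, yields
    T(a) = Phi(w (x) a).  This map is contractive because TRO homomorphisms are
    automatically contractive, by a spectral argument
    ([tro_hom_contractive]), and because elementary tensors satisfy
    |f (x) a| <= |f| |a| ([tensor_norm_le]).  It is completely orthogonality
    preserving because any sum of products Phi(x) Phi(y)^* that corresponds to 0
    annihilates the range of Phi ([tro_hom_cop]).  Since w generates C_0((0,1]),
    Phi is determined by T ([tro_hom_eq]).

    Conversely let T be given.  Suitable orthogonal 2 x 2 matrices show that
    T(a x) T(b)^* = T(a) T(b x^* )^* and T(x a)^* T(b) = T(a)^* T(x^* b)
    ([cop_move_right], [cop_move_left]): these products only depend on the weight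
    of T and on a b^* or a^* b.  Along approximate units e the products
    T(a) (T(e)^* T(e))^k converge, to what has to be the image of w^(2k+1) (x) a
    ([wimg]), and these limits obey the triple product rule ([wimg_mul]).  For an odd
    polynomial p(t) = t q(t^2), the resulting image of p (x) a is bounded by a
    multiple of the supremum of |p| on [0,1] times |a| ([wpoly_norm]), so it extends
    to p in C_0((0,1]).

    It remains to bound the image of a sum of elementary tensors by its supremum
    norm ([beta_comb_norm]).  Such a sum, seen as a function X with values in A, is
    close to the sum over k of h_k (x) X(k/n), where the h_k are tent functions around
    the points k/n.  Tents with indices of the same parity have disjoint supports,
    hence orthogonal images, and the norm of a sum of orthogonal elements is the
    largest of their norms.  Finally the supremum norm is dominated by the norm of D
    ([cone_comb_norm_le]), and the map extends to D.  The constants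
    picked up along the way do not matter, as Phi is automatically contractive.

    The analytic input is the order structure of a C*-algebra.  It is developed in
    the unitization from one construction, the square root of 1 - x for x a
    self-adjoint contraction ([sqrt_one_sub]); the positivity of u^* u
    ([psd_star_mul]) and the bound on polynomials in a self-adjoint element
    ([rhorner_norm]) follow algebraically. *)

Set Implicit Arguments.
Unset Strict Implicit.
Unset Printing Implicit Defensive.

Import Order.TTheory GRing.Theory Num.Theory numFieldNormedType.Exports.

Local Open Scope classical_set_scope.
Local Open Scope ring_scope.

(** * The unitization of a C*-algebra *)

(** The pairs (k, a) stand for k 1 + a.  When A already has a unit the operator
    norm on A does not separate them, which is why the norm below is the maximum
    of the operator norm and of |k|. *)
Definition unitization (R : realType) (A : cstarAlgType R) : Type := (R[i] * A)%type.

Section UnitizationRing.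
Context {R : realType} (A : cstarAlgType R).

HB.instance Definition _ := GRing.Lmodule.copy (unitization A) (R[i]^o * A)%type.

Implicit Types x y z : unitization A.

Definition umul x y : unitization A :=
  (x.1 * y.1, x.1 *: y.2 + y.1 *: x.2 + cmul x.2 y.2).
Definition uone : unitization A := (1, 0).

Let umulA : associative umul.
Proof.
move=> [k a] [l b] [m c]; rewrite /umul/=; congr (_, _); first by rewrite mulrA.
rewrite !(cmulDl, cmulDr, cmulZl, cmulZr, scalerDr, scalerA) cmulA.
rewrite [m * k]mulrC [m * l]mulrC !addrA.
by rewrite [LHS](ACl (1*2*4*6*3*5*7)).
Qed.

Let umul1l : left_id uone umul.
Proof.
by move=> [k a]; rewrite /umul/= mul1r scale1r scaler0 addr0 cmul0l addr0.
Qed.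

Let umul1r : right_id uone umul.
Proof.
by move=> [k a]; rewrite /umul/= mulr1 scale1r scaler0 add0r cmul0r addr0.
Qed.

Let umulDl : left_distributive umul +%R.
Proof.
move=> [k a] [l b] [m c]; rewrite /umul/=; congr (_, _); first exact: mulrDl.
rewrite /= scalerDl scalerDr cmulDl !addrA.
by rewrite [LHS](ACl (1*3*5*2*4*6)).
Qed.

Let umulDr : right_distributive umul +%R.
Proof.
move=> [k a] [l b] [m c]; rewrite /umul/=; congr (_, _); first exact: mulrDr.
rewrite /= scalerDl scalerDr cmulDr !addrA.
by rewrite [LHS](ACl (1*3*5*2*4*6)).
Qed.

Let uone_neq0 : uone != 0.
Proof. by apply/eqP => -[/eqP]; rewrite oner_eq0. Qed.

HB.instance Definition _ := GRing.Zmodule_isNzRing.Build (unitization A)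
  umulA umul1l umul1r umulDl umulDr uone_neq0.

Let uscaleAl (k : R[i]) x y : k *: (x * y) = (k *: x) * y.
Proof.
case: x y => [l a] [m b]; congr (_, _); first exact: mulrA.
by rewrite /= !scalerDr !scalerA cmulZl [k * m]mulrC.
Qed.

HB.instance Definition _ :=
  GRing.Lmodule_isLalgebra.Build R[i] (unitization A) uscaleAl.

Let uscaleAr (k : R[i]) x y : k *: (x * y) = x * (k *: y).
Proof.
case: x y => [l a] [m b]; congr (_, _); first exact: mulrCA.
by rewrite /= !scalerDr !scalerA cmulZr [k * l]mulrC.
Qed.

HB.instance Definition _ :=
  GRing.Lalgebra_isAlgebra.Build R[i] (unitization A) uscaleAr.

Definition inj (a : A) : unitization A := (0, a).
Definition uscal x : R[i] := x.1.

Definition uact x (a : A) : A := x.1 *: a + cmul x.2 a.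

Let inj_linear : linear inj.
Proof. by move=> k a b; congr (_, _); rewrite /= scaler0 addr0. Qed.
HB.instance Definition _ :=
  GRing.isLinear.Build R[i] A (unitization A) *:%R inj inj_linear.

Let uscal_linear : linear_for *%R uscal.
Proof. by []. Qed.
HB.instance Definition _ :=
  GRing.isLinear.Build R[i] (unitization A) R[i] *%R uscal uscal_linear.

Let uscal_monoid : monoid_morphism uscal.
Proof. by []. Qed.
HB.instance Definition _ :=
  GRing.isMonoidMorphism.Build (unitization A) R[i] uscal uscal_monoid.

Lemma inj_inj : injective inj.
Proof. by move=> a b []. Qed.

Lemma injM a b : inj (cmul a b) = inj a * inj b.
Proof. by congr (_, _); rewrite /= ?mul0r// !scale0r !add0r. Qed.

Lemma inj_uact x a : inj (uact x a) = x * inj a.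
Proof. by congr (_, _); rewrite /= ?mulr0// scale0r addr0. Qed.

Lemma uscal_inj a : uscal (inj a) = 0. Proof. by []. Qed.

Lemma uscal0_inj x : uscal x = 0 -> x = inj x.2.
Proof. by case: x => k a /= ->. Qed.

End UnitizationRing.

Lemma rnormZc (R : realType) (V : normedModType R[i]) (k : R[i]) (x : V) :
  rnorm (k *: x) = rnorm k * rnorm x.
Proof. exact: rnormZ. Qed.

Lemma rnormMc (R : realType) (k l : R[i]) : rnorm (k * l) = rnorm k * rnorm l.
Proof. exact: rnormZ. Qed.

Lemma rnorm_sum (R : realType) (V : normedModType R[i]) (I : Type) (r : seq I)
    (F : I -> V) : rnorm (\sum_(i <- r) F i) <= \sum_(i <- r) rnorm (F i).
Proof.
elim/big_ind2: _ => [|x1 x2 y1 y2 h1 h2|//]; first by rewrite rnorm0.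
by rewrite (le_trans (ler_rnormD _ _))// lerD.
Qed.

Section UnitizationNorm.
Context {R : realType} (A : cstarAlgType R).
Implicit Types (x y : unitization A) (a z : A).

Definition ustar x : unitization A := (Num.conj x.1, cstar x.2).

Definition uopn x : R := sup [set rnorm (uact x z) | z in [set z | rnorm z <= 1]].

Definition unorm x : R := Num.max (rnorm (uscal x)) (uopn x).

Lemma uactD x y z : uact (x + y) z = uact x z + uact y z.
Proof. by rewrite /uact /= scalerDl cmulDl addrACA. Qed.

Lemma uactZ k x z : uact (k *: x) z = k *: uact x z.
Proof. by rewrite /uact /= cmulZl scalerDr scalerA. Qed.

Lemma uactM x y z : uact (x * y) z = uact x (uact y z).
Proof. by apply: inj_inj; rewrite !inj_uact mulrA. Qed.

Lemma uactZr k x z : uact x (k *: z) = k *: uact x z.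
Proof. by rewrite /uact /= cmulZr scalerDr !scalerA mulrC. Qed.

Lemma uact_star x a z : cmul (cstar (uact x a)) z = cmul (cstar a) (uact (ustar x) z).
Proof.
rewrite /uact /= cstarD cstarZ cstarM cmulDl cmulZl cmulDr cmulZr.
by rewrite cmulA.
Qed.

Lemma uact_norm_le x z : rnorm (uact x z) <= (rnorm x.1 + rnorm x.2) * rnorm z.
Proof.
rewrite mulrDl (le_trans (ler_rnormD _ _))// lerD ?rnormM//.
by rewrite rnormZc.
Qed.

Lemma uopn_nonempty x : [set rnorm (uact x z) | z in [set z | rnorm z <= 1]] !=set0.
Proof. by exists (rnorm (uact x 0)), 0; rewrite //= rnorm0. Qed.

Lemma uopn_bounded x : has_ubound [set rnorm (uact x z) | z in [set z | rnorm z <= 1]].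
Proof.
exists (rnorm x.1 + rnorm x.2) => _ [z /= z1 <-].
by rewrite (le_trans (uact_norm_le _ _))// ler_piMr// addr_ge0// rnorm_ge0.
Qed.

Lemma uact_opn x z : rnorm (uact x z) <= uopn x * rnorm z.
Proof.
have [z0|zn0] := eqVneq (rnorm z) 0.
  by rewrite (rnorm0_eq0 z0) (le_trans (uact_norm_le _ _))// rnorm0 !mulr0.
have z_gt0 : 0 < rnorm z by rewrite lt_neqAle eq_sym zn0 rnorm_ge0.
rewrite -ler_pdivrMr//.
apply: ub_le_sup; first exact: uopn_bounded.
have kE : rnorm (real_complex R (rnorm z)^-1) = (rnorm z)^-1.
  by rewrite rnorm_complex/= expr0n addr0 sqrtr_sqr ger0_norm ?invr_ge0 ?rnorm_ge0.
exists (real_complex R (rnorm z)^-1 *: z).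
  by rewrite /= rnormZc kE mulVf.
by rewrite uactZr rnormZc kE mulrC.
Qed.

Lemma uopn_le x M : 0 <= M -> (forall z, rnorm (uact x z) <= M * rnorm z) ->
  uopn x <= M.
Proof.
move=> M0 H; apply: ge_sup; first exact: uopn_nonempty.
by move=> _ [z /= z1 <-]; rewrite (le_trans (H z))// ler_piMr.
Qed.

Lemma uopn_ge0 x : 0 <= uopn x.
Proof.
apply: le_trans (rnorm_ge0 (uact x 0)) _.
by apply: ub_le_sup; [exact: uopn_bounded|exists 0; rewrite //= rnorm0].
Qed.

Lemma uopnD x y : uopn (x + y) <= uopn x + uopn y.
Proof.
apply: uopn_le; first by rewrite addr_ge0 ?uopn_ge0.
move=> z; rewrite uactD mulrDl (le_trans (ler_rnormD _ _))//.
by rewrite lerD ?uact_opn.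
Qed.

Lemma uopnM x y : uopn (x * y) <= uopn x * uopn y.
Proof.
apply: uopn_le; first by rewrite mulr_ge0 ?uopn_ge0.
move=> z; rewrite uactM (le_trans (uact_opn _ _))// -mulrA.
by rewrite ler_wpM2l ?uopn_ge0 ?uact_opn.
Qed.

Lemma uopn_sqr x : uopn x ^+ 2 <= uopn (ustar x * x).
Proof.
have N0 := uopn_ge0 (ustar x * x).
rewrite -[leRHS]sqr_sqrtr// lerXn2r ?nnegrE ?sqrtr_ge0 ?uopn_ge0//.
apply: uopn_le => [|z]; first exact: sqrtr_ge0.
rewrite -(@ler_pXn2r _ 2)// ?nnegrE ?mulr_ge0 ?sqrtr_ge0 ?rnorm_ge0//.
rewrite exprMn sqr_sqrtr// -rnorm_star uact_star -uactM.
rewrite (le_trans (rnormM _ _))// rnormS expr2 mulrCA.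
by rewrite ler_wpM2l ?rnorm_ge0 ?uact_opn.
Qed.

Lemma ustarK : involutive ustar.
Proof. by move=> [k a]; rewrite /ustar /= conjCK cstarK. Qed.

Lemma uopnS x : uopn (ustar x) = uopn x.
Proof.
have le (y : unitization A) : uopn y <= uopn (ustar y).
  have [->|y0] := eqVneq (uopn y) 0; first exact: uopn_ge0.
  have y_gt0 : 0 < uopn y by rewrite lt_neqAle eq_sym y0 uopn_ge0.
  by rewrite -(ler_pM2r y_gt0) -expr2 (le_trans (uopn_sqr _))// uopnM.
by apply/le_anti; rewrite le (le_trans (le _))// ustarK.
Qed.

Lemma uopn_star x : uopn (ustar x * x) = uopn x ^+ 2.
Proof.
by apply/le_anti; rewrite uopn_sqr andbT (le_trans (uopnM _ _))// uopnS expr2.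
Qed.

Lemma uopnZ k x : uopn (k *: x) = rnorm k * uopn x.
Proof.
have le k' y : uopn (k' *: y) <= rnorm k' * uopn y.
  apply: uopn_le => [|z]; first by rewrite mulr_ge0 ?uopn_ge0 ?rnorm_ge0.
  by rewrite uactZ rnormZc -mulrA ler_wpM2l ?rnorm_ge0 ?uact_opn.
apply/le_anti; rewrite le/=.
have [->|k0] := eqVneq k 0; first by rewrite rnorm0 mul0r uopn_ge0.
have rk : rnorm k != 0 by apply/eqP => /rnorm0_eq0 /eqP; rewrite (negbTE k0).
have rk0 : 0 < rnorm k by rewrite lt_neqAle eq_sym rk rnorm_ge0.
rewrite -ler_pdivlMl// -[x in leLHS](scale1r) -(mulVf k0) -scalerA.
rewrite (le_trans (le _ _))//.
suff -> : rnorm k^-1 = (rnorm k)^-1 by [].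
by apply: (mulfI rk); rewrite mulfV// -rnormMc mulfV// /rnorm normr1.
Qed.

Lemma uopn_inj a : uopn (inj a) = rnorm a.
Proof.
apply/le_anti/andP; split.
  apply: uopn_le => [|z]; first exact: rnorm_ge0.
  by rewrite /uact /= scale0r add0r rnormM.
have [a0|a0] := eqVneq (rnorm a) 0; first by rewrite a0 uopn_ge0.
have a_gt0 : 0 < rnorm a by rewrite lt_neqAle eq_sym a0 rnorm_ge0.
rewrite -(ler_pM2r a_gt0) -{3}(rnormS a); apply: le_trans (uact_opn _ _).
have := rnorm_star (cstar a); rewrite cstarK /uact /= scale0r add0r => ->.
by rewrite rnormS expr2.
Qed.

Lemma unorm_ge0 x : 0 <= unorm x.
Proof. by rewrite le_max rnorm_ge0. Qed.

Let unormD x y : real_complex R (unorm (x + y)) <=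
  real_complex R (unorm x) + real_complex R (unorm y).
Proof.
rewrite -rmorphD lecR ge_max; apply/andP; split.
  by rewrite (le_trans (ler_rnormD _ _))// lerD// le_max lexx.
by rewrite (le_trans (uopnD _ _))// lerD// le_max lexx orbT.
Qed.

Let unormZ k x : real_complex R (unorm (k *: x)) = `|k| * real_complex R (unorm x).
Proof.
rewrite rnormE -rmorphM; congr (real_complex R _).
by rewrite /unorm uopnZ rnormMc maxr_pMr ?rnorm_ge0.
Qed.

Let unorm0 x : real_complex R (unorm x) = 0 -> x = 0.
Proof.
move=> /complexI /eqP; rewrite eq_le unorm_ge0 andbT ge_max => /andP[k0 a0].
have {}k0 : uscal x = 0 by apply: rnorm0_eq0; apply/le_anti; rewrite k0 rnorm_ge0.
rewrite (uscal0_inj k0) in a0 *; rewrite uopn_inj in a0.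
suff -> : x.2 = 0 by [].
by apply: rnorm0_eq0; apply/le_anti; rewrite a0 rnorm_ge0.
Qed.

HB.instance Definition _ := @Lmodule_isNormed.Build R[i] (unitization A)
  (fun x => real_complex R (unorm x)) unormD unormZ unorm0.

Lemma unormE x : rnorm x = unorm x. Proof. by []. Qed.

Lemma rnorm_uscal x : rnorm (uscal x) <= rnorm x.
Proof. by rewrite unormE le_max lexx. Qed.

Lemma rnorm_inj a : rnorm (inj a) = rnorm a.
Proof. by rewrite unormE /unorm uopn_inj uscal_inj rnorm0 max_r ?rnorm_ge0. Qed.

Lemma uopn1_le : uopn (1 : unitization A) <= 1.
Proof. by apply: uopn_le => // z; rewrite /uact /= scale1r cmul0l addr0 mul1r. Qed.

Lemma unorm_le x : unorm x <= rnorm x.1 + rnorm x.2.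
Proof.
rewrite ge_max lerDl rnorm_ge0 /=.
by apply: uopn_le => [|z]; [rewrite addr_ge0 ?rnorm_ge0|exact: uact_norm_le].
Qed.

Lemma rnorm_snd x : rnorm x.2 <= 2 * rnorm x.
Proof.
rewrite -uopn_inj.
have -> : inj x.2 = x - uscal x *: 1.
  case: x => k a; congr (_, _); rewrite /= ?scaler0 ?subr0//.
  by rewrite -[k *: _]/(k * 1) mulr1 subrr.
rewrite (le_trans (uopnD _ _))// -scaleNr uopnZ rnormN.
have : uopn x <= rnorm x by rewrite unormE le_max lexx orbT.
have := rnorm_uscal x; have := uopn1_le; have := uopn_ge0 1; have := rnorm_ge0 (uscal x).
nra.
Qed.

Lemma unitization_complete (F : set_system (unitization A)) :
  ProperFilter F -> cauchy F -> cvg F.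
Proof.
move=> FF /cauchy_rnormP cF.
have [k Fk] : exists k : R[i], @uscal R A @ F --> k.
  apply/cvg_ex; apply: cauchy_cvg; apply/cauchy_rnormP => e e0.
  have [x Fx] := cF _ e0; exists (uscal x); apply: filterS Fx => y /=.
  by apply: le_lt_trans; rewrite -raddfB; exact: rnorm_uscal.
have [a Fa] : exists a : A, (x : unitization A).2 @[x --> F] --> a.
  apply/cvg_ex; apply: cauchy_cvg; apply/cauchy_rnormP => e e0.
  have e20 : 0 < e / 2 by rewrite divr_gt0.
  have [x Fx] := cF _ e20; exists x.2; apply: filterS Fx => y /=.
  have := rnorm_snd (x - y); rewrite [(x - y).2]/= => H1 H2.
  by apply: (le_lt_trans H1); rewrite mulrC -ltr_pdivlMr.
apply/cvg_ex; exists ((k, a) : unitization A); apply/cvg_rnormP => e e0.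
have e20 : 0 < e / 2 by rewrite divr_gt0.
near=> x; apply: (le_lt_trans (unorm_le _)) => /=.
rewrite [ltRHS]splitr ltrD//; near: x.
  by move/cvg_rnormP: Fk; exact.
by move/cvg_rnormP: Fa; exact.
Unshelve. all: by end_near. Qed.

HB.instance Definition _ :=
  Uniform_isComplete.Build (unitization A) unitization_complete.

Let umulA x y t : x * (y * t) = x * y * t. Proof. exact: mulrA. Qed.
Let umulDl x y t : (x + y) * t = x * t + y * t. Proof. exact: mulrDl. Qed.
Let umulDr x y t : x * (y + t) = x * y + x * t. Proof. exact: mulrDr. Qed.
Let umulZl (k : R[i]) x y : (k *: x) * y = k *: (x * y).
Proof. by rewrite scalerAl. Qed.
Let umulZr (k : R[i]) x y : x * (k *: y) = k *: (x * y).
Proof. by rewrite scalerAr. Qed.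
Let ustarD : {morph ustar : x y / x + y}.
Proof.
by move=> x y; congr (_, _); [exact: rmorphD|exact: cstarD].
Qed.
Let ustarZ (k : R[i]) x : ustar (k *: x) = Num.conj k *: ustar x.
Proof. by congr (_, _); [exact: rmorphM|exact: cstarZ]. Qed.
Let ustarM x y : ustar (x * y) = ustar y * ustar x.
Proof.
congr (_, _); first by rewrite mulrC; exact: rmorphM.
by rewrite /= !cstarD !cstarZ cstarM; congr (_ + _); rewrite addrC.
Qed.
Let unormM x y : `|x * y| <= `|x| * `|y|.
Proof.
rewrite !rnormE -rmorphM lecR !unormE ge_max rnormMc; apply/andP; split.
  by rewrite ler_pM ?rnorm_ge0// le_max lexx.
by rewrite (le_trans (uopnM _ _))// ler_pM ?uopn_ge0// le_max lexx orbT.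
Qed.
Let unorm_star x : `|ustar x * x| = `|x| ^+ 2.
Proof.
rewrite !rnormE -rmorphXn; congr (real_complex R _).
rewrite !unormE /unorm uopn_star [uscal _]/(_ * _) rnormMc.
have -> : rnorm (Num.conj x.1) = rnorm x.1 by rewrite /rnorm norm_conjC.
have h1 := rnorm_ge0 x.1; have h2 := uopn_ge0 x.
rewrite -expr2 [uscal x]/x.1; case: (leP (rnorm x.1) (uopn x)) => h.
  by rewrite max_r// lerXn2r.
by rewrite max_l// lerXn2r// ltW.
Qed.

HB.instance Definition _ := @isCStarAlgebra.Build R (unitization A)
  *%R ustar umulA umulDl umulDr umulZl umulZr
  ustarD ustarZ ustarM ustarK unormM unorm_star.

Lemma uscal_star x : uscal (cstar x) = Num.conj (uscal x).
Proof. by []. Qed.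

Lemma inj_star a : inj (cstar a) = cstar (inj a).
Proof. by congr (_, _); rewrite rmorph0. Qed.

End UnitizationNorm.

Lemma cvg_eq (R : realType) (V : normedModType R[i]) {T : Type}
    (F : set_system T) {FF : ProperFilter F} (f g : T -> V) (l m : V) :
  f @ F --> l -> g @ F --> m -> f =1 g -> l = m.
Proof. by move=> fl gm /funext fg; move: gm; rewrite -fg; exact: norm_cvg_unique. Qed.

(** * Convergence tools *)

(** A sequence whose steps are dominated by those of a convergent real sequence
    is Cauchy, with the same rate.  The Neumann series and the square root
    iteration below are both controlled in this way. *)
Lemma majorant_cvg (R : realType) (V : completeNormedModType R[i])
    (u : nat -> V) (Y : nat -> R) (L : R) :
  (forall n, rnorm (u n.+1 - u n) <= Y n.+1 - Y n) -> Y @ \oo --> L ->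
  exists l : V, (u @ \oo --> l) /\ forall n, rnorm (l - u n) <= L - Y n.
Proof.
move=> uY YL.
have uYD n k : rnorm (u (k + n)%N - u n) <= Y (k + n)%N - Y n.
  elim: k => [|k IH]; first by rewrite !subrr rnorm0.
  rewrite addSn -(subrK (u (k + n)%N) (u (k + n).+1)) -addrA.
  rewrite (le_trans (ler_rnormD _ _))//.
  by rewrite -(subrK (Y (k + n)%N) (Y (k + n).+1)) -[leRHS]addrA lerD.
have Ynd : nondecreasing_seq Y.
  apply/nondecreasing_seqP => n.
  by rewrite -subr_ge0 (le_trans (rnorm_ge0 _) (uY n)).
have YleL n : Y n <= L.
  rewrite -(cvg_lim _ YL)//; apply: nondecreasing_cvgn_le => //.
  by apply/cvg_ex; exists L.
have /cvg_ex[l ul] : cvgn u.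
  apply: cauchy_cvg; apply/cauchy_rnormP => e e0.
  have /cvgrPdist_lt/(_ _ e0)[N _ HN] := YL.
  exists (u N); exists N => // n /= Nn.
  rewrite rnormB -(subnK Nn) (le_lt_trans (uYD _ _))//.
  have := HN N (leqnn N); rewrite /= ger0_norm ?subr_ge0//.
  by have := YleL (n - N + N)%N; lra.
exists l; split=> // n; apply/ler_addgt0Pl => e e0.
have /cvg_rnormP/(_ _ e0)[N _ HN] := ul.
rewrite -(subrK (u (N + n)%N) l) -addrA (le_trans (ler_rnormD _ _))//.
rewrite lerD//; first by rewrite ltW// HN//= leq_addr.
by rewrite (le_trans (uYD _ _))// lerB.
Qed.

Section UnitizationTheory.
Context {R : realType} {A : cstarAlgType R}.
Local Notation U := (unitization A).
Implicit Types (x y z p q u v : U) (a b : A).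

Lemma ustarM x y : cstar (x * y) = cstar y * cstar x.
Proof. exact: cstarM. Qed.

Lemma ustarX x n : cstar (x ^+ n) = cstar x ^+ n.
Proof.
elim: n => [|n IH]; first by congr (_, _); [exact: rmorph1|exact: cstar0].
by rewrite exprSr ustarM IH -exprS.
Qed.

Lemma ustar1 : cstar (1 : U) = 1.
Proof. exact: (ustarX 1 0). Qed.

Lemma urnormM x y : rnorm (x * y) <= rnorm x * rnorm y.
Proof. exact: rnormM. Qed.

Lemma urnorm_star x : rnorm (cstar x * x) = rnorm x ^+ 2.
Proof. exact: rnorm_star. Qed.

Lemma urnorm1 : rnorm (1 : U) = 1.
Proof.
have r1 : rnorm (uscal (1 : U)) = 1 by rewrite rmorph1 /rnorm normr1.
apply/le_anti; rewrite -{2}r1 rnorm_uscal andbT unormE ge_max uopn1_le andbT.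
by rewrite r1.
Qed.

Lemma cvg_umul {T} {F : set_system T} {FF : Filter F} (f g : T -> U) (l m : U) :
  f @ F --> l -> g @ F --> m -> f t * g t @[t --> F] --> l * m.
Proof. exact: cvg_cmul. Qed.

Lemma rnormRC (t : R) : rnorm (t%:C%C : R[i]) = `|t|.
Proof. by rewrite rnorm_complex/= expr0n addr0 sqrtr_sqr. Qed.

Lemma conjRC (t : R) : Num.conj (t%:C%C : R[i]) = t%:C%C.
Proof. by apply/CrealP; apply/complex_realP; exists t. Qed.

Local Notation "t *:r x" := ((t%:C%C : R[i]) *: x) (at level 40).

Lemma rnormZr (V : normedModType R[i]) t (x : V) :
  rnorm ((t%:C%C : R[i]) *: x) = `|t| * rnorm x.
Proof. by rewrite rnormZc rnormRC. Qed.

Lemma cstarZr t x : cstar (t *:r x) = t *:r cstar x.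
Proof. by rewrite cstarZ conjRC. Qed.

(** * Square roots in the unitization *)

(** The iteration y := (x + y ^ 2) / 2 from y = 0 converges to a solution of
    (1 - y) ^ 2 = 1 - x.  Its iterates are polynomials in x with nonnegative
    coefficients, so the scalar iteration at x = 1 dominates it whenever x has
    norm at most 1. *)
Fixpoint visserR n : R := if n is n'.+1 then (1 + visserR n' ^+ 2) / 2 else 0.

Fixpoint visser x n : U :=
  if n is n'.+1 then (2^-1)%R *:r (x + visser x n' ^+ 2) else 0.

Lemma visserR01 n : 0 <= visserR n <= 1.
Proof.
by elim: n => [|n /andP[h0 h1]] /=; [rewrite lexx ler01|apply/andP; split; nra].
Qed.

Lemma visserR_cvg : exists2 L, visserR @ \oo --> L & L <= 1.
Proof.
have nd : nondecreasing_seq visserR.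
  by apply/nondecreasing_seqP => n /=; have /andP[] := visserR01 n; nra.
have ub n : visserR n <= 1 by have /andP[] := visserR01 n.
have vc : cvgn visserR.
  by apply: nondecreasing_is_cvgn => //; exists 1 => _ [n _ <-].
by exists (limn visserR) => //; apply: limr_le => //; apply: nearW.
Qed.

Lemma visser_comm x y n : x * y = y * x -> visser x n * y = y * visser x n.
Proof.
move=> xy; elim: n => [|n IH] /=; first by rewrite mul0r mulr0.
rewrite -scalerAl -scalerAr mulrDl mulrDr xy; congr (_ *: (_ + _)).
by rewrite !expr2 -mulrA IH mulrA IH -mulrA.
Qed.

Lemma visser_star x n : cstar x = x -> cstar (visser x n) = visser x n.
Proof.
move=> xx; elim: n => [|n IH] /=; first exact: cstar0.
by rewrite cstarZr cstarD xx ustarX IH.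
Qed.

Lemma visser_norm x n : rnorm x <= 1 -> rnorm (visser x n) <= visserR n.
Proof.
move=> x1; elim: n => [|n IH] /=; first by rewrite rnorm0.
have h := rnorm_ge0 (visser x n).
rewrite rnormZr ger0_norm ?invr_ge0// mulrC ler_wpM2r ?invr_ge0//.
rewrite (le_trans (ler_rnormD _ _))// lerD// (le_trans (urnormM _ _))//.
by rewrite -expr2 lerXn2r ?nnegrE// (le_trans h).
Qed.

(** Consecutive differences satisfy d' = d (y' + y) / 2, an identity that needs
    the iterates to commute; the induction compares its two factors with the
    scalar ones. *)
Lemma visser_step x n : rnorm x <= 1 ->
  rnorm (visser x n.+1 - visser x n) <= visserR n.+1 - visserR n.
Proof.
move=> x1; elim: n => [|n IH].
  rewrite /= !subr0 !expr0n /= !addr0 rnormZr ger0_norm ?invr_ge0//.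
  by rewrite mulrC ler_wpM2r ?invr_ge0.
set v1 := visser x n.+1 in IH *; set v0 := visser x n in IH *.
have -> : visser x n.+2 - v1 = 2^-1 *:r ((v1 - v0) * (v1 + v0)).
  rewrite /v1 [visser x n.+2]/= -/v1 {2}/v1 /= -/v0 -scalerBr opprD addrACA subrr add0r.
  congr (_ *: _); rewrite mulrDr !mulrBl [v0 * v1](_ : _ = v1 * v0).
    by rewrite addrA subrK !expr2.
  by rewrite visser_comm// -/v1; apply/esym/visser_comm.
have -> : visserR n.+2 - visserR n.+1 =
    2^-1 * ((visserR n.+1 - visserR n) * (visserR n.+1 + visserR n)).
  by rewrite /=; field.
rewrite rnormZr ger0_norm ?invr_ge0// ler_wpM2l ?invr_ge0//.
rewrite (le_trans (urnormM _ _))// ler_pM ?rnorm_ge0//.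
by rewrite (le_trans (ler_rnormD _ _))// lerD// visser_norm.
Qed.

Lemma visser_cvg L x : rnorm x <= 1 -> visserR @ \oo --> L ->
  exists y, (visser x @ \oo --> y) /\ forall n, rnorm (y - visser x n) <= L - visserR n.
Proof. by move=> x1; apply: majorant_cvg => n; exact: visser_step. Qed.

(** q lies in the bicommutant of p.  Square roots are limits of polynomials in
    their square, and this is all that is remembered of that fact. *)
Definition bicommutes p q := forall x, p * x = x * p -> q * x = x * q.

Lemma sqrt_one_sub x : cstar x = x -> rnorm x <= 1 ->
  exists s : U, [/\ cstar s = s, s ^+ 2 = 1 - x, bicommutes x s & rnorm (1 - s) <= 1].
Proof.
move=> xx x1; have [L vL L1] := visserR_cvg.
have [y [vy yv]] := visser_cvg x1 vL.
have vyS : visser x n.+1 @[n --> \oo] --> y by rewrite (cvg_shiftS (visser x)).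
have yE : y = 2^-1 *:r (x + y ^+ 2).
  apply: (cvg_eq vyS) => [|n]; last by [].
  apply: cvgZl_tmp; apply: cvgD; first exact: cvg_cst.
  exact: (cvg_umul vy vy).
have y2 : y + y = x + y ^+ 2.
  rewrite {1 2}yE -scalerDl -rmorphD (_ : 2^-1 + 2^-1 = 1) ?scale1r//; lra.
exists (1 - y); split.
- rewrite cstarD cstarN ustar1; congr (1 - _).
  by apply: (cvg_eq (cvg_cstar vy) vy) => n; rewrite visser_star.
- rewrite expr2 mulrBl !mulrBr !mul1r mulr1 -expr2 opprB.
  have -> : y ^+ 2 - y = y - x.
    by apply/eqP; rewrite subr_eq addrAC y2 addrAC subrr add0r.
  by rewrite addrA subrK.
- move=> z xz; rewrite mulrBl mulrBr mul1r mulr1; congr (_ - _).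
  have cz : (fun=> z) @ \oo --> z by exact: cvg_cst.
  by apply: (cvg_eq (cvg_umul vy cz) (cvg_umul cz vy)) => n; exact: visser_comm.
- rewrite opprB addrC subrK.
  by have := yv 0%N; rewrite /= !subr0 => /le_trans; exact.
Qed.

End UnitizationTheory.

(** * Positive elements *)

Lemma cstarB (R : realType) (A : cstarAlgType R) (x y : A) :
  cstar (x - y) = cstar x - cstar y.
Proof. by rewrite cstarD cstarN. Qed.

Section Positivity.
Context {R : realType} {A : cstarAlgType R}.
Local Notation U := (unitization A).
Local Notation "t *:r x" := ((t%:C%C : R[i]) *: x) (at level 40).
Implicit Types (x y z p q u v j k : U) (a b : A) (t l : R).

Lemma rscaleDl s t x : (s + t) *:r x = s *:r x + t *:r x.
Proof. by rewrite rmorphD scalerDl. Qed.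

Lemma rscaleA s t x : s *:r (t *:r x) = (s * t) *:r x.
Proof. by rewrite rmorphM scalerA. Qed.

Lemma rscale1 x : 1 *:r x = x.
Proof. by rewrite rmorph1 scale1r. Qed.

Lemma rscale0 x : 0 *:r x = 0.
Proof. by rewrite rmorph0 scale0r. Qed.

(** Positivity in terms of the norm: for functions, the condition says that
    the values of p lie in a disc touching the imaginary axis from the right. *)
Definition psd p : Prop :=
  cstar p = p /\ exists2 l, 0 <= l & rnorm (l *:r 1 - p) <= l.

Lemma psd_star p : psd p -> cstar p = p. Proof. by case. Qed.

Lemma psd_scalar t : 0 <= t -> psd (t *:r 1).
Proof.
by move=> t0; split; [rewrite cstarZr ustar1|exists t; rewrite // subrr rnorm0].
Qed.

Lemma psd0 : psd 0.
Proof. by rewrite -(rscale0 1); exact: psd_scalar. Qed.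

Lemma psdD p q : psd p -> psd q -> psd (p + q).
Proof.
move=> [ps [l l0 lp]] [qs [m m0 mq]]; split; first by rewrite cstarD ps qs.
exists (l + m); first exact: addr_ge0.
by rewrite rscaleDl opprD addrACA (le_trans (ler_rnormD _ _))// lerD.
Qed.

Lemma psdZ t p : 0 <= t -> psd p -> psd (t *:r p).
Proof.
move=> t0 [ps [l l0 lp]]; split; first by rewrite cstarZr ps.
exists (t * l); first exact: mulr_ge0.
by rewrite -rscaleA -scalerBr rnormZr ger0_norm// ler_wpM2l.
Qed.

Lemma psd_sub_scalar p l : cstar p = p -> rnorm p <= l -> psd (l *:r 1 - p).
Proof.
move=> ps pl; split; first by rewrite cstarB cstarZr ustar1 ps.
exists l; first exact: le_trans (rnorm_ge0 _) pl.
by rewrite opprB addrC subrK.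
Qed.

(** Positivity of p says exactly that 1 - p / l is a contraction, so that
    1 minus it has a square root. *)
Lemma psd_sqrt p : psd p ->
  exists j, [/\ cstar j = j, j ^+ 2 = p, bicommutes p j & psd j].
Proof.
move=> [ps [l l0 lp]].
have [l_eq0|ln0] := eqVneq l 0.
  exists 0; have -> : p = 0.
    move: lp; rewrite l_eq0 rscale0 sub0r rnormN => lp.
    by apply: rnorm0_eq0; apply/le_anti; rewrite lp rnorm_ge0.
  split; [exact: cstar0|by rewrite expr0n| |exact: psd0].
  by move=> x _; rewrite mulr0 mul0r.
have l_gt0 : 0 < l by rewrite lt_neqAle eq_sym ln0.
have [||s [ss s2 sb s1]] := @sqrt_one_sub _ _ (1 - l^-1 *:r p).
- by rewrite cstarB ustar1 cstarZr ps.
- have -> : 1 - l^-1 *:r p = l^-1 *:r (l *:r 1 - p).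
    by rewrite scalerBr rscaleA mulVf// rscale1.
  by rewrite rnormZr ger0_norm ?invr_ge0// mulrC ler_pdivrMr// mul1r.
have q0 : 0 <= Num.sqrt l := sqrtr_ge0 _.
exists (Num.sqrt l *:r s); split.
- by rewrite cstarZr ss.
- rewrite exprZn s2 opprB addrC subrK -rmorphXn/= sqr_sqrtr// rscaleA.
  by rewrite mulfV// rscale1.
- move=> x px; rewrite -scalerAl -scalerAr sb// mulrBl mulrBr mul1r mulr1.
  by rewrite -scalerAl -scalerAr px.
- apply: psdZ => //; split=> //; exists 1; rewrite ?ler01//.
  by rewrite rscale1.
Qed.

Definition unit_i : R[i] := Complex 0 1.

Lemma unit_i2 : unit_i * unit_i = -1.
Proof. by rewrite /unit_i; simpc. Qed.

Lemma conj_unit_i : Num.conj unit_i = - unit_i.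
Proof. by rewrite /unit_i -[LHS]/(Complex _ _); apply/eqP; rewrite eq_complex /= oppr0 !eqxx. Qed.

Lemma star_mul_cartesian j k : cstar j = j -> cstar k = k -> j * k = k * j ->
  cstar (j + unit_i *: k) * (j + unit_i *: k) = j ^+ 2 + k ^+ 2.
Proof.
move=> js ks jk; rewrite cstarD cstarZ js ks conj_unit_i mulrDl !mulrDr.
rewrite -!scalerAr -!scalerAl scalerA mulrN unit_i2 opprK scale1r jk.
by rewrite addrA -[X in X + _]addrA -scalerDl subrr scale0r addr0.
Qed.

(** Up to scaling, j + i k is unitary, and j is the mean of this element and its
    adjoint.  Every comparison of norms below comes down to this remark. *)
Lemma norm_cartesian j k l : 0 <= l -> cstar j = j -> cstar k = k -> j * k = k * j ->
  j ^+ 2 + k ^+ 2 = l *:r 1 -> rnorm j ^+ 2 <= l.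
Proof.
move=> l0 js ks jk jkl; set v := j + unit_i *: k.
have vl : rnorm v ^+ 2 = l.
  rewrite -urnorm_star star_mul_cartesian// jkl rnormZr ger0_norm// urnorm1.
  by rewrite mulr1.
have -> : j = 2^-1 *:r (v + cstar v).
  rewrite /v cstarD cstarZ js ks conj_unit_i scaleNr addrACA subrr addr0.
  by rewrite -[X in X + X]rscale1 -rscaleDl rscaleA (_ : 2^-1 * _ = 1) ?rscale1//; lra.
rewrite -vl lerXn2r ?nnegrE ?rnorm_ge0// rnormZr ger0_norm ?invr_ge0//.
rewrite mulrC ler_pdivrMr// mulr_natr mulr2n (le_trans (ler_rnormD _ _))//.
by rewrite rnormS.
Qed.

(** With s a square root of 1 - j ^ 2 / l, the pair (s, j) is of the form treated
    above, so s is a contraction, and l - j ^ 2 = l s ^ 2. *)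
Lemma psd_sqr j : cstar j = j -> psd (j ^+ 2).
Proof.
move=> js; split; first by rewrite ustarX js.
have l0 : 0 <= rnorm j ^+ 2 + 1 by rewrite addr_ge0 ?sqr_ge0.
have l_gt0 : 0 < rnorm j ^+ 2 + 1 by rewrite ltr_wpDl ?sqr_ge0.
set l := rnorm j ^+ 2 + 1 in l0 l_gt0 *; exists l => //.
have [||s [ss s2 sb _]] := @sqrt_one_sub _ _ (l^-1 *:r j ^+ 2).
- by rewrite cstarZr ustarX js.
- rewrite rnormZr ger0_norm ?invr_ge0// mulrC ler_pdivrMr// mul1r.
  by rewrite (le_trans (urnormM _ _))// -expr2 lerDl.
have lE : l *:r 1 - j ^+ 2 = l *:r s ^+ 2.
  by rewrite s2 scalerBr rscaleA mulfV ?gt_eqF// rscale1.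
rewrite lE rnormZr ger0_norm// ler_piMr//.
have -> : rnorm (s ^+ 2) = rnorm s ^+ 2 by rewrite -urnorm_star ss.
apply: (@norm_cartesian s ((Num.sqrt l)^-1 *:r j)) => //.
- by rewrite cstarZr js.
- rewrite -scalerAl -scalerAr; congr (_ *: _); apply: sb.
  by rewrite -scalerAl -scalerAr expr2 mulrA.
- rewrite exprZn s2 -rmorphXn/= exprVn sqr_sqrtr// subrK.
  by rewrite rscale1.
Qed.

Lemma psd_mul p q : psd p -> psd q -> p * q = q * p -> psd (p * q).
Proof.
move=> /psd_sqrt[j [js jp jb _]] /psd_sqrt[k [ks kq kb _]] pq.
have jk : j * k = k * j by apply: jb; rewrite kb.
have -> : p * q = (j * k) ^+ 2.
  by rewrite -jp -kq !expr2 -!mulrA; congr (_ * _); rewrite !mulrA jk.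
by apply: psd_sqr; rewrite ustarM js ks jk.
Qed.

(** The square roots of p and l - p commute and their squares add up to l. *)
Lemma psd_norm_le p l : 0 <= l -> psd p -> psd (l *:r 1 - p) -> rnorm p <= l.
Proof.
move=> l0 pp; have [j [js jp jb _]] := psd_sqrt pp.
move=> /psd_sqrt[k [ks kq kb _]].
have -> : rnorm p = rnorm j ^+ 2 by rewrite -urnorm_star js -expr2 jp.
apply: (norm_cartesian l0 js ks).
- apply: jb; apply/esym/kb; rewrite mulrBl mulrBr -scalerAl -scalerAr mul1r.
  by rewrite mulr1.
- by rewrite jp kq addrC subrK.
Qed.

Lemma psd_le_norm p q : psd p -> psd (q - p) -> rnorm p <= rnorm q.
Proof.
move=> pp pq; apply: psd_norm_le => //; first exact: rnorm_ge0.
have -> : rnorm q *:r 1 - p = (rnorm q *:r 1 - q) + (q - p) by rewrite addrA subrK.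
apply: psdD => //; apply: psd_sub_scalar => //.
by rewrite -(subrK p q) cstarD (psd_star pp) (psd_star pq).
Qed.

Lemma psd_antisym p : psd p -> psd (- p) -> p = 0.
Proof.
move=> pp pn; apply: rnorm0_eq0; apply/le_anti; rewrite rnorm_ge0 andbT.
by apply: psd_norm_le => //; rewrite rscale0 sub0r.
Qed.

Lemma sa_sqr_eq0 x : cstar x = x -> x ^+ 2 = 0 -> x = 0.
Proof.
move=> xs x2; apply: rnorm0_eq0; apply/eqP; rewrite -sqrf_eq0 -urnorm_star xs.
by rewrite -expr2 x2 rnorm0.
Qed.

Lemma star_mul_sum y : exists b c : U, [/\ cstar b = b, cstar c = c &
  y * cstar y + cstar y * y = 2 *:r (b ^+ 2 + c ^+ 2)].
Proof.
exists (2^-1 *:r (y + cstar y)), ((2^-1%:C%C * unit_i) *: (cstar y - y)).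
split.
- by rewrite cstarZr cstarD cstarK addrC.
- rewrite cstarZ cstarB cstarK rmorphM /= conj_unit_i conjRC mulrN scaleNr.
  by rewrite -scalerN opprB.
- rewrite !exprZn exprMn [unit_i ^+ 2]expr2 unit_i2 mulrN1 scaleNr -scalerBr.
  rewrite -rmorphXn scalerA -rmorphM /=.
  rewrite !expr2 !mulrDl !mulrDr !mulNr !mulrN !opprK.
  set a := y * y; set b := cstar y * cstar y; set c := y * _; set d := _ * y.
  have -> : a + c + (d + b) - (b - d + (- c + a)) = 2 *:r (c + d).
    rewrite -[2]/(1 + 1) rscaleDl rscale1 !opprD !opprK !addrA.
    by rewrite [LHS](ACl (1*8*4*5*2*3*7*6))/= subrr add0r subrr add0r.
  by rewrite scalerA -rmorphM/= (_ : _ * 2 = 1) ?rmorph1 ?scale1r//; field.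
Qed.

(** If y^* y = - k ^ 2 then y y^* is positive, because the sum of both is a sum of
    squares; let j be its root.  For z = y k this makes both z^* z and z z^*
    negatives of squares, namely - k ^ 4 and - j ^ 4, while their sum is again a
    sum of squares; hence k ^ 4 = 0. *)
Lemma star_mul_neg_sqr y k : cstar k = k -> cstar y * y = - k ^+ 2 -> k = 0.
Proof.
move=> ks yk.
have psd_2 (b c : U) : cstar b = b -> cstar c = c -> psd (2 *:r (b ^+ 2 + c ^+ 2)).
  by move=> bs cs; apply: psdZ => //; apply: psdD; exact: psd_sqr.
have [j [js jE]] : exists j : U, cstar j = j /\ j ^+ 2 = y * cstar y.
  have [b [c [bs cs bcE]]] := star_mul_sum y.
  have : psd (y * cstar y).
    have -> : y * cstar y = 2 *:r (b ^+ 2 + c ^+ 2) + k ^+ 2.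
      by rewrite -bcE yk subrK.
    by apply: psdD; [exact: psd_2|exact: psd_sqr].
  by move=> /psd_sqrt[j [? ? _ _]]; exists j.
have [b [c [bs cs]]] := star_mul_sum (y * k).
have -> : y * k * cstar (y * k) = - (j ^+ 2) ^+ 2.
  rewrite ustarM ks jE [RHS](_ : _ = - (y * (cstar y * y) * cstar y)).
    by rewrite yk mulrN mulNr opprK expr2 !mulrA.
  by rewrite expr2 !mulrA.
have -> : cstar (y * k) * (y * k) = - (k ^+ 2) ^+ 2.
  rewrite ustarM ks -mulrA (mulrA (cstar y)) yk mulNr mulrN !expr2.
  by rewrite !mulrA.
move=> E; have k4 : (k ^+ 2) ^+ 2 = 0.
  have k2s : cstar (k ^+ 2) = k ^+ 2 by rewrite ustarX ks.
  apply: psd_antisym; first exact: psd_sqr.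
  rewrite (_ : - _ = 2 *:r (b ^+ 2 + c ^+ 2) + (j ^+ 2) ^+ 2).
    by apply: psdD; [exact: psd_2|apply: psd_sqr; rewrite ustarX js].
  by rewrite -E addrAC addNr add0r.
by apply: sa_sqr_eq0 => //; apply: sa_sqr_eq0 => //; rewrite ustarX ks.
Qed.

(** Let x = u^* u and let m be the root of x ^ 2, to be thought of as |x|.  The
    element n = m - x is twice the negative part of x, and u n satisfies the
    hypothesis of the previous lemma, which forces n = 0. *)
Lemma psd_star_mul u : psd (cstar u * u).
Proof.
set x := cstar u * u.
have xs : cstar x = x by rewrite ustarM cstarK.
have [m [ms m2 mb mp]] := psd_sqrt (psd_sqr xs).
have xm : x * m = m * x by apply/esym/mb; rewrite expr2 mulrA.
have [r [rs r2 rb _]] := psd_sqrt mp.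
pose n := m - x.
have ns : cstar n = n by rewrite cstarB ms xs.
have mn : m * n = n * m by rewrite mulrBl mulrBr xm.
have rn : r * n = n * r by exact: rb.
have nx : n * x = - (m * n).
  by rewrite /n mulrBl mulrBr opprB -expr2 -m2 expr2.
have n2 : n ^+ 2 = 2 *:r (m * n).
  rewrite expr2 {1}/n mulrBl [x * n](_ : _ = n * x); last by rewrite mulrBl mulrBr xm.
  by rewrite nx opprK -[2]/(1 + 1) rscaleDl rscale1.
have rn0 : r * n = 0.
  apply: (@star_mul_neg_sqr (u * n)); first by rewrite ustarM rs ns rn.
  rewrite ustarM ns -mulrA (mulrA (cstar u)) -/x mulrA nx mulNr; congr (- _).
  by rewrite -r2 !expr2 -!mulrA; congr (_ * _); rewrite !mulrA rn.
have n0 : n = 0.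
  by apply: sa_sqr_eq0 => //; rewrite n2 -r2 expr2 -mulrA rn0 mulr0 scaler0.
by have -> : x = m by apply/esym/eqP; rewrite -subr_eq0 -/n n0.
Qed.

End Positivity.

(** * Polynomials in a self-adjoint contraction *)

Section RealHorner.
Context {R : realType} {A : cstarAlgType R}.
Local Notation U := (unitization A).
Local Notation "t *:r x" := ((t%:C%C : R[i]) *: x) (at level 40).
Implicit Types (j x y : U) (p q : {poly R}) (t : R).

Definition rhorner j p : U := horner_alg j (map_poly (real_complex R) p).

Lemma rhornerD j p q : rhorner j (p + q) = rhorner j p + rhorner j q.
Proof. by rewrite /rhorner !rmorphD. Qed.

Lemma rhornerN j p : rhorner j (- p) = - rhorner j p.
Proof. by rewrite /rhorner !rmorphN. Qed.

Lemma rhornerM j p q : rhorner j (p * q) = rhorner j p * rhorner j q.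
Proof. by rewrite /rhorner !rmorphM. Qed.

Lemma rhornerXn j p n : rhorner j (p ^+ n) = rhorner j p ^+ n.
Proof. by rewrite /rhorner !rmorphXn. Qed.

Lemma rhornerC j t : rhorner j t%:P = t *:r 1.
Proof. by rewrite /rhorner map_polyC /= horner_algC. Qed.

Lemma rhornerX j : rhorner j 'X = j.
Proof. by rewrite /rhorner map_polyX horner_algX. Qed.

Lemma rhorner_star j p : cstar j = j -> cstar (rhorner j p) = rhorner j p.
Proof.
move=> js; elim/poly_ind: p => [|p c IH].
  by rewrite /rhorner !rmorph0 cstar0.
rewrite rhornerD rhornerM rhornerX rhornerC cstarD ustarM cstarZr ustar1 IH js.
by have := rhornerM j 'X p; rewrite mulrC rhornerM rhornerX => ->.
Qed.

Lemma rhorner_comm j p q : rhorner j p * rhorner j q = rhorner j q * rhorner j p.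
Proof. by rewrite -!rhornerM mulrC. Qed.

Lemma poly_real_quadratic_factor p (a b : R) : b != 0 ->
  root (map_poly (real_complex R) p) (Complex a b) ->
  exists q, p = q * (('X - a%:P) ^+ 2 + (b ^+ 2)%:P).
Proof.
move=> b0 /rootP pz; set Q := _ + _.
have sQ : size Q = 3%N.
  rewrite /Q size_polyDl; first by rewrite size_exp_XsubC.
  by rewrite size_exp_XsubC size_polyC sqrf_eq0 b0.
have Q0 : Q != 0 by rewrite -size_poly_eq0 sQ.
have Qz : (map_poly (real_complex R) Q).[Complex a b] = 0.
  rewrite /Q rmorphD rmorphXn rmorphB /= map_polyX !map_polyC /= !hornerE.
  by apply/eqP; rewrite expr2 eq_complex /=; apply/andP; split; apply/eqP; ring.
exists (p %/ Q); rewrite {1}(divp_eq p Q).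
suff -> : p %% Q = 0 by rewrite addr0.
have sr : (size (p %% Q)%R <= 2)%N by rewrite -ltnS -sQ ltn_modp.
set r := p %% Q in sr *.
have rE : r = (r`_0)%:P + (r`_1)%:P * 'X.
  apply/polyP => -[|[|i]].
  - by rewrite coefD coefC coefCM coefX mulr0 addr0.
  - by rewrite coefD coefC coefCM coefX mulr1 add0r.
  - by rewrite coefD coefC coefCM coefX mulr0 addr0 nth_default// (leq_trans sr).
have rz : (map_poly (real_complex R) r).[Complex a b] = 0.
  move: pz; rewrite {1}(divp_eq p Q) -/r rmorphD rmorphM /= hornerD hornerM Qz.
  by rewrite mulr0 add0r.
move: rz; rewrite rE rmorphD rmorphM /= map_polyX !map_polyC /= !hornerE.
move=> /eqP; rewrite eq_complex /= => /andP[/eqP h0 /eqP h1].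
have r1 : r`_1 = 0.
  by apply/eqP; rewrite -[_ == 0]orbF -(negbTE b0) -mulf_eq0; apply/eqP; lra.
have r0 : r`_0 = 0 by move: h0; rewrite r1; lra.
by rewrite r0 r1 mul0r addr0.
Qed.

(** A real polynomial without roots in [-1,1] is, up to sign, a product of factors
    x - a with a < -1, of factors a - x with 1 < a, and of factors
    (x - a) ^ 2 + b ^ 2.  Each of them is positive at j, and commuting positive
    elements have a positive product.  A strict inequality is assumed so that
    roots in [-1,1] never occur. *)
Lemma rhorner_psd j p : cstar j = j -> rnorm j <= 1 ->
  (forall t, -1 <= t <= 1 -> 0 < p.[t]) -> psd (rhorner j p).
Proof.
move=> js j1.
have [n] := ubnP (size p); elim: n p => // n IH p; rewrite ltnS => sp p0.
have [sp1|sp1] := leqP (size p) 1.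
  have p00 : 0 < p.[0] by apply: p0; lra.
  move: (size1_polyC sp1) p00; set c := p`_0 => ->.
  by rewrite hornerC rhornerC => /ltW; exact: psd_scalar.
have /closed_rootP[[a b] rz] : size (map_poly (real_complex R) p) != 1%N.
  by rewrite size_map_poly neq_ltn sp1 orbT.
have p_neq0 (q : {poly R}) : (forall t, -1 <= t <= 1 -> 0 < q.[t]) -> q != 0.
  move=> q0; apply/eqP => qq; suff : 0 < q.[0] by rewrite qq horner0 ltxx.
  by apply: q0; lra.
have [b0|b0] := eqVneq b 0; last first.
  (* a pair of conjugate non-real roots *)
  have [q pE] := poly_real_quadratic_factor b0 rz.
  have q_gt0 t : -1 <= t <= 1 -> 0 < q.[t].
    move=> /p0; rewrite pE hornerM pmulr_lgt0// hornerD horner_exp !hornerE.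
    by rewrite ltr_wpDl ?sqr_ge0// lt_neqAle eq_sym sqrf_eq0 b0 sqr_ge0.
  rewrite pE rhornerM; apply: psd_mul; last exact: rhorner_comm.
    apply: IH => //; apply: leq_trans sp; rewrite pE.
    have q0 := p_neq0 _ q_gt0.
    have sQ : size (('X - a%:P) ^+ 2 + (b ^+ 2)%:P) = 3%N.
      rewrite size_polyDl; first by rewrite size_exp_XsubC.
      by rewrite size_exp_XsubC size_polyC sqrf_eq0 b0.
    have Q0 : ('X - a%:P) ^+ 2 + (b ^+ 2)%:P != 0 by rewrite -size_poly_eq0 sQ.
    by rewrite size_mul// sQ addn3 /= ltnW.
  rewrite rhornerD rhornerXn rhornerC; apply: psdD.
    by apply: psd_sqr; exact: rhorner_star.
  by apply: psd_scalar; rewrite sqr_ge0.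
have ra : root p a.
  move: rz; rewrite b0 -[Complex a 0]/(real_complex R a).
  by rewrite fmorph_root.
have [p' pE] := factor_theorem _ _ ra.
have sp' : p' != 0 -> (size p' < size p)%N.
  move=> p'0; rewrite pE size_mul ?polyXsubC_eq0// size_XsubC addn2.
  exact: ltnSn.
have [a1|a1] := ltP a (-1).
  (* j - a = (1 + j) + (- 1 - a) *)
  have p'gt0 t : -1 <= t <= 1 -> 0 < p'.[t].
    move=> t1; have := p0 _ t1; rewrite pE hornerM pmulr_lgt0// !hornerE.
    by lra.
  rewrite pE rhornerM; apply: psd_mul; last exact: rhorner_comm.
    by apply: IH => //; apply: leq_trans sp; apply: sp'; exact: p_neq0.
  have -> : rhorner j ('X - a%:P) = (1 *:r 1 - - j) + (- 1 - a) *:r 1.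
    rewrite rhornerD rhornerN rhornerX rhornerC opprK [_ + j]addrC -addrA -rscaleDl.
    by rewrite (_ : 1 + (-1 - a) = - a) ?rmorphN ?scaleNr//; lra.
  apply: psdD; last by apply: psd_scalar; lra.
  by apply: psd_sub_scalar; rewrite ?cstarN ?js ?rnormN.
have [a2|a2] := ltP 1 a; last first.
  have := p0 a; rewrite a1 a2 => /(_ isT).
  by rewrite (rootP ra) ltxx.
(* a - j = (1 - j) + (a - 1); the signs of both factors are changed *)
have p'gt0 t : -1 <= t <= 1 -> 0 < (- p').[t].
  move=> t1; have := p0 _ t1; rewrite pE -[_ * _]opprK -mulNr -mulrN hornerM.
  by rewrite pmulr_lgt0// !hornerE; lra.
rewrite pE -[_ * _]opprK -mulNr -mulrN rhornerM.
apply: psd_mul; last exact: rhorner_comm.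
  apply: IH => //; apply: leq_trans sp; rewrite size_polyN; apply: sp'.
  by rewrite -oppr_eq0; exact: p_neq0.
have -> : rhorner j (- ('X - a%:P)) = (1 *:r 1 - j) + (a - 1) *:r 1.
  rewrite opprB rhornerD rhornerN rhornerX rhornerC addrAC -rscaleDl.
  by rewrite (_ : 1 + (a - 1) = a)//; lra.
by apply: psdD; [exact: psd_sub_scalar|apply: psd_scalar; lra].
Qed.

(** Apply positivity to (M + e) ^ 2 - p ^ 2. *)
Lemma rhorner_norm j p M : cstar j = j -> rnorm j <= 1 ->
  (forall t, -1 <= t <= 1 -> `|p.[t]| <= M) -> rnorm (rhorner j p) <= M.
Proof.
move=> js j1 pM.
have M0 : 0 <= M by apply: le_trans (pM 0 _); rewrite ?normr_ge0//; lra.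
apply/ler_addgt0Pl => e e0; have eM0 : 0 <= e + M by rewrite addr_ge0// ltW.
rewrite -(@ler_pXn2r _ 2)// ?nnegrE ?rnorm_ge0// -urnorm_star rhorner_star//.
rewrite -expr2 -rhornerXn; apply: psd_norm_le; first exact: sqr_ge0.
  by rewrite rhornerXn; apply/psd_sqr/rhorner_star.
rewrite -(rhornerC j) -rhornerN -rhornerD; apply: rhorner_psd => // t t1.
rewrite hornerD hornerN hornerC horner_exp subr_gt0 -[p.[t] ^+ 2]real_normK ?num_real//.
by rewrite ltrXn2r// ?nnegrE// (le_lt_trans (pM _ t1))// ltrDr.
Qed.

End RealHorner.

(** * Norm estimates and approximate units *)

Section Consequences.
Context {R : realType} {A : cstarAlgType R}.
Local Notation U := (unitization A).
Local Notation "t *:r x" := ((t%:C%C : R[i]) *: x) (at level 40).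
Implicit Types (x y z p q u v h j k : U) (a b c e : A) (t M : R).

Lemma psd_star_conj p u : psd p -> psd (cstar u * p * u).
Proof.
move=> /psd_sqrt[j [js <- _ _]]; have := psd_star_mul (j * u).
by rewrite ustarM js expr2 !mulrA.
Qed.

Lemma star_mul_le_norm x z : psd (cstar z * z - cstar x * x) -> rnorm x <= rnorm z.
Proof.
move=> h; rewrite -(@ler_pXn2r _ 2)// ?nnegrE ?rnorm_ge0// -!urnorm_star.
by apply: psd_le_norm h; exact: psd_star_mul.
Qed.

(** The form in which positivity is used in algebras without unit. *)
Lemma star_sum_le_norm a b c :
  cmul (cstar a) a + cmul (cstar b) b = cmul (cstar c) c -> rnorm a <= rnorm c.
Proof.
move=> E; rewrite -[rnorm a]rnorm_inj -[rnorm c]rnorm_inj; apply: star_mul_le_norm.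
rewrite -!inj_star -!injM -E raddfD /= addrAC subrr add0r injM inj_star.
exact: psd_star_mul.
Qed.

Lemma star_mul_complement x M : rnorm x <= M ->
  exists s : U, cstar s = s /\ s ^+ 2 = M ^+ 2 *:r 1 - cstar x * x.
Proof.
move=> xM; have /psd_sqrt[s [ss s2 _ _]] : psd (M ^+ 2 *:r 1 - cstar x * x).
  apply: psd_sub_scalar; first by rewrite ustarM cstarK.
  by rewrite urnorm_star lerXn2r ?nnegrE ?rnorm_ge0// (le_trans (rnorm_ge0 x)).
by exists s.
Qed.

Lemma rhorner_comp j (p q : {poly R}) : rhorner j (p \Po q) = rhorner (rhorner j q) p.
Proof.
elim/poly_ind: p => [|p c IH]; first by rewrite comp_poly0 /rhorner !rmorph0.
rewrite comp_polyD comp_polyM comp_polyX comp_polyC.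
by rewrite !rhornerD !rhornerM !rhornerC IH rhornerX.
Qed.

(** Only the values of t q(t^2) on [0,1] matter although u is arbitrary: if j is
    the root of u^* u, then u q(u^* u) and j q(j^2) have the same norm. *)
Lemma star_rhorner_norm u (q : {poly R}) M : rnorm u <= 1 ->
  (forall t, 0 <= t <= 1 -> `|t * q.[t ^+ 2]| <= M) ->
  rnorm (u * rhorner (cstar u * u) q) <= M.
Proof.
move=> u1 qM; have M0 : 0 <= M by apply: le_trans (qM 0 _); rewrite ?normr_ge0//; lra.
have [j [js ju _ _]] := psd_sqrt (psd_star_mul u).
have xs : cstar (cstar u * u) = cstar u * u by rewrite ustarM cstarK.
have -> : rnorm (u * rhorner (cstar u * u) q) = rnorm (rhorner j ('X * (q \Po 'X^2))).
  rewrite rhornerM rhorner_comp rhornerXn rhornerX ju; set z := rhorner _ q.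
  have zs : cstar z = z by exact: rhorner_star.
  apply/eqP; rewrite -(@eqrXn2 _ 2)// ?rnorm_ge0// -!urnorm_star !ustarM zs js.
  by rewrite -!mulrA (mulrA (cstar u)) -ju expr2 !mulrA.
apply: rhorner_norm => //.
  rewrite -(@ler_pXn2r _ 2)// ?nnegrE ?rnorm_ge0// -urnorm_star js -expr2 ju.
  by rewrite urnorm_star lerXn2r ?nnegrE ?rnorm_ge0.
move=> t t1; rewrite hornerM hornerX horner_comp hornerXn.
have := qM `|t|; rewrite normrM normr_id real_normK ?num_real// -normrM; apply.
by rewrite normr_ge0/= ler_norml.
Qed.

Lemma expr_mul_one_sub_le t n : 0 <= t <= 1 -> t ^+ n * (1 - t) <= n.+1%:R^-1.
Proof.
move=> /andP[t0 t1]; rewrite -[leRHS]mul1r ler_pdivlMr ?ltr0n//.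
suff : n.+1%:R * (t ^+ n * (1 - t)) <= 1 - t ^+ n.+1.
  by rewrite mulrC => /le_trans; apply; rewrite lerBlDr lerDl exprn_ge0.
elim: n => [|n IH]; first by rewrite expr0 expr1 !mul1r.
rewrite -natr1 mulrDl mul1r; set s := t ^+ n.+1 in IH *.
have s1 : s <= 1 by exact: exprn_ile1.
have : t * (n.+1%:R * (t ^+ n * (1 - t))) <= t * (1 - s) by rewrite ler_wpM2l.
have -> : t * (n.+1%:R * (t ^+ n * (1 - t))) = n.+1%:R * (s * (1 - t)).
  by rewrite /s exprS; ring.
have : 0 <= (1 - t) * (1 - s) by rewrite mulr_ge0// subr_ge0.
rewrite [t ^+ n.+2]exprS -/s; lra.
Qed.

Lemma horner_1subX2 t : (1 - 'X^2 : {poly R}).[t] = 1 - t ^+ 2.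
Proof. by rewrite hornerD hornerN hornerXn -polyC1 hornerC. Qed.

(** Quantitative form of the fact that t^n (1 - t) and t (1 - t)^n tend to 0
    uniformly on [0,1]. *)
Lemma psd_expr_small q n : psd q -> rnorm q <= 1 ->
  rnorm (q ^+ n * (1 - q)) <= n.+1%:R^-1 /\ rnorm (q * (1 - q) ^+ n) <= n.+1%:R^-1.
Proof.
move=> qp q1; have [j [js jq _ _]] := psd_sqrt qp.
have j1 : rnorm j <= 1.
  by rewrite -(@ler_pXn2r _ 2)// ?nnegrE ?rnorm_ge0// -urnorm_star js -expr2 jq expr1n.
have qE : q = rhorner j 'X^2 by rewrite rhornerXn rhornerX.
have q'E : 1 - q = rhorner j (1 - 'X^2).
  by rewrite rhornerD rhornerN -qE -[1 in RHS]polyC1 rhornerC rmorph1 scale1r.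
have t01 t : -1 <= t <= 1 -> 0 <= t ^+ 2 <= 1.
  by move=> t1; rewrite sqr_ge0/=; nra.
split; rewrite q'E {1}qE -rhornerXn -rhornerM; apply: rhorner_norm => // t /t01 t2;
    have /andP[t20 t21] := t2.
  rewrite hornerM horner_exp hornerXn horner_1subX2 ger0_norm; first exact: expr_mul_one_sub_le.
  by apply: mulr_ge0; [exact: exprn_ge0|rewrite subr_ge0].
rewrite hornerM hornerXn horner_exp horner_1subX2 ger0_norm; last first.
  by apply: mulr_ge0 => //; apply: exprn_ge0; rewrite subr_ge0.
rewrite mulrC; have := @expr_mul_one_sub_le (1 - t ^+ 2) n.
by rewrite subKr; apply; rewrite subr_ge0 t21 lerBlDr lerDl.
Qed.

(** If c is the sum of the b^* b and q = c / l is a contraction, then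
    e = 1 - (1 - q)^n does it: the square of the norm of b (1 - e) is at most
    l times the norm of q (1 - q)^(2n). *)
Lemma approximate_unit (s : seq A) (eps : R) : 0 < eps ->
  exists e, [/\ cstar e = e, rnorm e <= 1 &
    forall a, a \in s -> rnorm (a - cmul a e) < eps].
Proof.
move=> eps0; pose c := \sum_(b <- s) cstar (inj b) * inj b.
have sum_psd (r : seq A) : psd (\sum_(b <- r) cstar (inj b) * inj b).
  elim/big_ind: _ => [|x y|b _]; [exact: psd0|exact: psdD|exact: psd_star_mul].
have cp : psd c := sum_psd s.
pose l := rnorm c + 1; have l0 : 0 < l by rewrite ltr_wpDl ?rnorm_ge0.
pose q := l^-1 *:r c.
have qp : psd q by apply: psdZ => //; rewrite invr_ge0 ltW.
have cE : c = l *:r q by rewrite rscaleA mulfV ?gt_eqF// rscale1.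
have q1 : rnorm q <= 1.
  rewrite rnormZr gtr0_norm ?invr_gt0//.
  by rewrite ler_pdivrMl// mulr1 lerDl.
have [n nl] : exists n, l * n.+1%:R^-1 < eps ^+ 2.
  have : \forall n \near \oo, l / eps ^+ 2 < n%:R by exact: nbhs_infty_gtr.
  move=> /filter_ex[n]; rewrite ltr_pdivrMr ?exprn_gt0// => ln; exists n.
  rewrite ltr_pdivrMr ?ltr0n// mulrC (lt_le_trans ln)// ler_wpM2r ?sqr_ge0//.
  by rewrite ler_nat.
pose h := (1 - q) ^+ n; have qs := psd_star qp.
have hs : cstar h = h by rewrite ustarX cstarB ustar1 qs.
have h0 : uscal (1 - h) = 0.
  have q0 : uscal q = 0.
    rewrite /q linearZ /= /c raddf_sum big1 ?mulr0//= => b _.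
    exact: mulr0.
  have scal1B x : uscal (1 - x) = 1 - uscal x by [].
  have scalX x : uscal (x ^+ n) = uscal x ^+ n by exact: rmorphXn.
  by rewrite scal1B scalX scal1B q0 subr0 expr1n subrr.
have [j [js jq _ _]] := psd_sqrt qp.
have j1 : rnorm j <= 1.
  by rewrite -(@ler_pXn2r _ 2)// ?nnegrE ?rnorm_ge0// -urnorm_star js -expr2 jq expr1n.
have t01 t : -1 <= t <= 1 -> 0 <= 1 - t ^+ 2 <= 1.
  by move=> t1; have := sqr_ge0 t; nra.
pose P : {poly R} := (1 - 'X^2) ^+ n.
have qE : q = rhorner j 'X^2 by rewrite rhornerXn rhornerX.
have rhorner1 : rhorner j 1 = 1 by rewrite -polyC1 rhornerC rscale1.
have hE : h = rhorner j P by rewrite /h /P rhornerXn rhornerD rhornerN -qE rhorner1.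
(* the scalar part of 1 - h vanishes: this element comes from A *)
exists (1 - h).2; rewrite -[rnorm (1 - h).2]rnorm_inj -(uscal0_inj h0); split.
- by apply: inj_inj; rewrite inj_star -(uscal0_inj h0) cstarB ustar1 hs.
- rewrite hE -rhorner1 -rhornerN -rhornerD; apply: rhorner_norm => // t /t01/andP[t0 t1].
  rewrite hornerD hornerN -polyC1 hornerC /P horner_exp horner_1subX2 ger0_norm.
    by rewrite lerBlDr lerDl exprn_ge0.
  by rewrite subr_ge0 exprn_ile1.
- move=> a sa; rewrite -rnorm_inj raddfB /= injM -(uscal0_inj h0) mulrBr mulr1.
  rewrite opprB addrC subrK -(@ltr_pXn2r _ 2)// ?nnegrE ?rnorm_ge0// ?ltW//.
  rewrite -urnorm_star ustarM hs.
  have hn : rnorm h <= 1.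
    rewrite hE; apply: rhorner_norm => // t /t01/andP[t0 t1].
    by rewrite /P horner_exp horner_1subX2 ger0_norm ?exprn_ge0// exprn_ile1.
  apply: (@le_lt_trans _ _ (rnorm (h * c * h))).
    have -> : h * cstar (inj a) * (inj a * h) = cstar h * (cstar (inj a) * inj a) * h.
      by rewrite hs !mulrA.
    have -> : h * c * h = cstar h * c * h by rewrite hs.
    apply: psd_le_norm; first by apply: psd_star_conj; exact: psd_star_mul.
    rewrite -mulrBl -mulrBr; apply: psd_star_conj.
    rewrite /c (big_rem a)//= addrAC subrr add0r; exact: sum_psd.
  apply: le_lt_trans nl; rewrite cE -scalerAr -scalerAl rnormZr gtr0_norm//.
  rewrite ler_pM2l// (le_trans (urnormM _ _))//.
  have -> : h * q = q * h by rewrite qE hE rhorner_comm.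
  have [_ qh] := psd_expr_small n qp q1.
  by rewrite (le_trans _ qh)// ler_piMr ?rnorm_ge0.
Qed.

End Consequences.

(** * Contractivity of TRO homomorphisms *)

Section AutomaticContractivity.
Context {R : realType}.
Local Notation "t *:r x" := ((t%:C%C : R[i]) *: x) (at level 40).

Lemma neumann (D : cstarAlgType R) (p x : D) : rnorm p < 1 ->
  exists y, y = x + cmul p y.
Proof.
move=> p1; pose u := fix u n : D := if n is n'.+1 then x + cmul p (u n') else 0.
pose Y := series (geometric (rnorm x) (rnorm p)).
have [||l [ul _]] := @majorant_cvg _ D u Y (limn Y).
- move=> n; have -> : Y n.+1 - Y n = rnorm x * rnorm p ^+ n.
    by rewrite /Y !seriesEnat /= big_nat_recr //= addrAC subrr add0r.
  elim: n => [|n IH]; first by rewrite /= cmul0r addr0 subr0 expr0 mulr1.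
  rewrite /= opprD addrACA subrr add0r -cmulNr -cmulDr.
  rewrite (le_trans (rnormM _ _))// exprS mulrCA ler_wpM2l ?rnorm_ge0//.
- apply: is_cvg_geometric_series; rewrite ger0_norm ?rnorm_ge0//.
exists l; have ulS : u n.+1 @[n --> \oo] --> l by rewrite (cvg_shiftS u).
apply: (cvg_eq ulS) => [|n]; last by [].
apply: cvgD; first exact: cvg_cst.
by apply: cvg_cmul => //; exact: cvg_cst.
Qed.

Lemma sa_norm_exp2n (B : cstarAlgType R) (u : unitization B) n : cstar u = u ->
  rnorm (u ^+ (2 ^ n)) = rnorm u ^+ (2 ^ n).
Proof.
move=> us; elim: n => [|n IH]; first by rewrite !expr1.
by rewrite expnS mulnC !exprM -IH -urnorm_star ustarX us expr2.
Qed.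

(** In other words 1 belongs to the spectrum of q = u u^* when u has norm 1.
    Otherwise q^(m+1) = q^m (1 - q) v u^* would tend to 0, whereas q^(2^n)
    has norm 1 for all n. *)
Lemma one_sub_not_invertible (B : cstarAlgType R) (u v : unitization B) :
  rnorm u = 1 -> u = (1 - u * cstar u) * v -> False.
Proof.
move=> u1 uv; set q := u * cstar u in uv.
have qp : psd q by have := psd_star_mul (cstar u); rewrite cstarK.
have q1 : rnorm q = 1.
  by have := urnorm_star (cstar u); rewrite cstarK rnormS u1 expr1n.
have E m : q ^+ m.+1 = q ^+ m * (1 - q) * (v * cstar u).
  by rewrite exprSr -!mulrA; congr (_ * _); rewrite mulrA -uv.
have H n : 1 <= n.+1%:R^-1 * rnorm (v * cstar u).
  have : rnorm (q ^+ (2 ^ n)) = 1 by rewrite sa_norm_exp2n ?q1 ?expr1n ?(psd_star qp).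
  have n2 : (2 ^ n = (2 ^ n).-1.+1)%N by rewrite prednK// expn_gt0.
  rewrite n2 E => {1}<-.
  have q1le : rnorm q <= 1 by rewrite q1.
  have [h _] := psd_expr_small (2 ^ n).-1 qp q1le.
  rewrite (le_trans (urnormM _ _))// ler_wpM2r ?rnorm_ge0// (le_trans h)//.
  rewrite lef_pV2 ?posrE ?ltr0n// ler_nat ltnS -ltnS prednK ?expn_gt0//.
  exact: ltn_expl.
have : \forall n \near \oo, rnorm (v * cstar u) < n%:R by exact: nbhs_infty_gtr.
move=> /filter_ex[n vn]; have := H n.
rewrite ler_pdivlMl ?ltr0n// mulr1 leNgt => /negP; apply.
by rewrite (lt_trans vn)// ltr_nat.
Qed.

(** If the norm of x is smaller than that of its image,
    scale so that the image u has norm 1; then x = (1 - x x^* ) y is solvable by a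
    Neumann series, and applying Phi yields u = (1 - u u^* ) Phi y, which is
    impossible. *)
Lemma tro_hom_contractive (D B : cstarAlgType R) (Phi : {linear D -> B}) :
  is_tro_hom Phi -> forall x, rnorm (Phi x) <= rnorm x.
Proof.
move=> PhiM x; rewrite leNgt; apply/negP => xP.
have P0 : 0 < rnorm (Phi x) := le_lt_trans (rnorm_ge0 x) xP.
pose x' := (rnorm (Phi x))^-1 *:r x.
have x'1 : rnorm x' < 1.
  by rewrite rnormZr gtr0_norm ?invr_gt0// ltr_pdivrMl// mulr1.
have [|y yE] := @neumann D (cmul x' (cstar x')) x'.
  by rewrite (le_lt_trans (rnormM _ _))// rnormS mulr_ilt1 ?rnorm_ge0//.
apply: (@one_sub_not_invertible _ (inj (Phi x')) (inj (Phi y))).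
  by rewrite rnorm_inj linearZ /= rnormZr gtr0_norm ?invr_gt0// mulVf ?gt_eqF.
rewrite mulrBl mul1r -inj_star -!injM -PhiM -raddfB -raddfB /= {1}yE.
by rewrite addrK.
Qed.

End AutomaticContractivity.

(** * Square roots in C_0((0,1]) *)

Section ConeSqrt.
Context {R : realType}.
Local Notation "t *:r x" := ((t%:C%C : R[i]) *: x) (at level 40).

Lemma cvg_rnorm (V : normedModType R[i]) {T : Type} {F : set_system T} {FF : Filter F}
    (f : T -> V) (l : V) : f @ F --> l -> rnorm (f t) @[t --> F] --> rnorm l.
Proof.
move=> /cvg_rnormP fl; apply/cvgrPdist_lt => e e0.
apply: filterS (fl _ e0) => t; apply: le_lt_trans.
rewrite ler_norml ler_rnormB andbT lerNl opprB.
by rewrite (le_trans (ler_rnormB _ _))// rnormB.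
Qed.

Lemma cvg_real_complex {T : Type} {F : set_system T} {FF : Filter F}
    (f : T -> R) (l : R) : f @ F --> l -> ((f t)%:C%C : R[i]) @[t --> F] --> (l%:C%C : R[i]).
Proof.
move=> /cvgrPdist_lt fl; apply/cvg_rnormP => e e0.
by apply: filterS (fl _ e0) => t; rewrite -rmorphB rnormRC.
Qed.

Lemma conj_mul_rnorm (z : R[i]) : Num.conj z * z = ((rnorm z) ^+ 2)%:C%C.
Proof. by rewrite mulrC -normCK rnormE -rmorphXn. Qed.

Section Sqrt.
Variables (f g : C0 R) (M : R).
Let k t : R := Num.sqrt (M ^+ 2 * rnorm (cone_fun g t) ^+ 2 - rnorm (cone_fun f t) ^+ 2).

Let k_cvg (F : set_system R) (FF : Filter F) (l m : R[i]) :
  cone_fun f t @[t --> F] --> l -> cone_fun g t @[t --> F] --> m ->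
  ((k t)%:C%C : R[i]) @[t --> F] -->
  ((Num.sqrt (M ^+ 2 * rnorm m ^+ 2 - rnorm l ^+ 2))%:C%C : R[i]).
Proof.
move=> fl gm; apply: cvg_real_complex.
apply: (@continuous_cvg _ R^o R^o F _ (fun t : R => M ^+ 2 * rnorm (cone_fun g t) ^+ 2 -
  rnorm (cone_fun f t) ^+ 2) (@Num.sqrt R)); first exact: sqrt_continuous.
have sqr_cvg (h : C0 R) (y : R[i]) : cone_fun h t @[t --> F] --> y ->
    rnorm (cone_fun h t) ^+ 2 @[t --> F] --> rnorm y ^+ 2.
  by move=> hy; rewrite expr2; apply: cvgM; exact: cvg_rnorm.
apply: (@cvgB R R^o); last exact: sqr_cvg.
by apply: cvgM; [exact: cvg_cst|exact: sqr_cvg].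
Qed.

Lemma cone_sqrt_subproof : (fun t => (k t)%:C%C : R[i]) \in @cone_pred R R[i].
Proof.
apply/coneP; split.
- apply/subspace_continuousP => x x01.
  by apply: k_cvg; exact: cone_cvg.
- have -> : (0 : R[i]) = (Num.sqrt (M ^+ 2 * rnorm (0 : R[i]) ^+ 2 - rnorm (0 : R[i]) ^+ 2))%:C%C.
    by rewrite rnorm0 expr0n/= mulr0 subr0 sqrtr0.
  by apply: k_cvg; exact: cone_cvg0.
- by move=> t t01; rewrite /k !cone_out// rnorm0 expr0n/= mulr0 subr0 sqrtr0.
Qed.

Definition cone_sqrt : C0 R := Cone cone_sqrt_subproof.

Lemma cone_sqrtE : (forall t, rnorm (cone_fun f t) <= M * rnorm (cone_fun g t)) ->
  cmul (cstar f) f + cmul (cstar cone_sqrt) cone_sqrt =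
  M ^+ 2 *:r cmul (cstar g) g.
Proof.
move=> fg; apply/val_inj/funext => t.
have -> : val (cmul (cstar f) f + cmul (cstar cone_sqrt) cone_sqrt) t =
  Num.conj (cone_fun f t) * cone_fun f t + Num.conj (k t)%:C%C * (k t)%:C%C by [].
have -> : val (M ^+ 2 *:r cmul (cstar g) g) t =
  (M ^+ 2)%:C%C * (Num.conj (cone_fun g t) * cone_fun g t) by [].
rewrite !conj_mul_rnorm rnormRC real_normK ?num_real// sqr_sqrtr.
  by rewrite -rmorphM -rmorphD/= addrC subrK.
rewrite subr_ge0 -exprMn lerXn2r ?nnegrE ?rnorm_ge0//.
exact: le_trans (rnorm_ge0 _) (fg t).
Qed.

End Sqrt.
End ConeSqrt.

(** * Spectral localization *)

Section SpectralGap.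
Context {R : realType} {A : cstarAlgType R}.
Local Notation "t *:r x" := ((t%:C%C : R[i]) *: x) (at level 40).

Lemma injD (a b : A) : inj (a + b) = inj a + inj b.
Proof. exact: raddfD. Qed.

Lemma injZ (k : R[i]) (a : A) : inj (k *: a) = k *: inj a.
Proof. exact: linearZ. Qed.

Lemma psd_uscal (p : unitization A) : psd p -> 0 <= uscal p.
Proof.
move=> /psd_sqrt[j [js <- _ _]].
have -> : uscal (j ^+ 2) = uscal j ^+ 2 by exact: rmorphXn.
rewrite expr2 -{1}js uscal_star mulrC -normCK.
by rewrite exprn_ge0.
Qed.

(** With x = b^* b - mu ^ 2 and j = |x|, the element m = j + x is twice the positive
    part of x.  It satisfies x m = j m, and it is nonzero because mu is smaller
    than the norm of b.  Its scalar part vanishes since x has scalar part - mu ^ 2,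
    so m comes from A.  Thus b is bounded below by mu on the range of m. *)
Lemma spectral_gap (b : A) (mu : R) : 0 <= mu < rnorm b ->
  exists m r : A, m != 0 /\ mu ^+ 2 *:r cmul (cstar m) m + cmul (cstar r) r =
    cmul (cstar (cmul b m)) (cmul b m).
Proof.
move=> /andP[mu0 mub]; pose c := cstar (inj b) * inj b.
have cs : cstar c = c by rewrite ustarM cstarK.
pose x := c - mu ^+ 2 *:r 1.
have xs : cstar x = x by rewrite cstarB cs cstarZr ustar1.
have [j [js j2 jb jp]] := psd_sqrt (psd_sqr xs).
have [r [rs r2 rb _]] := psd_sqrt jp.
have jx : j * x = x * j by apply: jb; rewrite expr2 mulrA.
have ux : uscal x = - (mu ^+ 2)%:C%C.
  by rewrite /uscal /= mulr0 sub0r; congr (- _); exact: mulr1.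
have uj : uscal j = (mu ^+ 2)%:C%C.
  have mu2 : 0 <= (mu ^+ 2)%:C%C :> R[i] by rewrite ler0c sqr_ge0.
  apply/eqP; rewrite -(@eqrXn2 _ 2)//; last exact: psd_uscal.
  have -> : uscal j ^+ 2 = uscal (j ^+ 2) by apply/esym; exact: rmorphXn.
  have -> : uscal (j ^+ 2) = (uscal x) ^+ 2 by rewrite j2; exact: rmorphXn.
  by rewrite ux sqrrN.
pose m := j + x.
have um : uscal m = 0.
  have -> : uscal m = uscal j + uscal x by [].
  by rewrite uj ux subrr.
have ms : cstar m = m by rewrite cstarD js xs.
have mE := uscal0_inj um.
exists m.2, (uact r m.2); split.
  apply/eqP => m20; have m0 : m = 0 by rewrite mE m20 linear0.
  have : psd (mu ^+ 2 *:r 1 - c).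
    have -> : mu ^+ 2 *:r 1 - c = j; last by [].
    by rewrite -opprB -/x; apply/eqP; rewrite eq_sym -addr_eq0 -/m m0.
  move=> /(psd_norm_le (sqr_ge0 mu) (psd_star_mul _)).
  rewrite urnorm_star rnorm_inj leNgt ltrXn2r ?nnegrE ?rnorm_ge0//.
apply: inj_inj; rewrite injD injZ !injM !inj_star inj_uact injM -mE.
rewrite !ustarM rs ms.
have -> : m * r * (r * m) = m * (j * m) by rewrite -r2 expr2 !mulrA.
have -> : m * cstar (inj b) * (inj b * m) = m * (c * m) by rewrite /c !mulrA.
rewrite scalerAr -mulrDr; congr (_ * _).
have -> : j * m = x * m.
  by rewrite /m [j * _]mulrDr [x * (_ + _)]mulrDr -!expr2 j2 jx addrC.
by rewrite /x mulrBl -scalerAl mul1r addrC subrK.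
Qed.

End SpectralGap.

(** * The norm of a C*-tensor product with C_0((0,1]) *)

Section TensorNorm.
Context {R : realType} {A D : cstarAlgType R}.
Variable ten : {bilinear C0 R -> A -> D}.
Hypothesis tenP : is_cstar_tensor ten.
Local Notation "t *:r x" := ((t%:C%C : R[i]) *: x) (at level 40).
Implicit Types (f g : C0 R) (a b m : A) (s : seq (C0 R * A)).

Let ten_star_mul f a :
  cmul (cstar (ten f a)) (ten f a) = ten (cmul (cstar f) f) (cmul (cstar a) a).
Proof. by rewrite (tensor_star tenP) (tensor_mul tenP). Qed.

Let star_mulZr (B : cstarAlgType R) (t : R) (x : B) :
  cmul (cstar (t *:r x)) (t *:r x) = t ^+ 2 *:r cmul (cstar x) x.
Proof. by rewrite cstarZ conjRC cmulZl cmulZr scalerA -rmorphM -expr2. Qed.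

(** If s is the root of |a|^2 - a^* a, then the squares z^* z of z = f (x) a m and of
    z = f (x) s m add up to that of |a| (f (x) m). *)
Lemma tensor_norm_mulr f a m :
  rnorm (ten f (cmul a m)) <= rnorm a * rnorm (ten f m).
Proof.
have [|s [ss s2]] := @star_mul_complement _ _ (inj a) (rnorm a).
  by rewrite rnorm_inj.
have -> : rnorm a * rnorm (ten f m) = rnorm (rnorm a *:r ten f m).
  by rewrite rnormZr ger0_norm// rnorm_ge0.
apply: (@star_sum_le_norm _ _ _ (ten f (uact s m))).
rewrite star_mulZr !ten_star_mul -linearZr_LR -linearDr /=; congr (ten _ _).
apply: inj_inj; rewrite injD injZ !injM !inj_star !injM inj_uact !ustarM ss.
have -> : cstar (inj m) * s * (s * inj m) = cstar (inj m) * (s ^+ 2 * inj m).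
  by rewrite expr2 !mulrA.
rewrite s2 mulrBl -scalerAl mul1r mulrBr -scalerAr addrC -!mulrA subrK.
by [].
Qed.

(** Same idea in the first factor, where the complement is a square root in
    C_0((0,1]). *)
Lemma tensor_norm_monotone f g m (M : R) : 0 <= M ->
  (forall t, rnorm (cone_fun f t) <= M * rnorm (cone_fun g t)) ->
  rnorm (ten f m) <= M * rnorm (ten g m).
Proof.
move=> M0 fg.
have -> : M * rnorm (ten g m) = rnorm (M *:r ten g m).
  by rewrite rnormZr ger0_norm.
apply: (@star_sum_le_norm _ _ _ (ten (cone_sqrt f g M) m)).
rewrite star_mulZr !ten_star_mul -linearZl_LR -linearDl /=; congr (ten _ _).
exact: cone_sqrtE.
Qed.

(** For self-adjoint c and b, the square of the norm r of c (x) b is the norm of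
    c c (x) b b, which by the two previous estimates is at most |c| |b| r. *)
Lemma tensor_norm_le f a : rnorm (ten f a) <= rnorm f * rnorm a.
Proof.
pose c := cmul (cstar f) f; pose b := cmul (cstar a) a.
have cs : cstar c = c by rewrite cstarM cstarK.
have bs : cstar b = b by rewrite cstarM cstarK.
have xx : rnorm (ten c b) ^+ 2 <= rnorm c * rnorm b * rnorm (ten c b).
  rewrite -rnorm_star ten_star_mul cs bs.
  rewrite (le_trans (tensor_norm_mulr _ _ _))// [rnorm c * _]mulrC -mulrA ler_wpM2l ?rnorm_ge0//.
  apply: tensor_norm_monotone; first exact: rnorm_ge0.
  move=> t; rewrite (le_trans (rnormM _ _))// ler_wpM2r ?rnorm_ge0//.
  exact: rnorm_eval.
have xb : rnorm (ten c b) <= rnorm c * rnorm b.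
  have [x0|x0] := eqVneq (rnorm (ten c b)) 0.
    by rewrite x0 mulr_ge0 ?rnorm_ge0.
  have x1 : 0 < rnorm (ten c b) by rewrite lt_neqAle eq_sym x0 rnorm_ge0.
  by rewrite -(ler_pM2r x1) -expr2.
rewrite -(@ler_pXn2r _ 2)// ?nnegrE ?mulr_ge0 ?rnorm_ge0//.
by rewrite -rnorm_star ten_star_mul (le_trans xb)// !rnorm_star exprMn.
Qed.

Lemma tensor_nonzero g a t : cone_fun g t != 0 -> a != 0 -> 0 < rnorm (ten g a).
Proof.
move=> gt a0; rewrite lt_neqAle rnorm_ge0 andbT eq_sym; apply/eqP => /rnorm0_eq0 ga0.
have := @tensor_faithful _ _ _ _ _ tenP [:: (g, a)].
rewrite big_seq1 => /(_ ga0 (cone A) (@cone_tensor_fun R A)); rewrite big_seq1 /=.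
move=> /(congr1 (fun h : cone A => cone_fun h t)) /= /eqP.
by rewrite scaler_eq0 (negbTE gt) (negbTE a0).
Qed.

Definition cone_comb s t : A := \sum_(p <- s) cone_fun p.1 t *: p.2.

(** A tent function around t0, so narrow that the finitely many functions in s are
    almost constant on its support. *)
Lemma cone_bump s t0 (delta : R) : t0 \in `]0, 1] -> 0 < delta ->
  exists g, cone_fun g t0 != 0 /\ forall p t, p \in s -> cone_fun g t != 0 ->
    rnorm (cone_fun p.1 t - cone_fun p.1 t0) <= delta.
Proof.
move=> t01 delta0.
have [r r0 rP] : exists2 r : R, 0 < r & forall p t, p \in s -> t \in `]0, 1] ->
    `|t - t0| < r -> rnorm (cone_fun p.1 t - cone_fun p.1 t0) <= delta.
  elim: s => [|q s [r r0 IH]]; first by exists 1.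
  have /cvg_rnormP/(_ _ delta0) := @cone_cvg _ _ q.1 _ t01.
  rewrite near_withinE => /nbhs_ballP[d /= d0 dP].
  exists (Num.min r d); first by rewrite lt_min r0.
  move=> p t; rewrite inE lt_min => /predU1P[->|ps] t1 /andP[tr td]; last exact: IH.
  by rewrite rnormB ltW// dP//= /ball/= distrC.
have t0_gt0 : 0 < t0 by move: t01; rewrite in_itv/= => /andP[].
pose d := Num.min r t0; have d0 : 0 < d by rewrite lt_min r0.
pose phi (t : R) : R := Num.max 0 (d - `|t - t0|).
have phic : continuous phi.
  move=> t; apply: (@continuous_max _ _ (fun=> 0) (fun t => d - `|t - t0|)).
    exact: cvg_cst.
  apply: (@cvgB R R^o); first exact: cvg_cst.
  apply: (@cvg_norm R R^o); apply: (@cvgB R R^o); [exact: cvg_id|exact: cvg_cst].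
have phi0 : phi 0 = 0.
  by rewrite /phi sub0r normrN gtr0_norm// max_l// subr_le0 ge_min lexx orbT.
exists (Cone (cone_real_subproof phic phi0)); split.
  rewrite /= t01 /phi subrr normr0 subr0 max_r ?ltW//.
  by apply/eqP => /complexI; apply/eqP; rewrite gt_eqF.
move=> p t ps /=; case: ifPn => [t1|_]; last by rewrite eqxx.
have [dt|dt] := leP d `|t - t0|.
  by rewrite /phi max_l ?subr_le0// eqxx.
by move=> _; apply: rP => //; move: dt; rewrite lt_min => /andP[].
Qed.

(** The norm of D dominates the supremum norm.  Suppose that the value b at t of a
    sum X of elementary tensors is larger than the norm of X.  Localize near t with
    a bump g and in A with an element m on which b is bounded below by mu: then
    X (g (x) m) is close to g (x) b m, whose norm is at least mu times that of
    g (x) m, and mu exceeds the norm of X.  Faithfulness of D on the algebraic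
    tensor product ensures that g (x) m is nonzero. *)
Lemma cone_comb_norm_le s t : t \in `]0, 1] ->
  rnorm (cone_comb s t) <= rnorm (\sum_(p <- s) ten p.1 p.2).
Proof.
move=> t01; set X := \sum_(p <- s) _; set b := cone_comb s t.
rewrite leNgt; apply/negP => Xb.
(* mu lies strictly between the two norms, and delta keeps the error made by
   freezing the coefficients at t below mu minus the norm of X *)
pose mu := (rnorm X + rnorm b) / 2.
have X0 := rnorm_ge0 X.
have [|m [r [m0 mr]]] := @spectral_gap _ _ b mu.
  by rewrite /mu; apply/andP; split; lra.
pose K := \sum_(p <- s) rnorm p.2.
have K0 : 0 <= K by apply: sumr_ge0 => p _; exact: rnorm_ge0.
pose delta := (mu - rnorm X) / (2 * (K + 1)).
have muX : 0 < mu - rnorm X by rewrite /mu; lra.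
have delta0 : 0 < delta by rewrite divr_gt0// mulr_gt0// ltr_wpDl.
have [g [gt gP]] := @cone_bump s t delta t01 delta0.
have G0 := tensor_nonzero gt m0; set G := rnorm (ten g m) in G0.
have low : mu * G <= rnorm (ten g (cmul b m)).
  have mu0 : 0 <= mu by rewrite /mu; lra.
  have -> : mu * G = rnorm (mu *:r ten g m) by rewrite rnormZr ger0_norm.
  apply: (@star_sum_le_norm _ _ _ (ten g r)).
  by rewrite star_mulZr !ten_star_mul -linearZr_LR -linearDr /= mr.
pose h (p : C0 R * A) : C0 R := cmul p.1 g - cone_fun p.1 t *: g.
have XE : cmul X (ten g m) = ten g (cmul b m) + \sum_(p <- s) ten (h p) (cmul p.2 m).
  have -> : cmul X (ten g m) = \sum_(p <- s) ten (cmul p.1 g) (cmul p.2 m).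
    rewrite /X; elim: s {X b Xb mu X0 mr K K0 delta muX delta0 gP low} => [|p s IH].
      by rewrite !big_nil cmul0l.
    by rewrite !big_cons cmulDl IH (tensor_mul tenP).
  have -> : ten g (cmul b m) = \sum_(p <- s) ten (cone_fun p.1 t *: g) (cmul p.2 m).
    rewrite /b /cone_comb; elim: (s) => [|p s' IH].
      by rewrite !big_nil cmul0l linear0r.
    by rewrite !big_cons cmulDl linearDr IH cmulZl linearZr_LR linearZl_LR.
  rewrite -big_split /=; apply: eq_bigr => p _.
  by rewrite -linearDl /= /h addrC subrK.
have hle : rnorm (\sum_(p <- s) ten (h p) (cmul p.2 m)) <= delta * K * G.
  rewrite (le_trans (rnorm_sum _ _))// /K mulr_sumr mulr_suml.
  rewrite big_seq [leRHS]big_seq; apply: ler_sum => p ps.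
  rewrite (le_trans (tensor_norm_mulr _ _ _))// [delta * _]mulrC -mulrA.
  rewrite ler_wpM2l ?rnorm_ge0//; apply: tensor_norm_monotone; first exact: ltW.
  move=> u; have -> : cone_fun (h p) u =
      (cone_fun p.1 u - cone_fun p.1 t) * cone_fun g u by rewrite mulrBl.
  rewrite rnormMc; have [->|gu] := eqVneq (cone_fun g u) 0.
    by rewrite rnorm0 !mulr0.
  by rewrite ler_wpM2r ?rnorm_ge0// gP.
have up : rnorm (ten g (cmul b m)) <= rnorm X * G + delta * K * G.
  have -> : ten g (cmul b m) = cmul X (ten g m) - \sum_(p <- s) ten (h p) (cmul p.2 m).
    by rewrite XE addrK.
  by rewrite (le_trans (ler_rnormD _ _))// rnormN lerD// rnormM.
have : mu <= rnorm X + delta * K.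
  by rewrite -(ler_pM2r G0) mulrDl (le_trans low).
have dK : delta * (2 * (K + 1)) = mu - rnorm X by rewrite divfK// gt_eqF// mulr_gt0// ltr_wpDl.
nra.
Qed.

End TensorNorm.

(** * Identities for completely orthogonality preserving maps *)

Section OrthogonalityIdentities.
Context {R : realType} {A B : cstarAlgType R}.
Variable T : {linear A -> B}.
Hypothesis Tcop : completely_orthogonality_preserving T.

(** The rows (a x, - a) and (b, b x^* ) have zero product.  Placed in different rows
    of 2 x 2 matrices X and Y, they also give Y^* X = 0, whatever a, b and x are,
    so that X and Y are orthogonal. *)
Lemma cop_move_right (a b x : A) :
  cmul (T (cmul a x)) (cstar (T b)) = cmul (T a) (cstar (T (cmul b (cstar x)))).
Proof.
pose X : 'M[A]_2 := \matrix_(i, j) if i == ord0 then (if j == ord0 then cmul a x else - a) else 0.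
pose Y : 'M[A]_2 := \matrix_(i, j)
  if i == ord0 then 0 else (if j == ord0 then b else cmul b (cstar x)).
have [|TXY _] := Tcop (x := X) (y := Y).
  split; apply/matrixP => i j; rewrite !mxE big_ord_recl big_ord1 !mxE /=.
    case: ifPn => i0; last by rewrite !cmul0l addr0.
    case: ifPn => j0; first by rewrite !cstar0 !cmul0r addr0.
    by rewrite cstarM cstarK cmulNl !cmulA subrr.
  by rewrite cstar0 cmul0l cmul0r addr0.
have := congr1 (fun M : 'M[B]_2 => M ord0 (lift ord0 ord0)) TXY.
rewrite !mxE big_ord_recl big_ord1 !mxE /= linearN cmulNl => /eqP.
by rewrite subr_eq0 => /eqP.
Qed.

Lemma cop_move_left (a b x : A) :
  cmul (cstar (T (cmul x a))) (T b) = cmul (cstar (T a)) (T (cmul (cstar x) b)).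
Proof.
pose X : 'M[A]_2 := \matrix_(i, j)
  if j == ord0 then 0 else (if i == ord0 then b else - cmul (cstar x) b).
pose Y : 'M[A]_2 := \matrix_(i, j) if j == ord0 then (if i == ord0 then cmul x a else a) else 0.
have [|_ TXY] := Tcop (x := X) (y := Y).
  split; apply/matrixP => i j; rewrite !mxE big_ord_recl big_ord1 !mxE /=.
    by rewrite cstar0 cmul0l cmul0r addr0.
  case: ifPn => i0; last by rewrite cstar0 !cmul0l addr0.
  case: ifPn => j0; first by rewrite !cmul0r addr0.
  by rewrite cstarM cmulNr !cmulA subrr.
have := congr1 (fun M : 'M[B]_2 => M ord0 (lift ord0 ord0)) TXY.
rewrite !mxE big_ord_recl big_ord1 !mxE /= linearN cmulNr => /eqP.
by rewrite subr_eq0 => /eqP.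
Qed.

End OrthogonalityIdentities.

(** * Limits along approximate units *)

Section ApproximateUnitFilter.
Context {R : realType} (A : cstarAlgType R).

(** A need not be separable, so there may be no approximate unit indexed by the
    integers: limits are taken along the filter of all self-adjoint contractions
    that are almost units on finite sets. *)
Definition au_filter : set_system A := fun S => exists (s : seq A) (eps : R),
  0 < eps /\ forall e, cstar e = e -> rnorm e <= 1 ->
    (forall a, a \in s -> rnorm (a - cmul a e) < eps) -> S e.

Global Instance au_filter_proper : ProperFilter au_filter.
Proof.
split.
  move=> [s [eps [eps0 H]]]; have [e [es e1 se]] := approximate_unit s eps0.
  exact: (H e es e1 se).
split.
- by exists [::], 1; split.
- move=> P Q [s [eps [eps0 HP]]] [r [eta [eta0 HQ]]].
  exists (s ++ r), (Num.min eps eta); split; first by rewrite lt_min eps0.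
  move=> e es e1 H; split; [apply: HP|apply: HQ] => // a ain.
    by have := H a; rewrite mem_cat ain lt_min => /(_ isT)/andP[].
  by have := H a; rewrite mem_cat ain orbT lt_min => /(_ isT)/andP[].
- by move=> P Q PQ [s [eps [eps0 HP]]]; exists s, eps; split => // e *; exact/PQ/HP.
Qed.

Lemma au_near : \forall e \near au_filter, cstar e = e /\ rnorm e <= 1.
Proof. by exists [::], 1; split. Qed.

Lemma au_cvgr (a : A) : cmul a e @[e --> au_filter] --> a.
Proof.
apply/cvg_rnormP => eps eps0; exists [:: a], eps; split => // e _ _; apply.
by rewrite inE.
Qed.

Lemma au_cvgl (a : A) : cmul e a @[e --> au_filter] --> a.
Proof.
apply/cvg_rnormP => eps eps0; exists [:: cstar a], eps; split => // e es _.
move=> /(_ (cstar a)); rewrite inE eqxx => /(_ isT).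
by rewrite -{1}es -cstarM -cstarN -cstarD rnormS.
Qed.

End ApproximateUnitFilter.

(** Stated for additive rather than linear maps since it is also applied to
    maps that are conjugate linear. *)
Lemma additive_dense_eq0 (R : realType) (E V : normedModType R[i]) (F : E -> V)
    (C : R) (S : set E) :
  (forall x y, F (x - y) = F x - F y) -> (forall x, rnorm (F x) <= C * rnorm x) ->
  (forall x eps, 0 < eps -> exists y, S y /\ rnorm (x - y) < eps) ->
  (forall x, S x -> F x = 0) -> forall x, F x = 0.
Proof.
move=> FB FC dS F0 x; apply: rnorm0_eq0; apply/le_anti; rewrite rnorm_ge0 andbT.
have C0 : 0 < `|C| + 1 by rewrite ltr_wpDl.
apply/ler_addgt0Pl => eps eps0; rewrite addr0.
have [y [Sy xy]] := dS x (eps / (`|C| + 1)) (divr_gt0 eps0 C0).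
rewrite -[F x]subr0 -(F0 _ Sy) -FB (le_trans (FC _))//.
apply: (@le_trans _ _ ((`|C| + 1) * rnorm (x - y))).
  by rewrite ler_wpM2r ?rnorm_ge0// (le_trans (ler_norm _))// lerDl.
by rewrite mulrC -ler_pdivlMr// ltW.
Qed.

Lemma triple_product_dense (R : realType) (A : cstarAlgType R) (a : A) (eps : R) :
  0 < eps -> exists y, (exists e, y = cmul (cmul a (cstar e)) e) /\ rnorm (a - y) < eps.
Proof.
move=> eps0; have [|e [es e1 ae]] := @approximate_unit _ _ [:: a] (eps / 2).
  by rewrite divr_gt0.
exists (cmul (cmul a (cstar e)) e); split; first by exists e.
have {}ae : rnorm (a - cmul a e) < eps / 2 by apply: ae; rewrite inE.
rewrite es -(subrK (cmul a e) a) -addrA (le_lt_trans (ler_rnormD _ _))//.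
rewrite subrK -cmulNl -cmulDl [ltRHS]splitr ltr_leD//.
rewrite (le_trans (rnormM _ _))// (le_trans _ (ltW ae))//.
by rewrite ler_piMr ?rnorm_ge0.
Qed.

Lemma additive_triple_eq0 (R : realType) (A : cstarAlgType R) (V : normedModType R[i])
    (F : A -> V) (C : R) :
  (forall x y, F (x - y) = F x - F y) -> (forall x, rnorm (F x) <= C * rnorm x) ->
  (forall a b c, F (cmul (cmul a (cstar b)) c) = 0) -> forall x, F x = 0.
Proof.
move=> FB FC F0 x.
apply: (additive_dense_eq0 FB FC (S := [set y | exists a b c, y = cmul (cmul a (cstar b)) c])).
  move=> a eps eps0; have [y [[e ye] ay]] := triple_product_dense a eps0.
  by exists y; split => //; exists a, e, e.
by move=> _ [a [b [c ->]]].
Qed.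

Lemma cvg_ext (S : Type) (V : topologicalType) (F : set_system S) (f g : S -> V) (l : V) :
  f =1 g -> f @ F --> l -> g @ F --> l.
Proof. by move=> /funext ->. Qed.

Lemma cvg_rnorm_le (R : realType) (V : normedModType R[i]) (T : Type)
    (F : set_system T) {FF : ProperFilter F} (f : T -> V) (l : V) (M : R) :
  f @ F --> l -> (\forall t \near F, rnorm (f t) <= M) -> rnorm l <= M.
Proof.
move=> /cvg_rnormP fl fM; apply/ler_addgt0Pl => e e0.
have [t [fle fMt]] := filter_ex (filterI (fl _ e0) fM).
rewrite -(subrK (f t) l) (le_trans (ler_rnormD _ _))//.
by rewrite lerD// ltW.
Qed.

Lemma cvg_rnorm0 (R : realType) (V : normedModType R[i]) (T : Type)
    (F : set_system T) {FF : Filter F} (f : T -> V) (g : T -> R) :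
  g @ F --> 0 -> (\forall t \near F, rnorm (f t) <= g t) -> f @ F --> 0.
Proof.
move=> /cvgrPdist_lt g0 fg; apply/cvg_rnormP => e e0.
apply: filterS2 (g0 _ e0) fg => t; rewrite !sub0r normrN rnormN => h1 h2.
exact: le_lt_trans h2 (le_lt_trans (ler_norm _) h1).
Qed.

(** * Images of the odd powers of w *)

(** Under the homomorphism Phi to be constructed, T(a) is the image of w (x) a and
    T(e)^* T(e) that of w^2 (x) e^* e.  The image of w^(2k+1) (x) a must therefore
    be the limit of T(a) (T(e)^* T(e))^k along approximate units e.  All values are
    taken in the unitization of B. *)

Section WeightPowers.
Context {R : realType} {A B : cstarAlgType R}.
Variable T : {linear A -> B}.
Hypothesis Tnorm : forall a, rnorm (T a) <= rnorm a.
Hypothesis Tcop : completely_orthogonality_preserving T.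
Local Notation U := (unitization B).
Local Notation EE := (@au_filter R A).
Local Notation "t *:r x" := ((t%:C%C : R[i]) *: x) (at level 40).
Implicit Types (a b c e y z : A) (k i j n : nat).

Definition img a : U := inj (T a).
Definition weight e : U := cstar (img e) * img e.

Lemma imgB a b : img (a - b) = img a - img b.
Proof. by rewrite /img !raddfB. Qed.

Lemma imgD a b : img (a + b) = img a + img b.
Proof. by rewrite /img !raddfD. Qed.

Lemma imgZ (k : R[i]) a : img (k *: a) = k *: img a.
Proof. by rewrite /img linearZ injZ. Qed.

Lemma img_norm a : rnorm (img a) <= rnorm a.
Proof. by rewrite rnorm_inj. Qed.

Lemma img_move_right a b x :
  img (cmul a x) * cstar (img b) = img a * cstar (img (cmul b (cstar x))).
Proof. by rewrite /img -!inj_star -!injM (cop_move_right Tcop). Qed.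

Lemma img_move_left a b x :
  cstar (img (cmul x a)) * img b = cstar (img a) * img (cmul (cstar x) b).
Proof. by rewrite /img -!inj_star -!injM (cop_move_left Tcop). Qed.

Lemma weight_star e : cstar (weight e) = weight e.
Proof. by rewrite ustarM cstarK. Qed.

Lemma weight_norm e k : rnorm e <= 1 -> rnorm (weight e ^+ k) <= 1.
Proof.
move=> e1; elim: k => [|k IH]; first by rewrite expr0 urnorm1.
rewrite exprS (le_trans (urnormM _ _))// mulr_ile1 ?rnorm_ge0//.
rewrite urnorm_star exprn_ile1 ?rnorm_ge0//.
exact: le_trans (img_norm e) e1.
Qed.

Lemma img_cvg {S} {F : set_system S} {FF : Filter F} (f : S -> A) a :
  f @ F --> a -> img (f t) @[t --> F] --> img a.
Proof.
move=> /cvg_rnormP fa; apply/cvg_rnormP => eps eps0.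
by apply: filterS (fa _ eps0) => t; rewrite -imgB; apply: le_lt_trans; exact: img_norm.
Qed.

Lemma cvg0_mul_bounded {S} {F : set_system S} {FF : Filter F} (f g : S -> U) (M : R) :
  f @ F --> (0 : U) -> (\forall t \near F, rnorm (g t) <= M) ->
  f t * g t @[t --> F] --> (0 : U).
Proof.
move=> f0 gM; apply: (@cvg_rnorm0 _ _ _ _ _ _ (fun t => rnorm (f t) * M)).
  by rewrite -(mul0r M) -(@rnorm0 R U); apply: cvgM; [exact: cvg_rnorm|exact: cvg_cst].
apply: filterS gM => t gM; rewrite (le_trans (urnormM _ _))//.
by rewrite ler_wpM2l ?rnorm_ge0.
Qed.

(** Since T(y z^* c) T(e)^* = T(y) T(e c^* z)^* and T(c^* z)^* T(e) = T(z)^* T(c e),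
    the product T(y z^* c) T(e)^* T(e) differs from T(y) T(z)^* T(c) by terms that
    vanish in the limit. *)
Lemma power_step k y z c (l : U) :
  img c * weight e ^+ k @[e --> EE] --> l ->
  img (cmul (cmul y (cstar z)) c) * weight e ^+ k.+1 @[e --> EE] -->
    img y * cstar (img z) * l.
Proof.
move=> cl.
have bounded : \forall e \near EE, rnorm (img e * weight e ^+ k) <= 1.
  apply: filterS (@au_near _ A) => e [_ e1]; rewrite (le_trans (urnormM _ _))//.
  by rewrite mulr_ile1 ?rnorm_ge0 ?weight_norm// (le_trans (img_norm e)).
have bounded2 : \forall e \near EE, rnorm (weight e ^+ k) <= 1.
  by apply: filterS (@au_near _ A) => e [_ e1]; exact: weight_norm.
pose x := cmul (cstar c) z.
have H1 : img y * ((cstar (img (cmul e x)) - cstar (img x)) * (img e * weight e ^+ k))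
    @[e --> EE] --> img y * 0.
  apply: cvg_umul; first exact: cvg_cst.
  apply: cvg0_mul_bounded bounded; rewrite -(subrr (cstar (img x))).
  by apply: cvgB; [apply/cvg_cstar/img_cvg/au_cvgl|exact: cvg_cst].
have H2 : img y * cstar (img z) * ((img (cmul c e) - img c) * weight e ^+ k)
    @[e --> EE] --> img y * cstar (img z) * 0.
  apply: cvg_umul; first exact: cvg_cst.
  apply: cvg0_mul_bounded bounded2; rewrite -(subrr (img c)).
  by apply: cvgB; [apply/img_cvg/au_cvgr|exact: cvg_cst].
have H3 : img y * cstar (img z) * (img c * weight e ^+ k) @[e --> EE] -->
    img y * cstar (img z) * l.
  by apply: cvg_umul => //; exact: cvg_cst.
have H := cvgD H1 (cvgD H2 H3); have {}H := H (@au_filter_proper R A) (@au_filter_proper R A); rewrite !mulr0 !add0r in H.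
refine (cvg_ext _ H) => e; rewrite !fctE.
have hx : cstar (img x) * img e = cstar (img z) * img (cmul c e).
  by rewrite img_move_left cstarK.
rewrite -mulrDr -mulrDl subrK mulrBl mulrBr [cstar (img x) * _]mulrA hx.
rewrite -(mulrA (img y)) (mulrA (cstar (img z))) subrK.
rewrite exprS /weight !mulrA -[cmul (cmul y _) c]cmulA img_move_right.
by rewrite cstarM cstarK.
Qed.

(** Induction on k: the previous lemma treats triple products, and these are
    dense. *)
Lemma power_cvg k a : exists l : U, img a * weight e ^+ k @[e --> EE] --> l.
Proof.
elim: k a => [|k IH] a.
  by exists (img a); under eq_fun do rewrite expr0 mulr1; exact: cvg_cst.
suff /cvg_ex[l al] : cvg (img a * weight e ^+ k.+1 @[e --> EE]) by exists l.
apply: cauchy_cvg; apply/cauchy_rnormP => eps eps0.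
have e20 : 0 < eps / 2 by rewrite divr_gt0.
have [_ [[e ->] ae]] := triple_product_dense a e20.
have [l el] := IH e; have := @power_step k a e e _ el.
set y := cmul _ e in ae *; set L := _ * l => yL.
exists L; move/cvg_rnormP : yL => /(_ _ e20) yL.
apply: filterS2 (@au_near _ A) yL => u [_ u1] uL /=.
rewrite -(subrK (img y * weight u ^+ k.+1) L) -addrA [ltRHS]splitr.
rewrite (le_lt_trans (ler_rnormD _ _))// ltrD// -mulrBl -imgB.
rewrite (le_lt_trans (urnormM _ _))// (le_lt_trans _ ae)// -rnormB.
by rewrite (le_trans (ler_piMr (rnorm_ge0 _) (weight_norm k.+1 u1)))// img_norm.
Qed.

(** The future image of w^(2k+1) (x) a. *)
Definition wimg k a : U := lim (img a * weight e ^+ k @[e --> EE]).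

Lemma wimg_cvg k a : img a * weight e ^+ k @[e --> EE] --> wimg k a.
Proof. by have /cvg_ex := power_cvg k a. Qed.

Arguments wimg_cvg : clear implicits.

Lemma wimg_eq k a (l : U) : img a * weight e ^+ k @[e --> EE] --> l -> wimg k a = l.
Proof. by move=> al; exact: (cvg_eq (wimg_cvg k a) al (fun=> erefl)). Qed.

Lemma wimg0 a : wimg 0 a = img a.
Proof. by apply: wimg_eq; under eq_fun do rewrite expr0 mulr1; exact: cvg_cst. Qed.

Lemma wimg_step k y z c :
  wimg k.+1 (cmul (cmul y (cstar z)) c) = img y * cstar (img z) * wimg k c.
Proof. by apply/wimg_eq/power_step/wimg_cvg. Qed.

Lemma wimgB k a b : wimg k (a - b) = wimg k a - wimg k b.
Proof.
apply: wimg_eq; under eq_fun do rewrite imgB mulrBl.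
by apply: cvgB; exact: wimg_cvg.
Qed.

Lemma wimg_linear k : linear (wimg k).
Proof.
move=> l a b; apply: wimg_eq; under eq_fun do rewrite imgD imgZ mulrDl -scalerAl.
by apply: cvgD; [apply: cvgZl_tmp|]; exact: wimg_cvg.
Qed.

Lemma wimg_norm k a : rnorm (wimg k a) <= rnorm a.
Proof.
apply: (cvg_rnorm_le (wimg_cvg k a)); apply: filterS (@au_near _ A) => e [_ e1].
rewrite (le_trans (urnormM _ _))//.
by rewrite (le_trans (ler_piMr (rnorm_ge0 _) (weight_norm k e1)))// img_norm.
Qed.

(** The powers of the weight are self-adjoint, hence can be moved across the
    product. *)
Lemma wimg_shift i j a b : wimg i a * cstar (wimg j b) = wimg (i + j) a * cstar (img b).
Proof.
have H1 : img a * weight e ^+ i * cstar (img b * weight e ^+ j) @[e --> EE] -->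
    wimg i a * cstar (wimg j b).
  by apply: cvg_umul; [|apply: cvg_cstar]; exact: wimg_cvg.
have H2 : img a * weight e ^+ (i + j) * cstar (img b) @[e --> EE] -->
    wimg (i + j) a * cstar (img b).
  by apply: cvg_umul; [exact: wimg_cvg|exact: cvg_cst].
apply: (cvg_eq H1 H2) => e.
by rewrite ustarM ustarX weight_star exprD !mulrA.
Qed.

(** Both sides are continuous in a, so a may be taken to be a triple product, and
    then the induction step is associativity. *)
Lemma wimg_mul0 m k a b c :
  wimg m a * cstar (img b) * wimg k c = wimg (m + k).+1 (cmul (cmul a (cstar b)) c).
Proof.
elim: m a b c => [|m IH] a b c; first by rewrite wimg_step wimg0.
apply/eqP; rewrite -subr_eq0; apply/eqP.
pose F a := wimg m.+1 a * cstar (img b) * wimg k c -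
  wimg (m.+1 + k).+1 (cmul (cmul a (cstar b)) c).
rewrite -[LHS]/(F a).
apply: (@additive_triple_eq0 _ _ _ _ (rnorm (img b) * rnorm (wimg k c) + rnorm b * rnorm c)).
- move=> x y; rewrite /F wimgB -!cmulA cmulDl cmulNl wimgB !mulrBl.
  by rewrite !opprD !opprK !addrA [LHS](ACl (1*3*2*4)).
- move=> x; rewrite /F (le_trans (ler_rnormD _ _))// rnormN mulrDl lerD//.
    rewrite -mulrA (le_trans (urnormM _ _))// mulrC ler_pM ?rnorm_ge0 ?wimg_norm//.
    by rewrite (le_trans (urnormM _ _))// rnormS.
  rewrite (le_trans (wimg_norm _ _))// -cmulA (le_trans (rnormM _ _))// mulrC.
  by rewrite ler_wpM2r ?rnorm_ge0// (le_trans (rnormM _ _))// rnormS.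
- move=> x y z; rewrite /F.
  have -> : cmul (cmul (cmul (cmul x (cstar y)) z) (cstar b)) c =
      cmul (cmul x (cstar y)) (cmul (cmul z (cstar b)) c) by rewrite !cmulA.
  by rewrite addSn wimg_step [X in _ - X]wimg_step -IH !mulrA subrr.
Qed.

Lemma wimg_mul i j k a b c :
  wimg i a * cstar (wimg j b) * wimg k c = wimg (i + j + k).+1 (cmul (cmul a (cstar b)) c).
Proof. by rewrite wimg_shift wimg_mul0. Qed.

End WeightPowers.

(** * Tents and their polynomial approximation *)

Section Tents.
Context {R : realType}.
Implicit Types (t x eps : R) (n k : nat).

(** The square root iteration at 1 - x^2; it converges to 1 - |x|. *)
Fixpoint visser_poly n : {poly R} :=
  if n is n'.+1 then 2^-1 *: (1 - 'X^2 + visser_poly n' ^+ 2) else 0.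

Lemma visserR_cvg1 : @visserR R @ \oo --> (1 : R).
Proof.
have [L vL L1] := @visserR_cvg R.
have vLS : visserR n.+1 @[n --> \oo] --> L by rewrite (cvg_shiftS (@visserR R)).
have H : visserR n.+1 @[n --> \oo] --> (1 + L ^+ 2) / 2.
  apply: cvgM; last exact: cvg_cst.
  by apply: cvgD; [exact: cvg_cst|rewrite expr2; exact: cvgM].
have LE : L = (1 + L ^+ 2) / 2 by apply: (@cvg_unique _ _ _ _ L _ vLS H); exact: norm_hausdorff.
by have <- : L = 1 by nra.
Qed.

(** With u = 1 - |x| one has u - y' = (u - y) (u + y) / 2, which is compared with
    the same identity for the scalar iteration and its limit 1. *)
Lemma visser_poly_approx n x : -1 <= x <= 1 ->
  `|(visser_poly n).[x]| <= visserR n /\ `|1 - `|x| - (visser_poly n).[x]| <= 1 - visserR n.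
Proof.
move=> x1; have y1 : `|x| <= 1 by rewrite ler_norml.
have y0 : 0 <= `|x| := normr_ge0 x.
elim: n => [|n [IH1 IH2]].
  by rewrite /= horner0 normr0 subr0 subr0 ger0_norm; lra.
have V1 := @visserR01 R n; have /andP[V10 V11] := V1.
rewrite [visser_poly _]/= hornerZ hornerD horner_1subX2 horner_exp.
have xx : x ^+ 2 = `|x| ^+ 2 by rewrite real_normK ?num_real.
set p := (visser_poly n).[x] in IH1 IH2 *; set V := visserR n in IH1 IH2 V10 V11 *.
have pV := IH1; rewrite ler_norml in pV; case/andP: pV => pV1 pV2.
have -> : visserR n.+1 = (1 + V ^+ 2) / 2 by [].
split.
  rewrite normrM ger0_norm ?invr_ge0// mulrC ler_wpM2r ?invr_ge0//.
  have p2 : 0 <= p ^+ 2 <= V ^+ 2.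
    rewrite sqr_ge0/= -[p ^+ 2]real_normK ?num_real//.
    by rewrite lerXn2r ?nnegrE.
  have x2 : 0 <= x ^+ 2 <= 1 by rewrite sqr_ge0 xx/= exprn_ile1.
  case/andP: p2 => p20 p21; case/andP: x2 => x20 x21.
  by rewrite ger0_norm; lra.
rewrite (_ : 1 - _ - _ = (1 - `|x| - p) * (1 - `|x| + p) / 2); last by rewrite xx; field.
rewrite (_ : 1 - (1 + V ^+ 2) / 2 = (1 - V) * (1 + V) / 2); last by field.
rewrite normrM [`|2^-1|]ger0_norm ?invr_ge0// ler_wpM2r ?invr_ge0// normrM.
by rewrite ler_pM// ler_norml; apply/andP; split; lra.
Qed.

Lemma abs_poly_approx eps : 0 < eps -> exists P : {poly R},
  forall x, -1 <= x <= 1 -> `| `|x| - P.[x] | <= eps.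
Proof.
move=> eps0; have /cvgrPdist_lt/(_ _ eps0)[n _ /(_ n (leqnn n)) /= Vn] := visserR_cvg1.
exists (1 - visser_poly n) => x x1; have [_ H] := visser_poly_approx n x1.
rewrite hornerD hornerN -polyC1 hornerC -normrN.
rewrite (_ : - _ = 1 - `|x| - (visser_poly n).[x]); last by ring.
by rewrite (le_trans H)// (le_trans (ler_norm _))// ltW.
Qed.

(** The clamp function: 0 up to 0, then the identity, then 1 from 1 on.  Written
    with absolute values so that the polynomial approximation of |x| applies
    to it. *)
Definition ramp x : R := (`|x| - `|x - 1| + 1) / 2.

Definition tent x : R := ramp (x + 1) - ramp x.

Lemma tentE x : tent x = (`|x + 1| - 2 * `|x| + `|x - 1|) / 2.
Proof. by rewrite /tent /ramp addrK; field. Qed.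

Lemma ramp_homo x y : x <= y -> ramp x <= ramp y.
Proof.
by move=> xy; rewrite /ramp; case: (ger0P x); case: (ger0P y);
  case: (ger0P (x - 1)); case: (ger0P (y - 1)); lra.
Qed.

Lemma tent_ge0 x : 0 <= tent x.
Proof. by rewrite subr_ge0 ramp_homo// lerDl. Qed.

Lemma ramp_le0 x : x <= 0 -> ramp x = 0.
Proof. by move=> x0; rewrite /ramp !ler0_norm; lra. Qed.

Lemma ramp_ge1 x : 1 <= x -> ramp x = 1.
Proof. by move=> x1; rewrite /ramp !ger0_norm; lra. Qed.

Lemma tent_out x : 1 <= `|x| -> tent x = 0.
Proof.
rewrite /tent; have [x0|x0] := ger0P x => x1.
  by rewrite !ramp_ge1 ?subrr//; lra.
by rewrite !ramp_le0 ?subrr//; lra.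
Qed.

Lemma tent_sum n t : 0 <= t <= 1 -> \sum_(k < n.+1) tent (n%:R * t - k%:R) = 1.
Proof.
move=> /andP[t0 t1]; rewrite -(big_mkord xpredT (fun k => tent (n%:R * t - k%:R))).
rewrite (eq_big_nat _ _ (F2 := fun k => - ramp (n%:R * t - k.+1%:R + 1) -
    - ramp (n%:R * t - k%:R + 1))); last first.
  by move=> k _; rewrite /tent opprK addrC; congr (- ramp _ + _); rewrite -natr1; ring.
rewrite telescope_sumr// opprK ramp_le0 ?ramp_ge1 ?oppr0 ?add0r//.
all: have h1 : 0 <= n%:R * t by rewrite mulr_ge0.
all: have h2 : n%:R * t <= n%:R by rewrite ler_piMr.
all: by rewrite -?natr1; lra.
Qed.

Lemma tent_continuous : continuous tent.
Proof.
have -> : tent = fun x => (`|x + 1| - 2 * `|x| + `|x - 1|) / 2 by apply/funext => x; rewrite tentE.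
move=> x; apply: cvgM; last exact: cvg_cst.
apply: (@cvgD R R^o); first apply: (@cvgB R R^o).
- by apply: (@cvg_norm R R^o); apply: (@cvgD R R^o); [exact: cvg_id|exact: cvg_cst].
- by apply: cvgM; [exact: cvg_cst|apply: (@cvg_norm R R^o); exact: cvg_id].
- by apply: (@cvg_norm R R^o); apply: (@cvgB R R^o); [exact: cvg_id|exact: cvg_cst].
Qed.

Lemma tent_poly_approx n k eps : 0 < eps -> exists P : {poly R},
  forall t, -1 <= t <= 1 -> `|tent (n%:R * t - k%:R) - P.[t]| <= eps.
Proof.
(* the arguments n t - k + c of the absolute values lie in [- r, r] *)
move=> eps0; pose r : R := (n + k + 1)%:R.
have r0 : 0 < r by rewrite ltr0n addn1.
have rE : r = n%:R + k%:R + 1 by rewrite /r !natrD.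
have er0 : 0 < eps / 2 / r by rewrite !divr_gt0.
have [Q QP] := abs_poly_approx er0.
pose S (c : R) : {poly R} := r *: (Q \Po (r^-1 *: (n%:R *: 'X + c%:P))).
have SP c t : `|n%:R * t + c| <= r -> `| `|n%:R * t + c| - (S c).[t]| <= eps / 2.
  move=> tc; rewrite /S !(hornerZ, horner_comp, hornerD, hornerX, hornerC).
  set y := r^-1 * _; have yE : n%:R * t + c = r * y by rewrite /y mulVKf// gt_eqF.
  have := QP y; rewrite -ler_norml => H.
  rewrite yE normrM gtr0_norm// -mulrBr normrM gtr0_norm// mulrC -ler_pdivlMr//.
  by apply: H; rewrite /y normrM gtr0_norm ?invr_gt0// ler_pdivrMl// mulr1.
exists (2^-1 *: (S (1 - k%:R) - 2 *: S (- k%:R) + S (- 1 - k%:R))) => t t1.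
have nt : `|n%:R * t| <= n%:R.
  by rewrite normrM ger0_norm ?ler0n// ler_piMr// ler_norml.
have k0 : 0 <= k%:R :> R := ler0n _ _.
have b (c : R) : `|c| <= k%:R + 1 -> `|n%:R * t + c| <= r.
  by move=> ck; rewrite (le_trans (ler_normD _ _))// rE -addrA lerD.
have := SP (1 - k%:R) t; have := SP (- k%:R) t; have := SP (- 1 - k%:R) t.
rewrite tentE !(hornerZ, hornerD, hornerN).
have -> : n%:R * t - k%:R + 1 = n%:R * t + (1 - k%:R) by ring.
have -> : n%:R * t - k%:R - 1 = n%:R * t + (- 1 - k%:R) by ring.
move=> /(_ (b _ _))-H1 /(_ (b _ _))-H2 /(_ (b _ _))-H3.
have {}H1 := H1 _; have {}H2 := H2 _; have {}H3 := H3 _.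
have h1 : `|-1 - k%:R| <= k%:R + 1 :> R by rewrite ler_norml; apply/andP; split; lra.
have h2 : `|- k%:R| <= k%:R + 1 :> R by rewrite ler_norml; apply/andP; split; lra.
have h3 : `|1 - k%:R| <= k%:R + 1 :> R by rewrite ler_norml; apply/andP; split; lra.
move: (H1 h1) (H2 h2) (H3 h3); rewrite !ler_norml.
by move=> /andP[? ?] /andP[? ?] /andP[? ?]; apply/andP; split; lra.
Qed.

(** On [0,1] the tent at k + 1 agrees with its odd extension to [-1,1], which is
    approximated by the odd part of a polynomial approximation of the tent. *)
Lemma tent_odd_poly_approx n k eps : 0 < eps -> exists q : {poly R},
  forall t, 0 <= t <= 1 -> `|tent (n%:R * t - k.+1%:R) - t * q.[t ^+ 2]| <= eps.
Proof.
move=> eps0; have [|P PP] := @tent_poly_approx n k.+1 (eps / 2); first by rewrite divr_gt0.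
exists (2 *: odd_poly P) => t /andP[t0 t1].
have PE u : P.[u] = (even_poly P).[u ^+ 2] + (odd_poly P).[u ^+ 2] * u.
  by rewrite -{1}(poly_even_odd P) !(hornerD, hornerM, horner_comp, hornerXn, hornerX).
have -> : t * (2 *: odd_poly P).[t ^+ 2] = P.[t] - P.[- t].
  by rewrite hornerZ !PE sqrrN; ring.
have z : tent (n%:R * - t - k.+1%:R) = 0.
  apply: tent_out; rewrite mulrN -opprD normrN -natr1 ger0_norm.
    by rewrite addrA lerDr addr_ge0// mulr_ge0.
  by rewrite addr_ge0// ?mulr_ge0// ?addr_ge0.
have h1 : `|tent (n%:R * t - k.+1%:R) - P.[t]| <= eps / 2 by apply: PP; lra.
have := PP (- t); rewrite z sub0r normrN => h2.
have {}h2 : `|P.[- t]| <= eps / 2 by apply: h2; lra.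
rewrite opprB addrCA addrC (le_trans (ler_normD _ _))//.
by rewrite [leRHS](splitr eps) lerD.
Qed.

End Tents.

(** * Density of the odd polynomials in C_0((0,1]) *)

Section ConeApproximation.
Context {R : realType}.
Local Notation "t *:r x" := ((t%:C%C : R[i]) *: x) (at level 40).
Implicit Types (t x eps : R) (n k : nat) (f g : C0 R).

Lemma hat_continuous n k : continuous (fun t : R => tent (n%:R * t - k%:R)).
Proof.
move=> x; apply: (@continuous_comp _ _ _ (fun t : R => n%:R * t - k%:R) tent).
  apply: (@cvgB R R^o); last exact: cvg_cst.
  by apply: cvgM; [exact: cvg_cst|exact: cvg_id].
exact: tent_continuous.
Qed.

Lemma hat0 n k : tent (n%:R * 0 - k.+1%:R) = 0 :> R.
Proof. by apply: tent_out; rewrite mulr0 sub0r normrN normr_nat ler1n. Qed.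

(** The tents at the nodes (k + 1) / n.  The node 0 is left out since the functions
    of C_0((0,1]) vanish there. *)
Definition hat n k : C0 R := Cone (cone_real_subproof (@hat_continuous n k.+1) (hat0 n k)).

Lemma hatE n k t : t \in `]0, 1] -> cone_fun (hat n k) t = (tent (n%:R * t - k.+1%:R))%:C%C.
Proof. by move=> t01; rewrite /hat /= t01. Qed.

Lemma cone_uniform_continuous f eps : 0 < eps -> exists2 d, 0 < d &
  forall x y, 0 <= x <= 1 -> 0 <= y <= 1 -> `|x - y| < d ->
    rnorm (cone_fun f x - cone_fun f y) <= eps.
Proof.
move=> eps0; have e20 : 0 < eps / 2 by rewrite divr_gt0.
pose P (d x : R) := forall y, 0 <= y <= 1 -> `|x - y| < d ->
    rnorm (cone_fun f x - cone_fun f y) <= eps.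
have /near_covering_withinP/(_ R (0^'+) P _) H :=
  (compact_near_coveringP _).1 (@segment_compact R 0 1).
have {H} : \forall d \near 0^'+, `[0, 1]%classic `<=` P d.
  apply: H => x x01.
  have /subspace_continuousP/(_ _ x01)/cvg_rnormP/(_ _ e20) := @cone_within _ _ f.
  rewrite near_withinE => /nbhs_ballP[d /= d0 fd].
  have d20 : 0 < d / 2 by rewrite divr_gt0.
  exists (ball x (d / 2), [set u : R | u < d / 2]).
    split; first exact: nbhsx_ballx.
    by apply: nbhs_right_lt.
  move=> [t u] /= [xt ud] t01 y y01 ty.
  have ft : rnorm (cone_fun f x - cone_fun f t) < eps / 2.
    by apply: fd => //; apply: le_ball xt; lra.
  have fy : rnorm (cone_fun f x - cone_fun f y) < eps / 2.
    apply: fd; last by rewrite /= in_itv.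
    rewrite /ball /= -(subrK t x) -addrA (le_lt_trans (ler_normD _ _))//.
    by move: xt; rewrite /ball/=; lra.
  have -> : cone_fun f t - cone_fun f y =
      - (cone_fun f x - cone_fun f t) + (cone_fun f x - cone_fun f y).
    by rewrite opprB addrA subrK.
  by apply: (le_trans (ler_rnormD _ _)); rewrite rnormN; lra.
move=> H; near (0 : R)^'+ => d.
have dP : `[0, 1]%classic `<=` P d by near: d.
exists d; first by near: d; exact: nbhs_right_gt.
by move=> x y x01 y01; apply: dP => //; rewrite /= in_itv.
Unshelve. all: by end_near. Qed.

Definition hat_interpolation n f : C0 R :=
  \sum_(k < n) cone_fun f (k.+1%:R / n%:R) *: hat n k.

Lemma hat_interpolation_approx (s : seq (C0 R)) eps : 0 < eps -> exists n,
  forall f, f \in s -> rnorm (f - hat_interpolation n f) <= eps.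
Proof.
move=> eps0.
have [d d0 dP] : exists2 d, 0 < d & forall f, f \in s ->
    forall x y, 0 <= x <= 1 -> 0 <= y <= 1 -> `|x - y| < d ->
    rnorm (cone_fun f x - cone_fun f y) <= eps.
  elim: s => [|f s [d d0 IH]]; first by exists 1.
  have [d' d'0 fP] := cone_uniform_continuous f eps0.
  exists (Num.min d d'); first by rewrite lt_min d0.
  move=> g; rewrite inE => /predU1P[->|gs] x y x01 y01; rewrite lt_min => /andP[xd xd'].
    exact: fP.
  exact: IH.
have [n nd] : exists n, d^-1 < n%:R.
  have : \forall n \near \oo, d^-1 < n%:R by exact: nbhs_infty_gtr.
  by move=> /filter_ex.
have n0 : 0 < n%:R :> R by apply: lt_trans nd; rewrite invr_gt0.
exists n => f fs; rewrite cone_rnormE; apply: cone_sup_le => t t01.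
have t01' : 0 <= t <= 1 by move: t01; rewrite in_itv/= => /andP[/ltW-> ->].
have -> : cone_fun (f - hat_interpolation n f) t =
    \sum_(k < n.+1) (tent (n%:R * t - k%:R))%:C%C *:
      (cone_fun f t - cone_fun f (k%:R / n%:R)) :> R[i].
  have -> : cone_fun (f - hat_interpolation n f) t =
    cone_fun f t - cone_fun (hat_interpolation n f) t by [].
  under [RHS]eq_bigr do rewrite scalerBr.
  rewrite sumrB -scaler_suml -rmorph_sum/= tent_sum// scale1r; congr (_ - _).
  rewrite big_ord_recl /= mul0r cone0 scaler0 add0r /hat_interpolation cone_sumE.
  apply: eq_bigr => k _; change (cone_fun f (k.+1%:R / n%:R) * cone_fun (hat n k) t =
    (tent (n%:R * t - k.+1%:R))%:C%C * cone_fun f (k.+1%:R / n%:R)).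
  rewrite hatE//.
  exact: mulrC.
apply: (le_trans (rnorm_sum _ _)).
apply: (@le_trans _ _ (\sum_(k < n.+1) tent (n%:R * t - k%:R) * eps)); last first.
  by rewrite -mulr_suml tent_sum// mul1r.
apply: ler_sum => k _; rewrite rnormZc rnormRC ger0_norm ?tent_ge0//.
have [tk|tk] := ltP `|n%:R * t - k%:R| 1; last by rewrite tent_out// !mul0r.
rewrite ler_wpM2l ?tent_ge0//; apply: dP => //.
  by rewrite divr_ge0//= ler_pdivrMr// mul1r ler_nat -ltnS.
rewrite -(ltr_pM2l n0) -[X in X * `|_|](gtr0_norm n0) -normrM mulrBr.
rewrite [_ * (k%:R / _)]mulrC divfK ?gt_eqF//.
by rewrite (lt_trans tk)// -ltr_pdivrMr// div1r.
Qed.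

Definition odd_power k : C0 R := iter k (cmul (cmul cone_id cone_id)) cone_id.

Lemma odd_powerE k t : t \in `]0, 1] -> cone_fun (odd_power k) t = (t * (t ^+ 2) ^+ k)%:C%C.
Proof.
move=> t01; elim: k => [|k IH]; first by rewrite /odd_power /= t01 expr0 mulr1.
have -> : cone_fun (odd_power k.+1) t =
  cone_fun cone_id t * cone_fun cone_id t * cone_fun (odd_power k) t by [].
have -> : cone_fun cone_id t = t%:C%C by rewrite /= t01.
by rewrite IH -!rmorphM /=; congr (_%:C%C); rewrite [_ ^+ k.+1]exprS expr2 !mulrA.
Qed.

Lemma odd_power_star k : cstar (odd_power k) = odd_power k.
Proof.
apply/val_inj/funext => t.
change (Num.conj (cone_fun (odd_power k) t) = cone_fun (odd_power k) t).
have [t01|t01] := boolP (t \in `]0, 1]); last by rewrite cone_out// conjC0.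
by rewrite odd_powerE// conjRC.
Qed.

Lemma odd_power_mul i j k :
  cmul (cmul (odd_power i) (cstar (odd_power j))) (odd_power k) = odd_power (i + j + k).+1.
Proof.
rewrite odd_power_star; apply/val_inj/funext => t.
change (cone_fun (odd_power i) t * cone_fun (odd_power j) t * cone_fun (odd_power k) t =
  cone_fun (odd_power (i + j + k).+1) t).
have [t01|t01] := boolP (t \in `]0, 1]); last by rewrite !cone_out// mulr0.
rewrite !odd_powerE// -!rmorphM/=; congr (_%:C%C).
rewrite [(t ^+ 2) ^+ (i + j + k).+1]exprS !exprD.
set x := _ ^+ i; set y := _ ^+ j; set z := _ ^+ k; ring.
Qed.

(** The odd function t q(t^2). *)
Definition odd_poly_fun (q : {poly R[i]}) : C0 R :=
  \sum_(k < size q) q`_k *: odd_power k.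

Lemma odd_poly_funE q t : t \in `]0, 1] ->
  cone_fun (odd_poly_fun q) t = t%:C%C * q.[(t ^+ 2)%:C%C].
Proof.
move=> t01; rewrite /odd_poly_fun cone_sumE horner_coef mulr_sumr.
apply: eq_bigr => k _; change (q`_k * cone_fun (odd_power k) t = t%:C%C * (q`_k * (t ^+ 2)%:C%C ^+ k)).
rewrite odd_powerE//.
by rewrite -rmorphXn rmorphM /= mulrCA.
Qed.

Lemma odd_poly_fun_linear : linear odd_poly_fun.
Proof.
move=> c p q; apply/val_inj/funext => t.
change (cone_fun (odd_poly_fun (c *: p + q)) t =
  c * cone_fun (odd_poly_fun p) t + cone_fun (odd_poly_fun q) t).
have [t01|t01] := boolP (t \in `]0, 1]); last by rewrite !cone_out// mulr0 addr0.
by rewrite !odd_poly_funE// hornerD hornerZ mulrDr mulrCA.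
Qed.

Lemma hat_odd_poly_approx n k eps : 0 < eps ->
  exists q, rnorm (hat n k - odd_poly_fun q) <= eps.
Proof.
move=> eps0; have [q qP] := tent_odd_poly_approx n k eps0.
exists (map_poly (real_complex R) q); rewrite cone_rnormE; apply: cone_sup_le => t t01.
set p := map_poly _ q.
change (rnorm (cone_fun (hat n k) t - cone_fun (odd_poly_fun p) t) <= eps).
rewrite hatE// odd_poly_funE// horner_map /= -rmorphM -rmorphB /= rnormRC; apply: qP.
by move: t01; rewrite in_itv/= => /andP[/ltW-> ->].
Qed.

Lemma odd_poly_fun_dense f eps : 0 < eps -> exists q, rnorm (f - odd_poly_fun q) < eps.
Proof.
move=> eps0; have e20 : 0 < eps / 2 / 2 by rewrite !divr_gt0.
have [n /(_ f)] := hat_interpolation_approx [:: f] e20.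
rewrite inE eqxx => /(_ isT) fn.
pose M := rnorm f + 1; have M0 : 0 < M by rewrite ltr_wpDl ?rnorm_ge0.
have d0 : 0 < eps / 2 / (n.+1%:R * M) by rewrite !divr_gt0// mulr_gt0.
have /choice[q qP] : forall k : 'I_n, exists q,
  rnorm (hat n k - odd_poly_fun q) <= eps / 2 / (n.+1%:R * M).
  by move=> k; exact: hat_odd_poly_approx.
exists (\sum_(k < n) cone_fun f (k.+1%:R / n%:R) *: q k).
have -> : odd_poly_fun (\sum_(k < n) cone_fun f (k.+1%:R / n%:R) *: q k) =
    \sum_(k < n) cone_fun f (k.+1%:R / n%:R) *: odd_poly_fun (q k).
  pose L : {linear {poly R[i]} -> C0 R} :=
    HB.pack odd_poly_fun (GRing.isLinear.Build _ _ _ _ odd_poly_fun odd_poly_fun_linear).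
  rewrite -[odd_poly_fun]/(L : _ -> _) linear_sum.
  by apply: eq_bigr => k _; rewrite linearZ.
set S := \sum_(k < n) _.
have -> : f - S = (f - hat_interpolation n f) + (hat_interpolation n f - S).
  by rewrite addrA subrK.
apply: (le_lt_trans (ler_rnormD _ _)).
have H : rnorm (hat_interpolation n f - S) <= eps / 2.
  rewrite /S /hat_interpolation -sumrB (le_trans (rnorm_sum _ _))//.
  apply: (@le_trans _ _ (\sum_(k < n) eps / 2 / n.+1%:R)).
    apply: ler_sum => k _; rewrite -scalerBr rnormZc.
    apply: (@le_trans _ _ (M * (eps / 2 / (n.+1%:R * M)))).
      apply: ler_pM; rewrite ?rnorm_ge0 ?qP//.
      by rewrite (le_trans (rnorm_eval f _))// lerDl.
    rewrite le_eqVlt; apply/orP; left; apply/eqP.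
    field; apply/andP; split; last by rewrite gt_eqF.
    by rewrite addrC natr1 pnatr_eq0.
  rewrite sumr_const card_ord -[leLHS]mulr_natr mulrAC ler_pdivrMr ?ltr0n//.
  by rewrite ler_wpM2l ?ler_nat// divr_ge0// ltW.
lra.
Qed.

End ConeApproximation.

(** * Extension by continuity *)

(** The map to be extended is given by its graph, so that its well-definedness is
    a consequence of the norm estimate instead of a separate condition. *)
Lemma dense_extension (R : realType) (E : normedModType R[i])
    (V : completeNormedModType R[i]) (G : E -> V -> Prop) (C : R) : 0 <= C ->
  (forall k x u y v, G x u -> G y v -> G (k *: x + y) (k *: u + v)) ->
  (forall x u, G x u -> rnorm u <= C * rnorm x) ->
  (forall x eps, 0 < eps -> exists y v, G y v /\ rnorm (x - y) < eps) ->
  exists Phi : {linear E -> V}, (forall x, rnorm (Phi x) <= C * rnorm x) /\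
    forall x u, G x u -> Phi x = u.
Proof.
move=> C0 Glin Gbound Gdense.
have GB x u y v : G x u -> G y v -> rnorm (u - v) <= C * rnorm (x - y).
  move=> xu yv; have := Gbound _ _ (Glin (-1) _ _ _ _ yv xu).
  by rewrite !scaleN1r ![- _ + _]addrC.
have /choice[Phi PhiP] : forall x, exists l, forall y v, G y v -> rnorm (l - v) <= C * rnorm (x - y).
  move=> x.
  have /choice[p pP] : forall n : nat, exists p : E * V,
      G p.1 p.2 /\ rnorm (x - p.1) < n.+1%:R^-1.
    move=> n; have [|y [v yv]] := Gdense x n.+1%:R^-1; first by rewrite invr_gt0 ltr0n.
    by exists (y, v).
  have near0 y v : G y v -> forall n, rnorm (v - (p n).2) <= C * rnorm (x - y) + C * n.+1%:R^-1.
    move=> yv n; have [pG /ltW pn] := pP n; rewrite (le_trans (GB _ _ _ _ yv pG))//.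
    rewrite -mulrDr ler_wpM2l//; have := ler_rnormD (y - x) (x - (p n).1).
    by rewrite addrA subrK [rnorm (y - x)]rnormB => /le_trans; apply; rewrite lerD.
  have small eps : 0 < eps -> exists n : nat, C * n.+1%:R^-1 <= eps.
    move=> eps0; have : \forall n \near \oo, C / eps < n%:R by exact: nbhs_infty_gtr.
    move=> /filter_ex[n nP]; exists n; rewrite ler_pdivrMr ?ltr0n// mulrC -ler_pdivrMr//.
    by rewrite (le_trans (ltW nP))// ler_nat.
  have /cvg_ex[l pl] : cvg ((p n).2 @[n --> \oo]).
    apply: cauchy_cvg; apply/cauchy_rnormP => eps eps0.
    have [n nP] := small (eps / 2 / 2) (divr_gt0 (divr_gt0 eps0 (ltr0n _ 2)) (ltr0n _ 2)).
    exists (p n).2; exists n => // m /= nm; have [pG /ltW pn] := pP n.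
    rewrite (le_lt_trans (near0 _ _ pG m))//.
    have H1 : C * rnorm (x - (p n).1) <= eps / 2 / 2 by rewrite (le_trans _ nP)// ler_wpM2l.
    have H2 : C * m.+1%:R^-1 <= eps / 2 / 2.
      by rewrite (le_trans _ nP)// ler_wpM2l// lef_pV2 ?posrE ?ltr0n// ler_nat ltnS.
    by apply: le_lt_trans (lerD H1 H2) _; lra.
  exists l => y v yv; apply/ler_addgt0Pl => eps eps0.
  have e20 : 0 < eps / 2 by rewrite divr_gt0.
  have [n nP] := small _ e20.
  move/cvg_rnormP : pl => /(_ _ e20)[N _ /(_ (N + n)%N (leq_addr _ _)) /ltW H].
  have H1 := near0 _ _ yv (N + n)%N; rewrite rnormB in H1.
  have H3 := ler_rnormD (l - (p (N + n)%N).2) ((p (N + n)%N).2 - v).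
  rewrite addrA subrK in H3.
  have H2 : C * (N + n).+1%:R^-1 <= eps / 2.
    by rewrite (le_trans _ nP)// ler_wpM2l// lef_pV2 ?posrE ?ltr0n// ler_nat ltnS leq_addl.
  by set c := C * (N + n).+1%:R^-1 in H1 H2; move: H; rewrite /=; lra.
have Phi_lin : linear Phi.
  move=> k x y; apply/eqP; rewrite -subr_eq0; apply/eqP/rnorm0_eq0/le_anti.
  rewrite rnorm_ge0 andbT; apply/ler_addgt0Pl => eps eps0; rewrite addr0.
  pose K := 2 * C * (rnorm k + 1) + 1.
  have K0 : 0 < K by rewrite ltr_wpDl// !mulr_ge0// addr_ge0// rnorm_ge0.
  have d0 : 0 < eps / K by rewrite divr_gt0.
  have [p [u [pu /ltW xp]]] := Gdense x _ d0.
  have [q [v [qv /ltW yq]]] := Gdense y _ d0.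
  have H3 := PhiP (k *: x + y) _ _ (Glin k _ _ _ _ pu qv).
  have H2 := PhiP x _ _ pu; have H1 := PhiP y _ _ qv.
  have xyE : k *: x + y - (k *: p + q) = k *: (x - p) + (y - q).
    by rewrite scalerBr opprD addrACA.
  rewrite xyE in H3.
  have {}H3 := le_trans H3 (ler_wpM2l C0 (ler_rnormD _ _)); rewrite rnormZc in H3.
  have -> : Phi (k *: x + y) - (k *: Phi x + Phi y) =
    (Phi (k *: x + y) - (k *: u + v)) - (k *: (Phi x - u) + (Phi y - v)).
    have -> : k *: (Phi x - u) + (Phi y - v) = k *: Phi x + Phi y - (k *: u + v).
      by rewrite scalerBr opprD addrACA.
    by rewrite opprB addrA subrK.
  rewrite (le_trans (ler_rnormD _ _))// rnormN.
  have H4 := ler_rnormD (k *: (Phi x - u)) (Phi y - v); rewrite rnormZc in H4.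
  have k0 := rnorm_ge0 k.
  have epsE : eps = K * (eps / K) by rewrite mulrC divfK// gt_eqF.
  rewrite epsE /K; set d := eps / K in xp yq d0 *.
  have : rnorm k * rnorm (Phi x - u) <= rnorm k * (C * d).
    by rewrite ler_wpM2l// (le_trans H2)// ler_wpM2l.
  have : C * (rnorm k * rnorm (x - p) + rnorm (y - q)) <= C * (rnorm k * d + d).
    by rewrite ler_wpM2l// lerD// ler_wpM2l.
  have : C * rnorm (y - q) <= C * d by rewrite ler_wpM2l.
  lra.
pose L : {linear E -> V} := HB.pack Phi (GRing.isLinear.Build _ _ _ _ Phi Phi_lin).
have PhiE x u : G x u -> Phi x = u.
  move=> xu; apply/eqP; rewrite -subr_eq0; apply/eqP/rnorm0_eq0/le_anti.
  by rewrite rnorm_ge0 andbT (le_trans (PhiP _ _ _ xu))// subrr rnorm0 mulr0.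
exists L; split => //= x; apply/ler_addgt0Pl => eps eps0.
have d0 : 0 < eps / (2 * C + 1) by rewrite divr_gt0// ltr_wpDl// mulr_ge0.
have [y [v [yv /ltW xy]]] := Gdense x _ d0.
have h1 := PhiP x _ _ yv; have h2 := Gbound _ _ yv; have h3 := ler_rnormD (Phi x - v) v.
have h4 := ler_rnormD (y - x) x; rewrite subrK in h3; rewrite subrK rnormB in h4.
have epsE : eps = (2 * C + 1) * (eps / (2 * C + 1)).
  by rewrite mulrC divfK// gt_eqF// ltr_wpDl// mulr_ge0.
rewrite [in leRHS]epsE; set d := eps / _ in xy d0 *.
have : C * rnorm (x - y) <= C * d by rewrite ler_wpM2l.
have : C * rnorm y <= C * (rnorm (x - y) + rnorm x) by rewrite ler_wpM2l.
lra.
Qed.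

(** * Functional calculus in the first variable *)

Lemma cvg_bigsum (R : realType) (V : normedModType R[i]) (S I : Type) (F : set_system S)
    {FF : Filter F} (r : seq I) (f : I -> S -> V) (l : I -> V) :
  (forall i, f i @ F --> l i) -> \sum_(i <- r) f i t @[t --> F] --> \sum_(i <- r) l i.
Proof.
move=> fl; elim: r => [|i r IH].
  by rewrite big_nil; apply: (cvg_ext (f := fun=> 0)) => [t|]; [rewrite big_nil|exact: cvg_cst].
rewrite big_cons; apply: (cvg_ext (f := fun t => f i t + \sum_(j <- r) f j t)) => [t|].
  by rewrite big_cons.
by apply: cvgD.
Qed.

Lemma rhornerZ (R : realType) (A : cstarAlgType R) (j : unitization A) (c : R) (p : {poly R}) :
  rhorner j (c *: p) = (c%:C%C : R[i]) *: rhorner j p.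
Proof. by rewrite -mul_polyC rhornerM rhornerC -scalerAl mul1r. Qed.

Lemma rhorner_sum (R : realType) (A : cstarAlgType R) (j : unitization A) (p : {poly R}) :
  rhorner j p = \sum_(k < size p) ((p`_k)%:C%C : R[i]) *: j ^+ k.
Proof.
have rhorner0 : rhorner j 0 = 0 by rewrite /rhorner !rmorph0.
rewrite -{1}[p]coefK poly_def (big_morph (rhorner j) (rhornerD j) rhorner0).
by apply: eq_bigr => k _; rewrite rhornerZ rhornerXn rhornerX.
Qed.

Section FunctionalCalculus.
Context {R : realType} {A B : cstarAlgType R}.
Variable T : {linear A -> B}.
Hypothesis Tnorm : forall a, rnorm (T a) <= rnorm a.
Hypothesis Tcop : completely_orthogonality_preserving T.
Local Notation U := (unitization B).
Local Notation EE := (@au_filter R A).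
Local Notation "t *:r x" := ((t%:C%C : R[i]) *: x) (at level 40).
Local Notation img := (img T).
Local Notation weight := (weight T).
Local Notation wimg := (wimg T).
Implicit Types (a b c e : A) (k n : nat) (q : {poly R[i]}).

(** The future image of t q(t^2) (x) a. *)
Definition wpoly q a : U := \sum_(k < size q) q`_k *: wimg k a.

Lemma wpoly_widen n q a : (size q <= n)%N -> wpoly q a = \sum_(k < n) q`_k *: wimg k a.
Proof.
move=> qn; rewrite /wpoly (big_ord_widen n (fun k => q`_k *: wimg k a) qn).
rewrite [RHS](bigID (fun k : 'I_n => (k < size q)%N)) /= [X in _ + X]big1 ?addr0//.
by move=> k; rewrite -leqNgt => qk; rewrite nth_default// scale0r.
Qed.

Lemma wpoly_linear a : linear (wpoly^~ a).
Proof.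
move=> c p q; pose n := maxn (size p) (size q).
have pn : (size p <= n)%N by exact: leq_maxl.
have qn : (size q <= n)%N by exact: leq_maxr.
rewrite (@wpoly_widen n)//; last first.
  by rewrite (leq_trans (size_polyD _ _))// geq_max qn (leq_trans (size_scale_leq _ _)).
rewrite (wpoly_widen _ pn) (wpoly_widen _ qn) scaler_sumr -big_split /=.
by apply: eq_bigr => k _; rewrite coefD coefZ scalerDl scalerA.
Qed.

Lemma wpolyXn k a : wpoly 'X^k a = wimg k a.
Proof.
rewrite /wpoly size_polyXn big_ord_recr /= coefXn eqxx scale1r big1 ?add0r// => i _.
by rewrite coefXn ltn_eqF ?scale0r.
Qed.

(** If s is the root of |a|^2 - a^* a, then T(a e)^* T(a e) + T(s e)^* T(s e) is
    |a|^2 T(e)^* T(e): the factors a and s move across the product and combine into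
    the scalar |a|^2. *)
Lemma img_mul_norm a e u : cstar e = e ->
  rnorm (img (cmul a e) * u) <= rnorm a * rnorm (img e * u).
Proof.
move=> es; have [|s [ss s2]] := @star_mul_complement _ _ (inj a) (rnorm a).
  by rewrite rnorm_inj.
have img_uact x y z : cstar (img (uact x y)) * img z = cstar (img y) * img (uact (cstar x) z).
  rewrite /uact !imgD !imgZ cstarD cstarZ mulrDl mulrDr -scalerAl -scalerAr.
  by congr (_ + _); exact: (img_move_left Tcop).
have -> : rnorm a * rnorm (img e * u) = rnorm (rnorm a *:r (img e * u)).
  by rewrite rnormZr ger0_norm// rnorm_ge0.
apply: star_mul_le_norm.
rewrite (_ : _ - _ = cstar (img (uact s e) * u) * (img (uact s e) * u)).
  exact: psd_star_mul.
rewrite cstarZr -scalerAl -scalerAr scalerA -rmorphM -expr2 !ustarM -!mulrA.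
rewrite !(mulrA (cstar (img _))) img_uact ss -[cmul a e](_ : uact (inj a) e = _); last first.
  by rewrite /uact /= scale0r add0r.
rewrite img_uact -!uactM -expr2 s2.
have -> : uact (rnorm a ^+ 2 *:r 1 - cstar (inj a) * inj a) e =
    rnorm a ^+ 2 *:r e - uact (cstar (inj a) * inj a) e.
  by apply: inj_inj; rewrite inj_uact raddfB /= injZ inj_uact mulrBl -scalerAl mul1r.
by rewrite imgB imgZ mulrBr mulrBl mulrBr -scalerAr -scalerAl -scalerAr.
Qed.

Lemma wpoly_real_norm (q : {poly R}) a (M : R) :
  (forall t, 0 <= t <= 1 -> `|t * q.[t ^+ 2]| <= M) ->
  rnorm (wpoly (map_poly (real_complex R) q) a) <= rnorm a * M.
Proof.
move=> qM.
have cv : img (cmul a e) * rhorner (weight e) q @[e --> EE] -->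
    wpoly (map_poly (real_complex R) q) a.
  rewrite /wpoly size_map_poly.
  apply: (@cvg_ext _ _ _ (fun e => \sum_(k < size q) (map_poly (real_complex R) q)`_k *:
      (img (cmul a e) * weight e ^+ k))).
    move=> e; rewrite rhorner_sum mulr_sumr; apply: eq_bigr => k _.
    by rewrite coef_map -scalerAr.
  apply: cvg_bigsum => k; apply: cvgZl_tmp.
  have H : (img (cmul a e) - img a) * weight e ^+ k @[e --> EE] --> (0 : U).
    have H1 : img (cmul a e) - img a @[e --> EE] --> (0 : U).
      rewrite -(subrr (img a)).
      by apply: cvgB; [apply/(img_cvg Tnorm)/au_cvgr|exact: cvg_cst].
    have H2 : \forall e \near EE, rnorm (weight e ^+ k) <= 1.
      by apply: filterS (@au_near _ A) => e [_ e1]; exact: weight_norm.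
    exact: (cvg0_mul_bounded H1 H2).
  rewrite -[wimg k a]add0r.
  apply: (@cvg_ext _ _ _ (fun e => (img (cmul a e) - img a) * weight e ^+ k +
    img a * weight e ^+ k)) => [e|]; first by rewrite -mulrDl subrK.
  by apply: cvgD => //; exact: wimg_cvg.
apply: (cvg_rnorm_le cv); apply: filterS (@au_near _ A) => e [es e1].
rewrite (le_trans (img_mul_norm _ _ es))// ler_wpM2l ?rnorm_ge0//.
by apply: star_rhorner_norm => //; rewrite (le_trans _ e1)// rnorm_inj.
Qed.

(** The factor 2 comes from splitting q into its real and imaginary parts.  It is
    harmless: boundedness suffices, since contractivity of the final map is
    automatic. *)
Lemma wpoly_norm q a : rnorm (wpoly q a) <= 2 * rnorm a * rnorm (odd_poly_fun q).
Proof.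
pose q1 := map_poly (@complex.Re R) q; pose q2 := map_poly (@complex.Im R) q.
have qE : q = unit_i *: map_poly (real_complex R) q2 + map_poly (real_complex R) q1.
  apply/polyP => k; rewrite coefD coefZ !coef_map /=.
  by case: (q`_k) => x y; apply/eqP; rewrite eq_complex /=; apply/andP; split; apply/eqP; ring.
have horner_q t : q.[t%:C%C] = unit_i * (q2.[t])%:C%C + (q1.[t])%:C%C.
  by rewrite {1}qE hornerD hornerZ !horner_map.
have bound (p : {poly R}) : (forall t, `|t * p.[t ^+ 2]| <=
    rnorm (t%:C%C * q.[(t ^+ 2)%:C%C])) ->
    forall t, 0 <= t <= 1 -> `|t * p.[t ^+ 2]| <= rnorm (odd_poly_fun q).
  move=> H t /andP[t0 t1]; have [->|tn0] := eqVneq t 0; first by rewrite mul0r normr0 rnorm_ge0.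
  have t01 : t \in `]0, 1] by rewrite in_itv/= t1 lt_neqAle eq_sym tn0 t0.
  by rewrite (le_trans (H t))// -odd_poly_funE// rnorm_eval.
rewrite {1}qE wpoly_linear (le_trans (ler_rnormD _ _))// rnormZc.
have i1 : rnorm (unit_i : R[i]) = 1.
  by rewrite rnorm_complex /= expr0n expr1n add0r sqrtr1.
rewrite i1 mul1r -mulrA mulr_natl mulr2n lerD//; apply: wpoly_real_norm; apply: bound => t.
  rewrite horner_q; apply: le_trans (ler_Im_rnorm _).
  rewrite le_eqVlt; apply/orP; left; apply/eqP; congr (`|_|).
  by rewrite /= !mul0r !mul1r !addr0 !add0r ?subr0.
rewrite horner_q; apply: le_trans (ler_Re_rnorm _).
rewrite le_eqVlt; apply/orP; left; apply/eqP; congr (`|_|).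
by rewrite /= !mul0r !mul1r !subr0 !add0r.
Qed.

(** This produces the future map f |-> Phi(f (x) a), by density of the odd
    polynomials. *)
Lemma calculus_exists a : exists Phi : {linear C0 R -> U},
  (forall f, rnorm (Phi f) <= 2 * rnorm a * rnorm f) /\
  forall q, Phi (odd_poly_fun q) = wpoly q a.
Proof.
have [||||Phi [Phi1 Phi2]] := @dense_extension R (C0 R) U
  (fun f u => exists q, f = odd_poly_fun q /\ u = wpoly q a) (2 * rnorm a).
- by rewrite mulr_ge0// rnorm_ge0.
- move=> k _ _ _ _ [p [-> ->]] [q [-> ->]]; exists (k *: p + q).
  by rewrite odd_poly_fun_linear wpoly_linear.
- by move=> _ _ [q [-> ->]]; exact: wpoly_norm.
- move=> f eps eps0; have [q fq] := odd_poly_fun_dense f eps0.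
  by exists (odd_poly_fun q), (wpoly q a); split => //; exists q.
by exists Phi; split => // q; apply: Phi2; exists q.
Qed.

End FunctionalCalculus.

(** * The bilinear map on C_0((0,1]) and A *)

Lemma odd_poly_funXn (R : realType) k : odd_poly_fun 'X^k = @odd_power R k.
Proof.
apply/val_inj/funext => t.
change (cone_fun (odd_poly_fun 'X^k) t = cone_fun (@odd_power R k) t).
have [t01|t01] := boolP (t \in `]0, 1]); last by rewrite !cone_out.
by rewrite odd_poly_funE// odd_powerE// hornerXn -rmorphXn -rmorphM.
Qed.

Lemma cone_dense_eq0 (R : realType) (V : normedModType R[i]) (F : C0 R -> V) (C : R) :
  (forall f g, F (f - g) = F f - F g) ->
  (forall (k : R[i]) f, F f = 0 -> F (k *: f) = 0) ->
  (forall f, rnorm (F f) <= C * rnorm f) ->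
  (forall k, F (odd_power k) = 0) -> forall f, F f = 0.
Proof.
move=> FB FZ FC F0.
have F00 : F 0 = 0 by rewrite -(subrr 0) FB subrr.
have FD f g : F (f + g) = F f + F g.
  by rewrite -{1}[g]opprK FB -[- g]sub0r FB F00 sub0r opprK.
apply: (additive_dense_eq0 FB FC (S := range (@odd_poly_fun R))).
  move=> f eps eps0; have [q fq] := odd_poly_fun_dense f eps0.
  by exists (odd_poly_fun q); split => //; exists q.
move=> _ [q _ <-]; rewrite /odd_poly_fun (big_morph F FD F00) big1// => k _.
exact/FZ/F0.
Qed.

(** For orthogonal u and v, the elements c = u^* u and d = v^* v have product 0.
    Hence (M^2 - c) (M^2 - d) is M^2 times M^2 - (c + d), and this is positive as a
    product of commuting positive elements. *)
Lemma orthogonal_sum_norm (R : realType) (A : cstarAlgType R) (I : eqType) (r : seq I)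
    (u : I -> unitization A) (M : R) : 0 <= M -> uniq r ->
  (forall i, i \in r -> rnorm (u i) <= M) ->
  (forall i j, i \in r -> j \in r -> i != j ->
    u i * cstar (u j) = 0 /\ cstar (u i) * u j = 0) ->
  rnorm (\sum_(i <- r) u i) <= M.
Proof.
move=> M0; elim: r => [|i r IH] /=; first by rewrite big_nil rnorm0.
move=> /andP[ir ur] uM uorth; rewrite big_cons; set v := \sum_(j <- r) u j.
have vM : rnorm v <= M.
  apply: IH => // [j jr|j k jr kr]; first by apply: uM; rewrite inE jr orbT.
  by apply: uorth; rewrite inE ?jr ?kr orbT.
have iM : rnorm (u i) <= M by apply: uM; rewrite inE eqxx.
have orth j : j \in r -> u i * cstar (u j) = 0 /\ cstar (u i) * u j = 0.
  move=> jr; apply: uorth; rewrite ?inE ?eqxx ?jr ?orbT//.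
  by apply: contraNneq ir => ->.
have uv1 : u i * cstar v = 0.
  rewrite (big_morph cstar (@cstarD R (unitization A)) cstar0) mulr_sumr big_seq big1// => j jr.
  by have [] := orth _ jr.
have uv2 : cstar (u i) * v = 0.
  by rewrite mulr_sumr big_seq big1// => j jr; have [] := orth _ jr.
have vu2 : cstar v * u i = 0 by rewrite -[LHS]cstarK ustarM cstarK uv2 cstar0.
pose c := cstar (u i) * u i; pose d := cstar v * v.
have cd : c * d = 0 by rewrite /c /d -mulrA (mulrA (u i)) uv1 mul0r mulr0.
have cs : cstar c = c by rewrite ustarM cstarK.
have ds : cstar d = d by rewrite ustarM cstarK.
have dc : d * c = 0 by rewrite -[LHS]cstarK ustarM cs ds cd cstar0.
have sumE : cstar (u i + v) * (u i + v) = c + d.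
  by rewrite cstarD mulrDl !mulrDr uv2 vu2 addr0 add0r.
rewrite -(@ler_pXn2r _ 2)// ?nnegrE ?rnorm_ge0// -urnorm_star sumE.
apply: psd_norm_le; first exact: sqr_ge0.
  by apply: psdD; exact: psd_star_mul.
have [M_eq0|Mn0] := eqVneq M 0.
  have u0 : u i = 0 by apply: rnorm0_eq0; apply/le_anti; rewrite rnorm_ge0 -M_eq0 iM.
  have v0 : v = 0 by apply: rnorm0_eq0; apply/le_anti; rewrite rnorm_ge0 -M_eq0 vM.
  by rewrite /c /d u0 v0 !mulr0 addr0 subr0; exact/psd_scalar/sqr_ge0.
have M2 : 0 < M ^+ 2 by rewrite lt_neqAle sqr_ge0 andbT eq_sym sqrf_eq0.
have -> : (M ^+ 2)%:C%C *: 1 - (c + d) =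
  ((M ^+ 2)^-1)%:C%C *: (((M ^+ 2)%:C%C *: 1 - c) * ((M ^+ 2)%:C%C *: 1 - d)).
  rewrite mulrBl !mulrBr -!scalerAl -!scalerAr !mul1r !mulr1 cd subr0 -scalerBr.
  rewrite -scalerBr rscaleA mulVf ?gt_eqF// rscale1 opprD addrA.
  by rewrite addrAC.
apply: psdZ; first by rewrite invr_ge0 ltW.
apply: psd_mul.
- apply: psd_sub_scalar => //.
  by rewrite urnorm_star lerXn2r ?nnegrE ?rnorm_ge0.
- apply: psd_sub_scalar => //.
  by rewrite urnorm_star lerXn2r ?nnegrE ?rnorm_ge0.
- rewrite !mulrBl !mulrBr -!scalerAl -!scalerAr !mul1r !mulr1 cd dc !subr0.
  by rewrite addrAC.
Qed.

Lemma subrBB (V : zmodType) (a b c d : V) : (a - b) - (c - d) = (a - c) - (b - d).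
Proof. by rewrite !opprB addrACA [RHS]addrACA [- b - c]addrC. Qed.

Lemma star_mul_eq0 (R : realType) (A : cstarAlgType R) (x : unitization A) :
  cstar x * x = 0 -> x = 0.
Proof.
by move=> xx; apply: rnorm0_eq0; apply/eqP; rewrite -sqrf_eq0 -urnorm_star xx rnorm0.
Qed.

Lemma mul_star_eq0 (R : realType) (A : cstarAlgType R) (x : unitization A) :
  x * cstar x = 0 -> x = 0.
Proof.
move=> xx; rewrite -[x]cstarK (@star_mul_eq0 _ _ (cstar x)) ?cstar0//.
by rewrite cstarK.
Qed.

Section TensorCalculus.
Context {R : realType} {A B : cstarAlgType R}.
Variable T : {linear A -> B}.
Hypothesis Tnorm : forall a, rnorm (T a) <= rnorm a.
Hypothesis Tcop : completely_orthogonality_preserving T.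
Local Notation U := (unitization B).
Local Notation wimg := (wimg T).
Implicit Types (a b c e : A) (k n : nat) (q : {poly R[i]}) (f g h : C0 R).

Variable beta : A -> {linear C0 R -> U}.
Hypothesis beta_norm : forall a f, rnorm (beta a f) <= 2 * rnorm a * rnorm f.
Hypothesis beta_poly : forall a q, beta a (odd_poly_fun q) = wpoly T q a.

Lemma beta_power a k : beta a (odd_power k) = wimg k a.
Proof. by rewrite -odd_poly_funXn beta_poly wpolyXn. Qed.

(** Both sides are bounded and linear in f, so it suffices to compare them at the
    odd powers of w.  The next lemma rests on the same principle, used in each of
    the three variables. *)
Lemma beta_linear_arg (l : R[i]) a b f : beta (l *: a + b) f = l *: beta a f + beta b f.
Proof.
apply/eqP; rewrite -subr_eq0; apply/eqP.
pose F f := beta (l *: a + b) f - (l *: beta a f + beta b f).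
apply: (@cone_dense_eq0 _ _ F (2 * rnorm (l *: a + b) + (rnorm l * (2 * rnorm a) + 2 * rnorm b))).
- move=> g h; have betaB c : beta c (g - h) = beta c g - beta c h by exact: raddfB.
  rewrite /F !betaB scalerBr.
  have -> : l *: beta a g - l *: beta a h + (beta b g - beta b h) =
      l *: beta a g + beta b g - (l *: beta a h + beta b h) by rewrite opprD addrACA.
  exact: subrBB.
- move=> k g; rewrite /F => H.
  have betaZ c : beta c (k *: g) = k *: beta c g by exact: linearZ.
  rewrite !betaZ scalerA [l * k]mulrC -scalerA -scalerDr.
  by rewrite -scalerBr H scaler0.
- move=> g; rewrite /F (le_trans (ler_rnormD _ _))// mulrDl rnormN lerD//.
  rewrite (le_trans (ler_rnormD _ _))// mulrDl lerD// rnormZc -mulrA.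
  by rewrite ler_wpM2l ?rnorm_ge0.
- move=> k; rewrite /F !beta_power (wimg_linear Tnorm Tcop).
  by rewrite subrr.
Qed.

Lemma beta_mul a b c f g h :
  beta a f * cstar (beta b g) * beta c h =
  beta (cmul (cmul a (cstar b)) c) (cmul (cmul f (cstar g)) h).
Proof.
set d := cmul _ c.
have d_norm f' g' h' : rnorm (beta d (cmul (cmul f' (cstar g')) h')) <=
    2 * rnorm d * (rnorm f' * rnorm g' * rnorm h').
  rewrite (le_trans (beta_norm _ _))// ler_wpM2l ?mulr_ge0 ?rnorm_ge0//.
  rewrite (le_trans (rnormM _ _))// ler_wpM2r ?rnorm_ge0//.
  by rewrite (le_trans (rnormM _ _))// rnormS.
have m_norm f' g' h' : rnorm (beta a f' * cstar (beta b g') * beta c h') <=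
    2 * rnorm a * rnorm f' * (2 * rnorm b * rnorm g') * (2 * rnorm c * rnorm h').
  apply: (le_trans (urnormM _ _)); apply: ler_pM; rewrite ?rnorm_ge0 ?beta_norm//.
  apply: (le_trans (urnormM _ _)); rewrite rnormS.
  by apply: ler_pM; rewrite ?rnorm_ge0 ?beta_norm.
pose F f g h := beta a f * cstar (beta b g) * beta c h - beta d (cmul (cmul f (cstar g)) h).
have F_norm f' g' h' : rnorm (F f' g' h') <=
    (8 * rnorm a * rnorm b * rnorm c + 2 * rnorm d) * (rnorm f' * rnorm g' * rnorm h').
  rewrite /F (le_trans (ler_rnormD _ _))// rnormN mulrDl lerD//.
  rewrite (le_trans (m_norm _ _ _))// le_eqVlt; apply/orP; left; apply/eqP; ring.
set K := _ + _ in F_norm.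
suff : F f g h = 0 by move=> /eqP; rewrite subr_eq0 => /eqP.
apply: (@cone_dense_eq0 _ _ (fun f => F f g h) (K * (rnorm g * rnorm h))).
- move=> x y; rewrite /F raddfB /= !mulrBl !cmulDl !cmulNl raddfB /=.
  exact: subrBB.
- move=> k x; rewrite /F linearZ /= -!scalerAl !cmulZl linearZ /= -scalerBr => ->.
  by rewrite scaler0.
- move=> x; rewrite (le_trans (F_norm _ _ _))// le_eqVlt; apply/orP; left; apply/eqP; ring.
move=> i; apply: (@cone_dense_eq0 _ _ (fun g => F (odd_power i) g h)
  (K * (rnorm (@odd_power R i) * rnorm h))).
- move=> x y; rewrite /F raddfB /= cstarB mulrBr mulrBl cstarD cstarN.
  rewrite cmulDr cmulNr cmulDl cmulNl raddfB /=.
  exact: subrBB.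
- move=> k x; rewrite /F linearZ /= !cstarZ -!scalerAr -!scalerAl cmulZr cmulZl linearZ /=.
  by rewrite -scalerBr => ->; rewrite scaler0.
- move=> x; rewrite (le_trans (F_norm _ _ _))// le_eqVlt; apply/orP; left; apply/eqP; ring.
move=> j; apply: (@cone_dense_eq0 _ _ (fun h => F (odd_power i) (odd_power j) h)
  (K * (rnorm (@odd_power R i) * rnorm (@odd_power R j)))).
- move=> x y; rewrite /F raddfB /= mulrBr cmulDr cmulNr raddfB /=.
  exact: subrBB.
- move=> k x; rewrite /F linearZ /= -scalerAr cmulZr linearZ /= -scalerBr => ->.
  by rewrite scaler0.
- move=> x; rewrite (le_trans (F_norm _ _ _))// le_eqVlt; apply/orP; left; apply/eqP; ring.
move=> k; rewrite /F !beta_power odd_power_mul beta_power /d.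
by rewrite (wimg_mul Tnorm Tcop) subrr.
Qed.

(** Let u and v be the images of f and g.  By the triple product formula u v^* v and
    u u^* v vanish; multiplied by u^* on the right and by v^* on the left, these are
    the products of u v^* and of u^* v with their adjoints. *)
Lemma beta_orthogonal a b f g :
  (forall t, cone_fun f t * cone_fun g t = 0) ->
  (forall t, cone_fun g t = Num.conj (cone_fun g t)) ->
  beta a f * cstar (beta b g) = 0 /\ cstar (beta a f) * beta b g = 0.
Proof.
move=> fg gg.
have fgh (h : C0 R) : cmul (cmul f (cstar g)) h = 0.
  apply/val_inj/funext => t.
  change (cone_fun f t * Num.conj (cone_fun g t) * cone_fun h t = 0).
  by rewrite -gg fg mul0r.
have hfg (h : C0 R) : cmul (cmul h (cstar f)) g = 0.
  apply/val_inj/funext => t.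
  change (cone_fun h t * Num.conj (cone_fun f t) * cone_fun g t = 0).
  by rewrite gg -mulrA -rmorphM fg rmorph0 mulr0.
split.
  by apply: mul_star_eq0; rewrite ustarM cstarK mulrA beta_mul fgh linear0 mul0r.
apply: star_mul_eq0; rewrite ustarM cstarK -mulrA (mulrA (beta a f)) beta_mul.
by rewrite hfg linear0 mulr0.
Qed.

End TensorCalculus.

(** * The supremum norm estimate *)

Section TentBound.
Context {R : realType} {A B : cstarAlgType R}.
Variable T : {linear A -> B}.
Hypothesis Tnorm : forall a, rnorm (T a) <= rnorm a.
Hypothesis Tcop : completely_orthogonality_preserving T.
Local Notation U := (unitization B).
Implicit Types (a b c : A) (k n : nat) (f g : C0 R) (s : seq (C0 R * A)).

Variable beta : A -> {linear C0 R -> U}.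
Hypothesis beta_norm : forall a f, rnorm (beta a f) <= 2 * rnorm a * rnorm f.
Hypothesis beta_poly : forall a q, beta a (odd_poly_fun q) = wpoly T q a.

Lemma tent_le1 (x : R) : tent x <= 1.
Proof.
by rewrite tentE; case: (ger0P x); case: (ger0P (x - 1)); case: (ger0P (x + 1)); lra.
Qed.

Lemma hat_norm n k : rnorm (hat n k : C0 R) <= 1.
Proof.
rewrite cone_rnormE; apply: cone_sup_le => t t01.
by rewrite hatE// rnormRC ger0_norm ?tent_ge0 ?tent_le1.
Qed.

Lemma hat_conj n k (t : R) : cone_fun (hat n k) t = Num.conj (cone_fun (hat n k) t).
Proof.
have [t01|t01] := boolP (t \in `]0, 1]); first by rewrite hatE// conjRC.
by rewrite cone_out// conjC0.
Qed.

Lemma hat_mul0 n k l (t : R) : (k.+1 < l)%N -> cone_fun (hat n k) t * cone_fun (hat n l) t = 0.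
Proof.
move=> kl; have [t01|t01] := boolP (t \in `]0, 1]); last by rewrite cone_out// mul0r.
rewrite !hatE// -rmorphM.
have kl2 : k.+1%:R + 2 <= l.+1%:R :> R by rewrite -natrD ler_nat addn2.
suff -> : tent (n%:R * t - k.+1%:R) * tent (n%:R * t - l.+1%:R) = 0 by rewrite rmorph0.
have [h|h] := leP 1 `|n%:R * t - k.+1%:R|; first by rewrite tent_out// mul0r.
rewrite [X in _ * X]tent_out ?mulr0//.
move: h; rewrite ltr_norml => /andP[h1 h2].
by rewrite ler0_norm; lra.
Qed.

Lemma beta_sum_arg (I : Type) (r : seq I) (F : I -> R[i]) (a : I -> A) f :
  beta (\sum_(i <- r) F i *: a i) f = \sum_(i <- r) F i *: beta (a i) f.
Proof.
have b0 : beta 0 f = 0.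
  apply: rnorm0_eq0; apply/le_anti; rewrite rnorm_ge0 andbT.
  by rewrite (le_trans (beta_norm _ _))// rnorm0 mulr0 mul0r.
elim: r => [|i r IH]; first by rewrite !big_nil.
by rewrite !big_cons (beta_linear_arg Tnorm Tcop beta_norm beta_poly) IH.
Qed.

(** Tents of the same parity have disjoint supports, so their images are orthogonal
    and the sum of these is bounded by the largest of them.  Both parities together
    cost a factor 2, and the other factor 2 is the one in the bound on beta. *)
Lemma hat_sum_norm n (b : nat -> A) (N : R) : 0 <= N ->
  (forall k, (k < n)%N -> rnorm (b k) <= N) ->
  rnorm (\sum_(k < n) beta (b k) (hat n k)) <= 4 * N.
Proof.
move=> N0 bN.
have half (P : pred 'I_n) : (forall k l : 'I_n, P k -> P l -> odd k = odd l) ->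
    rnorm (\sum_(k < n | P k) beta (b k) (hat n k)) <= 2 * N.
  move=> Podd; rewrite -big_filter; apply: orthogonal_sum_norm.
  - by rewrite mulr_ge0.
  - by rewrite filter_uniq// index_enum_uniq.
  - move=> k _; rewrite (le_trans (beta_norm _ _))// -[leRHS]mulr1.
    by apply: ler_pM; rewrite ?mulr_ge0 ?rnorm_ge0 ?hat_norm// ler_wpM2l// bN.
  - move=> k l; rewrite !mem_filter => /andP[Pk _] /andP[Pl _] kl.
    have okl := Podd _ _ Pk Pl.
    have {}kl : (k.+1 < l)%N || (l.+1 < k)%N.
      move: kl okl; rewrite -val_eqE /= neq_ltn => /orP[] kl okl; apply/orP.
        left; rewrite ltn_neqAle kl andbT; apply/eqP => e; move: okl.
        by rewrite -e /=; case: odd.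
      right; rewrite ltn_neqAle kl andbT; apply/eqP => e; move: okl.
      by rewrite -e /=; case: odd.
    apply: (beta_orthogonal Tnorm Tcop beta_norm beta_poly) => t; last exact: hat_conj.
    by move: kl => /orP[] kl; [|rewrite mulrC]; exact: hat_mul0.
rewrite (bigID (fun k : 'I_n => odd k)) /= (le_trans (ler_rnormD _ _))//.
have -> : 4 * N = 2 * N + 2 * N by ring.
apply: lerD; apply: half => k l; first by move=> -> ->.
by move=> /negbTE -> /negbTE ->.
Qed.

(** Up to an arbitrarily small error, each f is replaced by its interpolation at the
    nodes k / n.  The tensor then becomes a sum of tents with coefficients its
    values at the nodes. *)
Lemma beta_comb_norm s (N : R) :
  (forall t, t \in `]0, 1] -> rnorm (cone_comb s t) <= N) ->
  rnorm (\sum_(p <- s) beta p.2 p.1) <= 4 * N.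
Proof.
move=> sN; apply/ler_addgt0Pl => eps eps0.
have N0 : 0 <= N by apply: le_trans (sN 1 _); rewrite ?rnorm_ge0// in_itv/= ltr01 lexx.
pose K := \sum_(p <- s) 2 * rnorm p.2 + 1.
have S0 : 0 <= \sum_(p <- s) 2 * rnorm p.2.
  by apply: sumr_ge0 => p _; rewrite mulr_ge0// rnorm_ge0.
have K0 : 0 < K by rewrite ltr_wpDl.
have [n nP] := hat_interpolation_approx [seq p.1 | p <- s] (divr_gt0 eps0 K0).
have E : \sum_(p <- s) beta p.2 (hat_interpolation n p.1) =
    \sum_(k < n) beta (cone_comb s (k.+1%:R / n%:R)) (hat n k).
  rewrite /cone_comb; under [RHS]eq_bigr do rewrite beta_sum_arg.
  rewrite exchange_big /=; apply: eq_bigr => p _.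
  by rewrite linear_sum; apply: eq_bigr => k _; rewrite linearZ.
have -> : \sum_(p <- s) beta p.2 p.1 = \sum_(p <- s) beta p.2 (p.1 - hat_interpolation n p.1) +
    \sum_(k < n) beta (cone_comb s (k.+1%:R / n%:R)) (hat n k).
  by rewrite -E -big_split /=; apply: eq_bigr => p _; rewrite raddfB subrK.
rewrite (le_trans (ler_rnormD _ _))// lerD//.
  rewrite (le_trans (rnorm_sum _ _))//.
  apply: (@le_trans _ _ (\sum_(p <- s) 2 * rnorm p.2 * (eps / K))).
    rewrite big_seq [leRHS]big_seq; apply: ler_sum => p ps.
    rewrite (le_trans (beta_norm _ _))// ler_wpM2l ?mulr_ge0 ?rnorm_ge0//.
    by apply: nP; apply/mapP; exists p.
  rewrite -mulr_suml mulrC mulrAC ler_pdivrMr// ler_wpM2l ?(ltW eps0)//.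
  by rewrite lerDl.
apply: (@hat_sum_norm n (fun k => cone_comb s (k.+1%:R / n%:R))) => // k kn.
apply: sN; rewrite in_itv/=.
have n0 : 0 < n%:R :> R by rewrite ltr0n (leq_trans _ kn).
by rewrite divr_gt0// ler_pdivrMr// mul1r ler_nat.
Qed.

End TentBound.

(** * The correspondence *)

Lemma wimg_uscal (R : realType) (A B : cstarAlgType R) (T : {linear A -> B}) k a :
  (forall a, rnorm (T a) <= rnorm a) -> completely_orthogonality_preserving T ->
  uscal (wimg T k a) = 0.
Proof.
move=> Tnorm Tcop; case: k => [|k]; first by rewrite (wimg0 Tnorm Tcop).
apply: (@additive_triple_eq0 _ _ R[i] (fun a => uscal (wimg T k.+1 a)) 1) => [b c|b|b c d].
- by rewrite (wimgB Tnorm Tcop).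
- by rewrite mul1r (le_trans (rnorm_uscal _))// (wimg_norm Tnorm Tcop).
- by rewrite (wimg_step Tnorm Tcop) -mulrA rmorphM {1}/img /= mul0r.
Qed.

Section TensorExtension.
Context {R : realType} {A B D : cstarAlgType R}.
Variable ten : {bilinear C0 R -> A -> D}.
Hypothesis tenP : is_cstar_tensor ten.
Local Notation U := (unitization B).
Implicit Types (a b c : A) (f g h : C0 R) (s : seq (C0 R * A)) (x y z : D).

Lemma tensor_sum_dense x (eps : R) : 0 < eps ->
  exists s, rnorm (x - \sum_(p <- s) ten p.1 p.2) < eps.
Proof.
move=> eps0; have : closure (range (fun s => \sum_(p <- s) ten p.1 p.2)) x.
  by rewrite (tensor_dense tenP).
have nx : nbhs x [set y | rnorm (x - y) < eps].
  apply/nbhs_ballP; exists (real_complex R eps); first by rewrite /= ltcR.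
  by move=> y; rewrite -ball_normE /= rnormE ltcR.
by move=> /(_ _ nx)[_ [[s _ <-] /=]] xs; exists s.
Qed.

Lemma tensor_dense_eq0 (V : normedModType R[i]) (F : D -> V) (C : R) :
  (forall x y, F (x - y) = F x - F y) -> (forall x, rnorm (F x) <= C * rnorm x) ->
  (forall f a, F (ten f a) = 0) -> forall x, F x = 0.
Proof.
move=> FB FC F0.
have F00 : F 0 = 0 by rewrite -(subrr 0) FB subrr.
have FD u v : F (u + v) = F u + F v.
  by rewrite -{1}[v]opprK FB -[- v]sub0r FB F00 sub0r opprK.
apply: (additive_dense_eq0 FB FC
  (S := range (fun s => \sum_(p <- s) ten p.1 p.2))) => [x eps eps0|].
  have [s xs] := tensor_sum_dense x eps0.
  by exists (\sum_(p <- s) ten p.1 p.2); split => //; exists s.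
by move=> _ [s _ <-]; rewrite (big_morph F FD F00) big1// => p _; exact: F0.
Qed.

(** By triple products, the values on w (x) a determine those on w^(2k+1) (x) a;
    these elements span a dense subspace, and both maps are contractive. *)
Lemma tro_hom_eq (Phi Psi : tro_hom D B) :
  (forall a, Phi (ten cone_id a) = Psi (ten cone_id a)) -> forall x, Phi x = Psi x.
Proof.
move=> PP x; apply/eqP; rewrite -subr_eq0; apply/eqP.
have Phi1 := tro_hom_contractive (tro_homP Phi).
have Psi1 := tro_hom_contractive (tro_homP Psi).
pose F x := Phi x - Psi x.
have PB (P : tro_hom D B) y z : P (y - z) = P y - P z by exact: raddfB.
have FB y z : F (y - z) = F y - F z by rewrite /F !PB; exact: subrBB.
have FZ (k : R[i]) y : F y = 0 -> F (k *: y) = 0.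
  have PZ (P : tro_hom D B) : P (k *: y) = k *: P y by exact: linearZ.
  by rewrite /F !PZ -scalerBr => ->; rewrite scaler0.
have FC y : rnorm (F y) <= 2 * rnorm y.
  by rewrite (le_trans (ler_rnormD _ _))// rnormN mulr_natl mulr2n lerD.
apply: (tensor_dense_eq0 FB FC) => f a.
apply: (@cone_dense_eq0 _ _ (fun f => F (ten f a)) (2 * rnorm a)) => [g h|k g|g|k].
- by rewrite linearBl FB.
- by rewrite linearZl_LR; exact: FZ.
- rewrite (le_trans (FC _))// -mulrA ler_wpM2l// mulrC.
  exact: tensor_norm_le.
elim: k a => [|k IH] a; first by rewrite /F PP subrr.
apply: (@additive_triple_eq0 _ _ _ (fun a => F (ten (odd_power k.+1) a))
  (2 * rnorm (@odd_power R k.+1))) => [b c|b|b c d].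
- by rewrite linearBr FB.
- by rewrite (le_trans (FC _))// -mulrA ler_wpM2l//; exact: tensor_norm_le.
have := @odd_power_mul R 0 0 k; rewrite !add0n => <-.
rewrite -!(tensor_mul tenP) -(tensor_star tenP) /F (tro_homP Phi) (tro_homP Psi).
rewrite [odd_power 0]/cone_id !PP.
by have /eqP := IH d; rewrite subr_eq0 => /eqP ->; rewrite subrr.
Qed.

(** The map defined on sums of elementary tensors is bounded for the supremum norm,
    hence for the norm of D, and extends.  Multiplicativity passes to the limit in
    each variable.  The values lie in the unitization of B, and in B itself because
    their scalar parts vanish on elementary tensors. *)
Lemma tro_hom_of_cop (T : contractive_cop A B) :
  exists Phi : tro_hom D B, forall a, Phi (ten cone_id a) = T a.
Proof.
have Tnorm a : rnorm (T a) <= rnorm a by rewrite -lecR -!rnormE; exact: cop_contractive.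
have Tcop := cop_cop T.
have /choice[beta betaP] := calculus_exists Tnorm Tcop.
have beta_norm a f : rnorm (beta a f) <= 2 * rnorm a * rnorm f by have [] := betaP a.
have beta_poly a q : beta a (odd_poly_fun q) = wpoly T q a by have [_] := betaP a.
have [||||Phi [PhiC PhiE]] := @dense_extension R D U (fun x u => exists s,
    x = \sum_(p <- s) ten p.1 p.2 /\ u = \sum_(p <- s) beta p.2 p.1) 4.
- by [].
- move=> k _ _ _ _ [s [-> ->]] [r [-> ->]].
  exists ([seq (k *: p.1, p.2) | p <- s] ++ r); rewrite !big_cat !big_map /= !scaler_sumr.
  by split; congr (_ + _); apply: eq_bigr => p _; rewrite ?linearZl_LR ?linearZ.
- move=> _ _ [s [-> ->]]; apply: (beta_comb_norm Tnorm Tcop beta_norm beta_poly).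
  by move=> t t01; exact: cone_comb_norm_le.
- move=> x eps eps0; have [s xs] := tensor_sum_dense x eps0.
  by exists (\sum_(p <- s) ten p.1 p.2), (\sum_(p <- s) beta p.2 p.1); split => //; exists s.
have Phi_ten f a : Phi (ten f a) = beta a f.
  by apply: PhiE; exists [:: (f, a)]; rewrite !big_seq1.
have PhiB u v : Phi (u - v) = Phi u - Phi v by exact: raddfB.
have Phi_mul x y z : Phi (cmul (cmul x (cstar y)) z) = Phi x * cstar (Phi y) * Phi z.
  pose F x y z := Phi (cmul (cmul x (cstar y)) z) - Phi x * cstar (Phi y) * Phi z.
  (* Phi is bounded by 4, and 68 = 4 + 4 ^ 3 *)
  have FC x' y' z' : rnorm (F x' y' z') <= 68 * (rnorm x' * rnorm y' * rnorm z').
    rewrite (le_trans (ler_rnormD _ _))// rnormN.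
    have h1 : rnorm (Phi (cmul (cmul x' (cstar y')) z')) <= 4 * (rnorm x' * rnorm y' * rnorm z').
      rewrite (le_trans (PhiC _))// ler_wpM2l// (le_trans (rnormM _ _))//.
      by rewrite ler_wpM2r ?rnorm_ge0// (le_trans (rnormM _ _))// rnormS.
    have h2 : rnorm (Phi x' * cstar (Phi y') * Phi z') <=
        4 * rnorm x' * (4 * rnorm y') * (4 * rnorm z').
      apply: (le_trans (urnormM _ _)); apply: ler_pM; rewrite ?rnorm_ge0 ?PhiC//.
      apply: (le_trans (urnormM _ _)); rewrite rnormS.
      by apply: ler_pM; rewrite ?rnorm_ge0 ?PhiC.
    by rewrite (le_trans (lerD h1 h2))// le_eqVlt; apply/orP; left; apply/eqP; ring.
  suff : F x y z = 0 by move=> /eqP; rewrite subr_eq0 => /eqP.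
  apply: (@tensor_dense_eq0 _ (fun x => F x y z) (68 * (rnorm y * rnorm z))) => [u v|u|f a].
  - by rewrite /F !cmulDl !cmulNl !PhiB !mulrBl; exact: subrBB.
  - by rewrite (le_trans (FC _ _ _))// le_eqVlt; apply/orP; left; apply/eqP; ring.
  apply: (@tensor_dense_eq0 _ (fun y => F _ y z) (68 * (rnorm (ten f a) * rnorm z))) => [u v|u|g b].
  - rewrite /F cstarD cstarN cmulDr cmulNr cmulDl cmulNl !PhiB cstarB mulrBr mulrBl.
    exact: subrBB.
  - by rewrite (le_trans (FC _ _ _))// le_eqVlt; apply/orP; left; apply/eqP; ring.
  apply: (@tensor_dense_eq0 _ (fun z => F _ _ z)
    (68 * (rnorm (ten f a) * rnorm (ten g b)))) => [u v|u|h c].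
  - by rewrite /F cmulDr cmulNr !PhiB mulrBr; exact: subrBB.
  - by rewrite (le_trans (FC _ _ _))// le_eqVlt; apply/orP; left; apply/eqP; ring.
  rewrite /F (tensor_star tenP) !(tensor_mul tenP) !Phi_ten.
  by rewrite (beta_mul Tnorm Tcop beta_norm beta_poly) subrr.
have Phi_scal x : uscal (Phi x) = 0.
  apply: (@tensor_dense_eq0 R[i] (fun x => uscal (Phi x)) 4) => [u v|u|f a].
  - by rewrite raddfB.
  - by rewrite (le_trans (rnorm_uscal _))// PhiC.
  rewrite Phi_ten.
  apply: (@cone_dense_eq0 _ R[i] (fun f => uscal (beta a f)) (2 * rnorm a)) => [g h|k g|g|k].
  - by rewrite raddfB.
  - by rewrite linearZ /= => e; change (k * uscal (beta a g) = 0); rewrite e mulr0.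
  - by rewrite (le_trans (rnorm_uscal _))// beta_norm.
  by rewrite (beta_power beta_poly) (wimg_uscal _ _ Tnorm Tcop).
have PhiI x : inj (Phi x).2 = Phi x by rewrite -uscal0_inj.
pose Psi x : B := (Phi x).2.
have Psi_lin : linear Psi.
  by move=> k x y; apply: inj_inj; rewrite injD injZ !PhiI linearP.
pose L : {linear D -> B} := HB.pack Psi (GRing.isLinear.Build _ _ _ _ Psi Psi_lin).
have L_tro : is_tro_hom L.
  by move=> x y z; apply: inj_inj; rewrite !injM inj_star !PhiI Phi_mul.
exists (TroHom L_tro) => a; apply: inj_inj; rewrite [LHS]PhiI Phi_ten.
rewrite (_ : cone_id = odd_power 0)// (beta_power beta_poly).
by rewrite (wimg0 Tnorm Tcop).
Qed.

(** If u is an entry of the product of T(x) and T(y)^*, then u Phi(z) is the image of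
    (w w^* (x) r) z with r the corresponding entry of x y^*, that is, 0.  Since u^* is
    a sum of products that start with values of Phi, also u u^* = 0.  The other
    product is handled symmetrically. *)
Lemma tro_hom_cop (Phi : tro_hom D B) :
  completely_orthogonality_preserving (fun a => Phi (ten cone_id a)).
Proof.
move=> n x y [xy yx]; set T := fun a => _.
have cmul_suml (V : cstarAlgType R) (I : Type) (r : seq I) (F : I -> V) v :
    cmul (\sum_(i <- r) F i) v = \sum_(i <- r) cmul (F i) v.
  by elim: r => [|i r IH]; rewrite ?big_nil ?cmul0l// !big_cons cmulDl IH.
have cmul_sumr (V : cstarAlgType R) (I : Type) (r : seq I) (F : I -> V) v :
    cmul v (\sum_(i <- r) F i) = \sum_(i <- r) cmul v (F i).
  by elim: r => [|i r IH]; rewrite ?big_nil ?cmul0r// !big_cons cmulDr IH.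
have cstar_sum (V : cstarAlgType R) (I : Type) (r : seq I) (F : I -> V) :
    cstar (\sum_(i <- r) F i) = \sum_(i <- r) cstar (F i).
  by elim: r => [|i r IH]; rewrite ?big_nil ?cstar0// !big_cons cstarD IH.
split; apply/matrixP => i j; rewrite !mxE.
  set u := \sum_k _.
  have u_range z : cmul u (Phi z) = 0.
    have -> : cmul u (Phi z) = Phi (cmul (ten (cmul cone_id (cstar cone_id))
        (\sum_k cmul (x i k) (mx_cstar y k j))) z).
      rewrite {1}/u cmul_suml linear_sumr /= cmul_suml linear_sum; apply: eq_bigr => k _.
      by rewrite !mxE -(tensor_mul tenP) -(tensor_star tenP) tro_homP.
    have := congr1 (fun M : 'M[A]_n => M i j) xy; rewrite !mxE => ->.
    by rewrite linear0r cmul0l linear0.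
  have uu : cmul u (cstar u) = 0.
    rewrite {2}/u cstar_sum cmul_sumr big1// => k _.
    by rewrite !mxE cstarM cstarK cmulA u_range cmul0l.
  apply: rnorm0_eq0; apply/eqP; rewrite -sqrf_eq0 -rnormS -rnorm_star cstarK.
  by rewrite uu rnorm0.
set u := \sum_k _.
have u_range z : cmul (Phi z) u = 0.
  have -> : cmul (Phi z) u = Phi (cmul z (ten (cmul (cstar cone_id) cone_id)
      (\sum_k cmul (mx_cstar y i k) (x k j)))).
    rewrite {1}/u cmul_sumr linear_sumr /= cmul_sumr linear_sum; apply: eq_bigr => k _.
    by rewrite !mxE -(tensor_mul tenP) -(tensor_star tenP) [cmul z _]cmulA tro_homP cmulA.
  have := congr1 (fun M : 'M[A]_n => M i j) yx; rewrite !mxE => ->.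
  by rewrite linear0r cmul0r linear0.
have uu : cmul (cstar u) u = 0.
  rewrite {1}/u cstar_sum cmul_suml big1// => k _.
  by rewrite !mxE cstarM cstarK -cmulA u_range cmul0r.
by apply: rnorm0_eq0; apply/eqP; rewrite -sqrf_eq0 -rnorm_star uu rnorm0.
Qed.

Lemma cone_id_norm : rnorm (cone_id : C0 R) <= 1.
Proof.
rewrite cone_rnormE; apply: cone_sup_le => t t01; rewrite /= t01 rnormRC.
by move: t01; rewrite in_itv/= => /andP[t0 t1]; rewrite gtr0_norm.
Qed.

Lemma cop_of_tro_hom (Phi : tro_hom D B) :
  exists T : contractive_cop A B, forall a, T a = Phi (ten cone_id a).
Proof.
pose T a := Phi (ten cone_id a).
have T_lin : linear T by move=> k a b; rewrite /T linearPr /= linearP.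
pose L : {linear A -> B} := HB.pack T (GRing.isLinear.Build _ _ _ _ T T_lin).
have Lc : contractive L.
  move=> a; rewrite !rnormE lecR (le_trans (tro_hom_contractive (tro_homP Phi) _))//.
  rewrite (le_trans (tensor_norm_le tenP _ _))// ler_piMl ?rnorm_ge0//.
  exact: cone_id_norm.
by exists (ContractiveCop Lc (tro_hom_cop Phi)).
Qed.

End TensorExtension.

Theorem corollary21 (R : realType) (A B : cstarAlgType R)
    (D : cstar_tensor (C0 R) A) :
  exists (PhiOf : contractive_cop A B -> tro_hom D B)
         (TOf : tro_hom D B -> contractive_cop A B),
    [/\ forall (T : contractive_cop A B) (a : A),
          PhiOf T (tensor D cone_id a) = T a,
        forall (Phi : tro_hom D B) (a : A),
          TOf Phi a = Phi (tensor D cone_id a),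
        forall (T : contractive_cop A B) (a : A), TOf (PhiOf T) a = T a &
        forall (Phi : tro_hom D B) (x : D), PhiOf (TOf Phi) x = Phi x].
Proof.
have /choice[PhiOf PhiOfE] := @tro_hom_of_cop R A B D (tensor D) (tensorP D).
have /choice[TOf TOfE] := @cop_of_tro_hom R A B D (tensor D) (tensorP D).
exists PhiOf, TOf; split => // [T a|Phi]; first by rewrite TOfE PhiOfE.
by apply: (tro_hom_eq (tensorP D)) => a; rewrite PhiOfE TOfE.
Qed.
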